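(* For all integers $1\le m<n$ there exists an $m$-subharmonic germ $u$ at the origin of $\mathbb C^n$ (i.e. an $m$-subharmonic function on a neighborhood of $0$) such that $\nu_u(0)=0$, yet for every $\gamma>0$ the function $e^{-\gamma u}$ is not Lebesgue integrable on any neighborhood of $0$.
   Context: Let $\beta=dd^c|z|^2$ on $\mathbb C^n$. A real constant-coefficient $(1,1)$-form $\alpha$ is $m$-positive if $\alpha^k\wedge\beta^{n-k}\ge0$ for $1\le k\le m$. For an open set $\Omega\subset\mathbb C^n$, a locally integrable, upper semicontinuous function $u:\Omega\to[-\infty,\infty)$ is $m$-subharmonic, written $u\in \mathrm{SH}_m(\Omega)$, if it is subharmonic and $dd^c u\wedge\alpha_1\wedge\cdots\wedge\alpha_{m-1}\wedge\beta^{n-m}\ge0$ (as a current) for all constant-coefficient $m$-positive $(1,1)$-forms $\alpha_j$. For $u\in C^2$ this is equivalent to nonnegativity of the first $m$ elementary symmetric functions of the eigenvalues of the complex Hessian. For $1\le m<n$ put $\phi_m(r)=-\dfrac{1}{(n/m-1)\,r^{2(n/m-1)}}$, $r>0$. The $m$-Lelong number of an $m$-subharmonic function $u$ at $a$ is $$\nu_u(a)=2\lim_{r\downarrow0}\frac{\lambda(u,a,r)}{\phi_m(r)},$$ where $\lambda(u,a,r)$ is the mean value of $u$ over the sphere $\{|z-a|=r\}$ (the limit is known to exist). *)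

(* Defs.v *)
From HB Require Import structures.
From mathcomp Require Import all_boot all_order all_algebra.
From mathcomp Require Import complex.
From mathcomp Require Import all_classical all_reals all_analysis.

Set Implicit Arguments.
Unset Strict Implicit.
Unset Printing Implicit Defensive.

Import Order.TTheory GRing.Theory Num.Theory.
Import numFieldNormedType.Exports.

Local Open Scope classical_set_scope.
Local Open Scope ring_scope.

(* R^N = 'rV[R]_N carries the sigma-algebra generated by the coordinates, which
   is its Borel sigma-algebra. *)
Section measurable_rV.
Context {R : realType} {N : nat}.

Let coors : 'I_N -> 'rV[R]_N -> R := fun i x => x 0 i.

Let rV_set0 : g_sigma_preimage coors set0.
Proof. exact: sigma_algebra0. Qed.

Let rV_setC A : g_sigma_preimage coors A -> g_sigma_preimage coors (~` A).
Proof. exact: sigma_algebraC. Qed.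

Let rV_bigcup (F : _^nat) : (forall i, g_sigma_preimage coors (F i)) ->
  g_sigma_preimage coors (\bigcup_i (F i)).
Proof. exact: sigma_algebra_bigcup. Qed.

HB.instance Definition _ := @isMeasurable.Build default_measure_display
  'rV[R]_N (g_sigma_preimage coors) rV_set0 rV_setC rV_bigcup.

End measurable_rV.

Lemma measurable_coor (R : realType) (N : nat) (i : 'I_N) :
  measurable_fun [set: 'rV[R]_N] (fun x : 'rV[R]_N => x 0 i).
Proof.
move=> _ Y mY; rewrite setTI; apply: sub_sigma_algebra => /=.
rewrite -bigcup_seq/=; exists i => /=; first by rewrite mem_index_enum.
by exists Y => //; rewrite setTI.
Qed.

Lemma measurable_fun_rVP (R : realType) (N : nat) d (T : measurableType d)
    (f : T -> 'rV[R]_N) :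
  (forall i, measurable_fun [set: T] (fun t => f t 0 i)) ->
  measurable_fun [set: T] f.
Proof.
move=> mf; suff H : g_sigma_preimage (fun i t => f t 0 i) `<=` measurable.
  move=> _ A mA; rewrite setTI; apply: H.
  have := @g_sigma_preimage_comp _ R N 'rV[R]_N (fun i x => x 0 i) T f.
  rewrite /comp => ->; exists A => //; by rewrite setTI.
apply: smallest_sub; first exact: sigma_algebra_measurable.
case: N f mf => [|N] f mf; first by rewrite big_ord0.
rewrite -bigcup_mkord_ord; apply: bigcup_sub => i Ii.
by move=> A [B mB <-]; exact: mf.
Qed.

Definition consV (R : realType) (N : nat) (p : measurableTypeR R * 'rV[R]_N) : 'rV[R]_N.+1 :=
  row_mx (p.1%:M : 'rV[R]_1) p.2.

Lemma measurable_consV (R : realType) (N : nat) :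
  measurable_fun [set: measurableTypeR R * 'rV[R]_N] (@consV R N).
Proof.
apply: measurable_fun_rVP => i.
case: (splitP (i : 'I_(1 + N))) => [j ij|k ik].
  have -> : i = lshift N j by apply/val_inj.
  rewrite (_ : (fun t => _) = fst); first exact: measurable_fst.
  apply/funext => -[a b] /=; rewrite /consV (row_mxEl (a%:M : 'rV[R]_1) b).
  by rewrite ord1 mxE eqxx mulr1n.
have -> : i = rshift 1 k by apply/val_inj.
rewrite (_ : (fun t => _) = (fun x : 'rV[R]_N => x 0 k) \o snd).
  by apply: measurableT_comp; [exact: measurable_coor|exact: measurable_snd].
by apply/funext => -[a b] /=; rewrite /consV (row_mxEr (a%:M : 'rV[R]_1) b).
Qed.

Section lebS.
Context {R : realType} {N : nat}.
Variable mu : {sigma_finite_measure set 'rV[R]_N -> \bar R}.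

Definition lebS : set 'rV[R]_N.+1 -> \bar R :=
  pushforward (lebesgue_measure \x mu)%E (@consV R N).

Let m : {measure set (measurableTypeR R * 'rV[R]_N)%type -> \bar R} :=
  (@lebesgue_measure R \x mu)%E.

Let lebS0 : lebS set0 = 0%E.
Proof. by rewrite /lebS /pushforward preimage_set0 (measure0 m). Qed.

Let lebS_ge0 A : (0 <= lebS A)%E.
Proof. exact: (measure_ge0 m). Qed.

Let lebS_sigma_additive : semi_sigma_additive lebS.
Proof.
move=> F mF tF mUF; rewrite /lebS /pushforward preimage_bigcup.
have mc A : measurable A -> measurable (@consV R N @^-1` A).
  by move=> mA; rewrite -[X in measurable X]setTI; exact: measurable_consV.
apply: (@measure_semi_sigma_additive _ _ _ m).
- by move=> k; exact: mc.
- apply/trivIsetP => /= i j _ _ ij; rewrite -preimage_setI.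
  by move/trivIsetP : tF => /(_ _ _ _ _ ij) ->//; rewrite preimage_set0.
- by rewrite -preimage_bigcup; exact: mc.
Qed.

HB.instance Definition _ :=
  isMeasure.Build _ _ _ lebS lebS0 lebS_ge0 lebS_sigma_additive.

Let unconsV (x : 'rV[R]_N.+1) : measurableTypeR R * 'rV[R]_N :=
  (x 0 0, \row_(j < N) x 0 (lift ord0 j)).

Let consVK : cancel (@consV R N) unconsV.
Proof.
move=> [a b]; rewrite /unconsV /consV; congr (_, _).
  transitivity ((row_mx (a%:M : 'rV[R]_1) b) 0 (lshift N 0)).
    by congr (fun_of_matrix _ _ _); exact/val_inj.
  by rewrite row_mxEl mxE eqxx mulr1n.
apply/rowP => j; rewrite mxE (_ : lift _ _ = rshift 1 j); last exact/val_inj.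
exact: (row_mxEr (a%:M : 'rV[R]_1) b).
Qed.

Let measurable_unconsV : measurable_fun setT unconsV.
Proof.
apply: measurable_fun_pair; first exact: measurable_coor.
apply: measurable_fun_rVP => i.
rewrite (_ : (fun t => _) = (fun x : 'rV[R]_N.+1 => x 0 (lift ord0 i))).
  exact: measurable_coor.
by apply/funext => x; rewrite mxE.
Qed.

Let lebS_sigma_finite : sigma_finite setT lebS.
Proof.
have /sigma_finiteP[F [TF ndF Foo]] := sigma_finiteT (@lebesgue_measure R).
have /sigma_finiteP[G [TG ndG Goo]] := sigma_finiteT mu.
exists (fun k => unconsV @^-1` (F k `*` G k)).
  apply/seteqP; split=> // x _.
  have : setT (unconsV x).1 by [].
  rewrite TF => -[i _ Fi].
  have : setT (unconsV x).2 by [].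
  rewrite TG => -[j _ Gj].
  exists (maxn i j) => //; split.
  - by move: Fi; exact/subsetPset/ndF/leq_maxl.
  - by move: Gj; exact/subsetPset/ndG/leq_maxr.
move=> k; have [mF Fk] := Foo k; have [mG Gk] := Goo k; split.
  rewrite -[X in measurable X]setTI; apply: measurable_unconsV => //.
  exact: measurableX.
rewrite /lebS /pushforward (_ : _ @^-1` _ = F k `*` G k).
  by rewrite product_measure1E// lte_mul_pinfty// ge0_fin_numE.
have /funext E : unconsV \o @consV R N =1 id by move=> p; exact: consVK.
by rewrite -comp_preimage E.
Qed.

HB.instance Definition _ :=
  @Measure_isSigmaFinite.Build _ _ _ lebS lebS_sigma_finite.

End lebS.

Fixpoint leb (R : realType) (N : nat) :
    {sigma_finite_measure set 'rV[R]_N -> \bar R} :=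
  match N with
  | 0 => \d_(0 : 'rV[R]_0)
  | N'.+1 => lebS (leb R N')
  end.

(* C^n is 'rV[R]_(n + n): the first n coordinates of z are the real parts
   x_1, ..., x_n and the last n are the imaginary parts y_1, ..., y_n. *)

(* The exterior algebra over C generated by dz_1, ..., dz_n (indices
   lshift n j) and their conjugates (indices rshift n j). A form is given by
   its coefficients on the monomials, that is, on the products of generators
   taken in increasing order of indices. *)
Definition cform (R : realType) (n : nat) := {ffun {set 'I_(n + n)} -> R[i]}.

Definition form1 (R : realType) (n : nat) : cform R n :=
  [ffun S => (S == finset.set0)%:R].

Definition gen (R : realType) (n : nat) (i : 'I_(n + n)) : cform R n :=
  [ffun S => (S == finset.set1 i)%:R].

Definition dz (R : realType) (n : nat) (j : 'I_n) : cform R n :=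
  gen R (lshift n j).

Definition dzb (R : realType) (n : nat) (j : 'I_n) : cform R n :=
  gen R (rshift n j).

Definition fscale (R : realType) (n : nat) (c : R[i]) (w : cform R n) :
    cform R n :=
  [ffun S => c * w S].

Definition inversions (N : nat) (S T : {set 'I_N}) : nat :=
  #|[pred p : 'I_N * 'I_N | [&& p.1 \in S, p.2 \in T & (p.2 < p.1)%N]]|.

Definition wedge (R : realType) (n : nat) (v w : cform R n) : cform R n :=
  [ffun S : {set 'I_(n + n)} => \sum_(T : {set 'I_(n + n)} | T \subset S)
    (-1) ^+ inversions T (S :\: T) * v T * w (S :\: T)].

Definition wedgeX (R : realType) (n : nat) (w : cform R n) (k : nat) :
    cform R n :=
  iter k (wedge w) (form1 R n).

(* dx_1 /\ dy_1 /\ ... /\ dx_n /\ dy_n, since dx /\ dy = (i/2) dz /\ dzb. *)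
Definition vol (R : realType) (n : nat) : cform R n :=
  \big[@wedge R n/form1 R n]_(j < n)
    fscale (Complex 0 2^-1) (wedge (dz R j) (dzb R j)).

Definition mono (R : realType) (n : nat) (S : {set 'I_(n + n)}) : cform R n :=
  [ffun T => (T == S)%:R].

Lemma wedge_mono (R : realType) (n : nat) (S T : {set 'I_(n + n)}) (a b : R[i]) :
  fintype.disjoint (mem S) (mem T) ->
  wedge (fscale a (mono R S)) (fscale b (mono R T)) =
  fscale ((-1) ^+ inversions S T * a * b) (mono R (S :|: T)).
Proof.
move=> dST; apply/ffunP => U; rewrite !ffunE.
have [->{U}|US] := eqVneq U (S :|: T).
  rewrite (bigD1 S) ?finset.subsetUl//= big1 ?addr0 => [|V /andP[_ VS]]; last first.
    by rewrite !ffunE (negbTE VS) !(mulr0, mul0r).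
  rewrite !ffunE eqxx finset.setDUl finset.setDv finset.set0U.
  have -> : T :\: S = T by apply/finset.setDidPl; rewrite fintype.disjoint_sym.
  by rewrite eqxx !mulr1.
rewrite big1 ?mulr0// => V VU; rewrite !ffunE.
have [VS|] := eqVneq V S; last by rewrite !(mulr0, mul0r).
have [UT|] := eqVneq (U :\: V) T; last by rewrite !mulr0.
case/negP: US; apply/eqP; rewrite -UT -VS; apply/finset.setP => x.
rewrite !finset.inE; have /fintype.subsetP/(_ x) := VU.
by case: (x \in V) => //= ->.
Qed.

Lemma vol_neq0 (R : realType) (n : nat) : vol R n finset.setT != 0.
Proof.
pose P (r : seq 'I_n) := [set i | has (fun j => (i == lshift n j) || (i == rshift n j)) r]%SET.
have H (r : seq 'I_n) : uniq r -> exists2 c, c != 0 &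
  \big[@wedge R n/form1 R n]_(j <- r)
    fscale (Complex 0 2^-1) (wedge (dz R j) (dzb R j)) = fscale c (mono R (P r)).
  elim: r => [_|j r IH /= /andP[jr ur]].
    exists 1; first exact: oner_neq0.
    rewrite big_nil; apply/ffunP => S; rewrite !ffunE mul1r.
    by congr (_ == _)%:R; apply/finset.setP => i; rewrite !finset.inE.
  have [c c0 E] := IH ur; rewrite big_cons E.
  have s1 (w : cform R n) : w = fscale 1 w by apply/ffunP => S; rewrite !ffunE mul1r.
  have -> : dz R j = fscale 1 (mono R [set lshift n j]%SET).
    by apply/ffunP => S; rewrite !ffunE mul1r.
  have -> : dzb R j = fscale 1 (mono R [set rshift n j]%SET).
    by apply/ffunP => S; rewrite !ffunE mul1r.
  rewrite wedge_mono; last first.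
    by rewrite disjoints1 finset.inE eq_lrshift.
  rewrite (_ : fscale _ (fscale ?[a] ?[w]) = fscale (Complex 0 2^-1 * ?a) ?w); last first.
    by apply/ffunP => S; rewrite !ffunE mulrA.
  rewrite wedge_mono; last first.
    rewrite finset.disjoints_subset; apply/fintype.subsetP => i; rewrite !finset.inE.
    move=> ij; apply/negP => /hasP[k kr].
    have [kj|kj] := eqVneq k j; first by rewrite -kj kr in jr.
    case/orP: ij => /eqP ->; rewrite ?eq_lrshift ?eq_rlshift ?orbF ?orFb.
      by rewrite (inj_eq (@lshift_inj _ _)) eq_sym (negbTE kj).
    by rewrite (inj_eq (@rshift_inj _ _)) eq_sym (negbTE kj).
  have -> : P (j :: r) = ([set lshift n j] :|: [set rshift n j] :|: P r)%SET.
    by apply/finset.setP => i; rewrite !finset.inE.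
  eexists; last by [].
  rewrite !mulf_neq0// ?expf_neq0 ?oppr_eq0 ?oner_neq0//.
  by rewrite eq_complex/= eqxx/= invr_eq0 pnatr_eq0.
have [c c0] := H _ (index_enum_uniq _).
rewrite (_ : P _ = finset.setT) => [E|].
  by rewrite /vol E !ffunE eqxx mulr1.
apply/finset.setP => i; rewrite !finset.inE; apply/hasP.
by case: (split_ordP i) => j ->; exists j; rewrite ?mem_index_enum// eqxx ?orbT.
Qed.

(* A form w of bidegree (n, n) equals topcoef w times vol. *)
Definition topcoef (R : realType) (n : nat) (w : cform R n) : R[i] :=
  w finset.setT / vol R n finset.setT.

(* In the order of R[i], 0 <= c means that c is real and nonnegative. *)
Definition top_ge0 (R : realType) (n : nat) (w : cform R n) : Prop :=
  0 <= topcoef w.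

(* The (1,1)-form 2i sum_(j,k) A_(j,k) dz_j /\ dzb_k. *)
Definition form11 (R : realType) (n : nat) (A : 'M[R[i]]_n) : cform R n :=
  \sum_(j < n) \sum_(k < n)
    fscale (Complex 0 2 * A j k) (wedge (dz R j) (dzb R k)).

(* The form 2i sum_(j,k) A_(j,k) dz_j /\ dzb_k is real iff A is Hermitian. *)
Definition real11 (R : realType) (n : nat) (w : cform R n) : Prop :=
  exists2 A : 'M[R[i]]_n, (forall j k, A k j = ((A j k)^*)%C) & w = form11 A.

Definition cnorm2 (R : realType) (n : nat) (z : 'rV[R]_(n + n)) : R :=
  \sum_(i < n + n) z 0 i ^+ 2.

Definition cnorm (R : realType) (n : nat) (z : 'rV[R]_(n + n)) : R :=
  Num.sqrt (cnorm2 z).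

Definition d_x (R : realType) (n : nat) (j : 'I_n)
    (f : 'rV[R]_(n + n) -> R) : 'rV[R]_(n + n) -> R :=
  'D_(delta_mx 0 (lshift n j)) f.

Definition d_y (R : realType) (n : nat) (j : 'I_n)
    (f : 'rV[R]_(n + n) -> R) : 'rV[R]_(n + n) -> R :=
  'D_(delta_mx 0 (rshift n j)) f.

(* The second derivatives d^2 f / dz_j dzb_k of a real function f, where
   d/dz_j = (d/dx_j - i d/dy_j) / 2 and d/dzb_k = (d/dx_k + i d/dy_k) / 2. *)
Definition complex_hessian (R : realType) (n : nat)
    (f : 'rV[R]_(n + n) -> R) (z : 'rV[R]_(n + n)) : 'M[R[i]]_n :=
  \matrix_(j < n, k < n)
    Complex ((d_x j (d_x k f) z + d_y j (d_y k f) z) / 4)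
            ((d_x j (d_y k f) z - d_y j (d_x k f) z) / 4).

(* dd^c f at z, with d^c = i (dbar - d), so that dd^c = 2i d dbar; any other
   positive normalization gives the same notions below. *)
Definition ddc (R : realType) (n : nat) (f : 'rV[R]_(n + n) -> R)
    (z : 'rV[R]_(n + n)) : cform R n :=
  form11 (complex_hessian f z).

(* dd^c |z|^2, which has constant coefficients. *)
Definition beta (R : realType) (n : nat) : cform R n := ddc (@cnorm2 R n) 0.

Lemma is_derive_coor (R : realType) (N : nat) (i : 'I_N) (x v : 'rV[R]_N) :
  is_derive x v (fun z : 'rV[R]_N => z 0 i) (v 0 i).
Proof.
have E : forall h : R, h != 0 -> h^-1 *: (((fun z : 'rV[R]_N => z 0 i) \o shift x) (h *: v) - x 0 i) = v 0 i.
  by move=> h h0; rewrite /= !mxE addrK /GRing.scale/= mulrA mulVf// mul1r.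
have C : h^-1 *: (((fun z : 'rV[R]_N => z 0 i) \o shift x) (h *: v) - x 0 i) @[h --> (0:R)^'] --> v 0 i.
  apply: cvg_near_cst; near=> h; apply: E; near: h; exact: nbhs_dnbhs_neq.
split; first by apply/cvg_ex; exists (v 0 i).
exact: (cvg_lim _ C).
Unshelve. all: by end_near. Qed.

Lemma derive_cnorm2 (R : realType) (n : nat) (v : 'rV[R]_(n + n)) :
  'D_v (@cnorm2 R n) = (fun z => \sum_(i < n + n) 2 * v 0 i * z 0 i).
Proof.
apply/funext => x.
have -> : @cnorm2 R n = \sum_(i < n + n) (fun z : 'rV[R]_(n + n) => z 0 i) ^+ 2.
  by apply/funext => z; rewrite fct_sumE; apply: eq_bigr.
rewrite derive_sum; last first.
  by move=> i; apply: derivableX; have [] := is_derive_coor i x v.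
apply: eq_bigr => i _; rewrite deriveX; last by have [] := is_derive_coor i x v.
rewrite (@derive_val _ _ _ _ _ _ _ (is_derive_coor i x v)).
by rewrite /GRing.scale/= expr1 -!mulrA (mulrC (x 0 i)).
Qed.

Lemma betaE (R : realType) (n : nat) : beta R n = form11 1%:M.
Proof.
have D (c : 'I_(n + n) -> R) (v x : 'rV[R]_(n + n)) :
    'D_v (fun z : 'rV[R]_(n + n) => \sum_(i < n + n) c i * z 0 i) x =
    \sum_(i < n + n) c i * v 0 i.
  have -> : (fun z : 'rV[R]_(n + n) => \sum_(i < n + n) c i * z 0 i) =
      \sum_(i < n + n) c i \*: (fun z : 'rV[R]_(n + n) => z 0 i).
    by apply/funext => z; rewrite fct_sumE; apply: eq_bigr.
  rewrite derive_sum => [|i]; last first.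
    by apply: derivableZ; have [] := is_derive_coor i x v.
  apply: eq_bigr => i _; rewrite deriveZ; last by have [] := is_derive_coor i x v.
  by rewrite (@derive_val _ _ _ _ _ _ _ (is_derive_coor i x v)).
have S (p q : 'I_(n + n)) :
    \sum_(i < n + n) 2 * (delta_mx 0 p : 'rV[R]_(n + n)) 0 i *
      (delta_mx 0 q : 'rV[R]_(n + n)) 0 i = 2 * (p == q)%:R.
  rewrite (bigD1 p)//= big1 ?addr0 => [|i ip]; last first.
    by rewrite !mxE/= (negbTE ip) mulr0 mul0r.
  by rewrite !mxE !eqxx/= mulr1.
congr form11; apply/matrixP => j k; rewrite !mxE /d_x /d_y !derive_cnorm2 !D !S.
rewrite (inj_eq (@lshift_inj _ _)) (inj_eq (@rshift_inj _ _)).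
rewrite !eq_lrshift !eq_rlshift mulr0 subrr mul0r.
case: (eqVneq j k) => _ /=; last by rewrite !mulr0 addr0 mul0r.
by rewrite !mulr1 -natrD divff ?pnatr_eq0.
Qed.

Definition m_positive (R : realType) (n m : nat) (a : cform R n) : Prop :=
  real11 a /\
  forall k : nat, (1 <= k <= m)%N ->
    top_ge0 (wedge (wedgeX a k) (wedgeX (beta R n) (n - k))).

Fixpoint Ck (R : realType) (N k : nat) (f : 'rV[R]_N -> R) : Prop :=
  continuous f /\
  if k is k'.+1 then forall v : 'rV[R]_N,
    (forall x, derivable f x v) /\ Ck k' ('D_v f)
  else True.

Definition test_function (R : realType) (N : nat) (Om : set 'rV[R]_N)
    (f : 'rV[R]_N -> R) : Prop :=
  (forall k, Ck k f) /\
  exists K : set 'rV[R]_N,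
    [/\ compact K, K `<=` Om & forall x, ~ K x -> f x = 0].

(* Only the values of u on Om are relevant. *)
Definition usc_on (R : realType) (N : nat) (Om : set 'rV[R]_N)
    (u : 'rV[R]_N -> \bar R) : Prop :=
  forall x, Om x -> forall c : R, (u x < c%:E)%E ->
    \forall y \near x, (u y < c%:E)%E.

Definition loc_integrable_on (R : realType) (N : nat) (Om : set 'rV[R]_N)
    (u : 'rV[R]_N -> \bar R) : Prop :=
  forall K : set 'rV[R]_N, compact K -> K `<=` Om ->
    (leb R N).-integrable K u.

Definition unit_ball (R : realType) (n : nat) : set 'rV[R]_(n + n) :=
  [set z | cnorm z < 1].

(* The mean value of u over the sphere |z - a| = r. The normalized surface
   measure of the unit sphere is the image of the normalized Lebesgue measure
   of the unit ball under z |-> z / |z|. *)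
Definition sphere_mean (R : realType) (n : nat) (u : 'rV[R]_(n + n) -> \bar R)
    (a : 'rV[R]_(n + n)) (r : R) : \bar R :=
  ((\int[leb R (n + n)]_(z in @unit_ball R n) u (a + (r / cnorm z) *: z)%R)
     * ((fine (leb R (n + n) (@unit_ball R n)))^-1)%:E)%E.

Definition subharmonic (R : realType) (n : nat) (Om : set 'rV[R]_(n + n))
    (u : 'rV[R]_(n + n) -> \bar R) : Prop :=
  usc_on Om u /\
  forall a r, 0 < r -> [set z | cnorm (z - a) <= r] `<=` Om ->
    (u a <= sphere_mean u a r)%E.

(* dd^c u /\ T >= 0 as a current on Om, for a constant-coefficient form T of
   bidegree (n - 1, n - 1): it is nonnegative on nonnegative test functions,
   on which it acts by f |-> \int u dd^c f /\ T. *)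
Definition ddc_wedge_ge0 (R : realType) (n : nat) (Om : set 'rV[R]_(n + n))
    (u : 'rV[R]_(n + n) -> \bar R) (T : cform R n) : Prop :=
  forall f, test_function Om f -> (forall z, 0 <= f z) ->
    (0 <= \int[leb R (n + n)]_(z in Om)
            (u z * (complex.Re (topcoef (wedge (ddc f z) T)))%:E))%E.

(* u is m-subharmonic on the open set Om. *)
Definition SH (R : realType) (n m : nat) (Om : set 'rV[R]_(n + n))
    (u : 'rV[R]_(n + n) -> \bar R) : Prop :=
  [/\ forall z, Om z -> (u z < +oo)%E,
      loc_integrable_on Om u,
      usc_on Om u,
      subharmonic Om u
    & forall a : 'I_(m - 1) -> cform R n, (forall j, m_positive m (a j)) ->
        ddc_wedge_ge0 Om u
          (wedge (\big[@wedge R n/form1 R n]_(j < m - 1) a j)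
                 (wedgeX (beta R n) (n - m)))].

Definition phi (R : realType) (n m : nat) (r : R) : R :=
  let q : R := n%:R / m%:R - 1 in - (q * r `^ (2 * q))^-1.

(* The m-Lelong number of u at a exists and is equal to nu. *)
Definition is_lelong (R : realType) (n m : nat) (u : 'rV[R]_(n + n) -> \bar R)
    (a : 'rV[R]_(n + n)) (nu : \bar R) : Prop :=
  exists2 l : \bar R,
    (sphere_mean u a r * ((phi n m r)^-1)%:E)%E @[r --> 0^'+] --> l
    & nu = (2%:E * l)%E.

(* Main.v *)
(** Let s = 1/(4n) and u(z) = - |z|^(-2s). As s < n/m - 1, u is negligible
    compared with phi_m at the origin and its Lelong number vanishes, whereas
    exp(- gamma u) = exp(gamma |z|^(-2s)) is integrable near 0 for no gamma > 0.

    The function u is the decreasing limit of u_e = - (|z|^2 + e)^(-s). Since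
    s m <= 1, dd^c u_e is m-positive: it is c beta plus a form g of rank one,
    with g^2 = 0. That a product of different m-positive forms and powers of
    beta is nonnegative is Garding's inequality: the polynomial x |-> det x on
    Hermitian matrices has no zeros in the tube over the ray of beta; this
    stability persists under derivatives in the directions of the cone
    (Gauss-Lucas) and when an m-positive form is added to the cone (a homotopy
    in which no root can cross the real line). Positivity of the current
    passes to the limit after two integrations by parts.

    For the submean inequality, integrating by parts in the integral of
    u_e(a + r z) w(|z|^2) shows that it is nondecreasing in r for every weight
    w >= 0, hence the mean of u_e over a + r A is at least u_e(a) for an annulus
    A; cutting the ball into thin annuli th^(j+1) <= |z| < th^j and letting th
    tend to 1 gives the mean over spheres. *)
From HB Require Import structures.
Require Import Defs.
From mathcomp Require Import all_boot all_order all_algebra.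
From mathcomp Require Import all_fingroup.
From mathcomp Require Import complex.
From mathcomp Require Import reals.
From mathcomp Require Import ring lra zify.

Set Implicit Arguments.
Unset Strict Implicit.
Unset Printing Implicit Defensive.

Import Order.TTheory GRing.Theory Num.Theory.

Local Open Scope ring_scope.

(** * The commutative ring of even forms *)

(** The integrality of m and n leaves room for the exponent: m < n gives n/m - 1 >= 1/m, so one
    small s satisfies every constraint at once. Against powers of itself and of beta, the radial
    form is controlled by hand, because its rank-one part squares to zero. The obstacle is that
    positivity is tested against m - 1 unrelated m-positive forms, which need not be simultaneously
    diagonalizable; this is what forces Garding's inequality. To run polynomial arguments on forms,
    the even ones are made into a commutative ring on which the top coefficient L is linear;
    matrices enter only through L(x^n) = n! 4^n det. The regularization makes every integration by
    parts one of smooth functions on the whole space, with no boundary term at the singularity.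
    Spherical means are defined through the Lebesgue measure of the ball, so volume integrals with a
    radial weight take the place of the divergence theorem on spheres: the weighted radial field is
    the gradient of a compactly supported function of |z|^2. *)

Section exterior.
Variables (R : realType) (n : nat).
Local Notation form := (cform R n).
Implicit Types (u v w : form) (S T U : {set 'I_(n + n)}) (c : R[i]).

Lemma inversionsUl S T U : [disjoint S & T] ->
  inversions (S :|: T) U = (inversions S U + inversions T U)%N.
Proof.
move=> dST; rewrite /inversions -cardUI [X in _ = (_ + X)%N]eq_card0 ?addn0; last first.
  move=> p; rewrite !inE.
  case: (boolP (p.1 \in S)) => //= pS; by rewrite (disjointFr dST pS) !andbF.
by apply: eq_card => p; rewrite !inE; do 3 case: (_ \in _) => //=; case: (_ < _)%N.
Qed.

Lemma inversionsUr S T U : [disjoint T & U] ->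
  inversions S (T :|: U) = (inversions S T + inversions S U)%N.
Proof.
move=> dTU; rewrite /inversions -cardUI [X in _ = (_ + X)%N]eq_card0 ?addn0; last first.
  move=> p; rewrite !inE.
  case: (boolP (p.2 \in T)) => [pT|]; last by rewrite andbF.
  by rewrite (disjointFr dTU pT) !andbF.
by apply: eq_card => p; rewrite !inE; do 3 case: (_ \in _) => //=; case: (_ < _)%N.
Qed.

(** A pair of [S] x [T] has distinct entries, so it is an inversion on exactly one of the two sides.
    Exchanging two monomials therefore costs the sign (-1)^(|S||T|). *)
Lemma inversionsC S T : [disjoint S & T] ->
  (inversions S T + inversions T S = #|S| * #|T|)%N.
Proof.
move=> dST; rewrite -cardsX /inversions.
have -> : #|[pred p : 'I_(n+n) * 'I_(n+n) | [&& p.1 \in T, p.2 \in S & (p.2 < p.1)%N]]| =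
   #|[pred p : 'I_(n+n) * 'I_(n+n) | [&& p.1 \in S, p.2 \in T & (p.1 < p.2)%N]]|.
  rewrite -(card_image (f := fun p => (p.2, p.1))); last by move=> [a b] [d e] [-> ->].
  apply: eq_card => -[a b]; rewrite inE; apply/imageP/idP => /=.
    by move=> [[x y]]; rewrite !inE /= => /and3P[xT yS xy] [-> ->]; rewrite xT yS xy.
  by move=> /and3P[aS bT ab]; exists (b, a) => //; rewrite !inE /= aS bT ab.
rewrite -cardUI [X in (_ + X)%N = _]eq_card0 ?addn0; last first.
  by move=> p; rewrite !inE; case: ltngtP; rewrite ?andbF.
apply: eq_card => -[a b]; rewrite !inE /=.
have [aS|] := boolP (a \in S) => //=; have [bT|] := boolP (b \in T) => //=.
case: ltngtP => // ab; have := disjointFr dST aS; by rewrite -(val_inj ab) bT.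
Qed.

Lemma wedge_addl u v w : wedge (u + v) w = wedge u w + wedge v w.
Proof.
apply/ffunP => S; rewrite !ffunE -big_split /=; apply: eq_bigr => T _.
by rewrite !ffunE mulrDr mulrDl.
Qed.

Lemma wedge_addr u v w : wedge u (v + w) = wedge u v + wedge u w.
Proof.
apply/ffunP => S; rewrite !ffunE -big_split /=; apply: eq_bigr => T _.
by rewrite !ffunE mulrDr.
Qed.

Lemma wedge_scalel c v w : wedge (fscale c v) w = fscale c (wedge v w).
Proof.
apply/ffunP => S; rewrite !ffunE mulr_sumr; apply: eq_bigr => T _.
by rewrite !ffunE mulrCA !mulrA.
Qed.

Lemma wedge_scaler c v w : wedge v (fscale c w) = fscale c (wedge v w).
Proof.
apply/ffunP => S; rewrite !ffunE mulr_sumr; apply: eq_bigr => T _.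
by rewrite !ffunE mulrCA !mulrA.
Qed.

Lemma inversions0l S : inversions finset.set0 S = 0%N.
Proof. by apply: eq_card0 => p; rewrite !inE. Qed.

Lemma wedge_form1l w : wedge (form1 R n) w = w.
Proof.
apply/ffunP => S; rewrite ffunE (bigD1 finset.set0) ?sub0set //= big1 ?addr0.
  by rewrite ffunE eqxx inversions0l setD0 !mul1r.
by move=> T /andP[_ /negbTE T0]; rewrite ffunE T0 mulr0 mul0r.
Qed.

Lemma disjointUl S T U : [disjoint S :|: T & U] = [disjoint S & U] && [disjoint T & U].
Proof. by rewrite -!setI_eq0 setIUl setU_eq0. Qed.

Lemma disjointUr S T U : [disjoint S & T :|: U] = [disjoint S & T] && [disjoint S & U].
Proof. by rewrite -!setI_eq0 setIUr setU_eq0. Qed.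

Lemma wedge0l w : wedge 0 w = 0.
Proof. by apply/ffunP => S; rewrite !ffunE big1 // => T _; rewrite ffunE mulr0 mul0r. Qed.

Lemma wedge0r w : wedge w 0 = 0.
Proof. by apply/ffunP => S; rewrite !ffunE big1 // => T _; rewrite ffunE mulr0. Qed.

Lemma wedge_suml (I : Type) (r : seq I) P (F : I -> form) w :
  wedge (\sum_(i <- r | P i) F i) w = \sum_(i <- r | P i) wedge (F i) w.
Proof. exact: (big_morph (fun v => wedge v w) (fun u v => wedge_addl u v w) (wedge0l w)). Qed.

Lemma wedge_sumr (I : Type) (r : seq I) P (F : I -> form) w :
  wedge w (\sum_(i <- r | P i) F i) = \sum_(i <- r | P i) wedge w (F i).
Proof. exact: (big_morph _ (wedge_addr w) (wedge0r w)). Qed.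

Lemma fscaleA c c' w : fscale c (fscale c' w) = fscale (c * c') w.
Proof. by apply/ffunP => S; rewrite !ffunE mulrA. Qed.

Lemma fscale1 w : fscale 1 w = w.
Proof. by apply/ffunP => S; rewrite !ffunE mul1r. Qed.

Lemma fscale0 c : fscale c (0 : form) = 0.
Proof. by apply/ffunP => S; rewrite !ffunE mulr0. Qed.

Lemma form_sum w : w = \sum_S fscale (w S) (mono R S).
Proof.
apply/ffunP => S; rewrite sum_ffunE (bigD1 S) //= big1 ?addr0; last first.
  by move=> T TS; rewrite !ffunE eq_sym (negbTE TS) mulr0.
by rewrite !ffunE eqxx mulr1.
Qed.

Lemma wedge_monoE S T : wedge (mono R S) (mono R T) =
  if [disjoint S & T] then fscale ((-1) ^+ inversions S T) (mono R (S :|: T)) else 0.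
Proof.
case: ifPn => dST.
  by rewrite -(fscale1 (mono R S)) -(fscale1 (mono R T)) wedge_mono // !mulr1.
apply/ffunP => U; rewrite !ffunE big1 // => V _; rewrite !ffunE.
have [->{V}|] := eqVneq V S; last by rewrite mulr0 mul0r.
case: eqP => [E|]; last by rewrite mulr0.
by case/negP: dST; rewrite -E -setI_eq0; apply/eqP/setP => x; rewrite !inE; case: (x \in S).
Qed.

Lemma wedge_monoA S T U : wedge (mono R S) (wedge (mono R T) (mono R U)) =
  wedge (wedge (mono R S) (mono R T)) (mono R U).
Proof.
rewrite !wedge_monoE.
have [dTU|nTU] := boolP [disjoint T & U]; have [dST|nST] := boolP [disjoint S & T];
  rewrite ?wedge0l ?wedge0r ?wedge_scalel ?wedge_scaler ?wedge_monoE //.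
- rewrite disjointUr disjointUl dST dTU andbT /=.
  case: ifP => dSU; last by rewrite !fscale0.
  rewrite !fscaleA inversionsUr // inversionsUl // setUA; congr fscale.
  by rewrite -!exprD addnC -!addnA; congr (_ ^+ _); rewrite addnCA addnC -addnA addnC -addnA.
- by rewrite disjointUr (negbTE nST) fscale0.
- by rewrite disjointUl (negbTE nTU) andbF fscale0.
Qed.

Lemma wedgeA : associative (@wedge R n).
Proof.
move=> u v w; rewrite (form_sum u) (form_sum v) (form_sum w).
rewrite !wedge_suml; apply: eq_bigr => S _.
rewrite [LHS]wedge_sumr [wedge (fscale _ _) (\sum_T _)]wedge_sumr wedge_suml.
apply: eq_bigr => T _. rewrite !wedge_sumr; apply: eq_bigr => U _.
rewrite !(wedge_scalel, wedge_scaler) wedge_monoA !fscaleA; congr fscale.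
by rewrite [LHS]mulrC mulrA.
Qed.

(* Forms with even components only commute, so that they form a commutative
   ring in which polynomial arguments are available. *)
Definition evenform w := [forall S : {set 'I_(n + n)}, odd #|S| ==> (w S == 0)].

Lemma evenformP w : reflect (forall S, odd #|S| -> w S = 0) (evenform w).
Proof. by apply: (iffP 'forall_implyP) => H S oS; apply/eqP/H. Qed.

(** When |S| is even, |S||T| is even too, so the two inversion counts have the same parity whatever
    [T] is. *)
Lemma wedgeC v w : evenform v -> wedge v w = wedge w v.
Proof.
move=> /evenformP ev; rewrite (form_sum v) (form_sum w).
rewrite wedge_suml wedge_sumr; apply: eq_bigr => S _.
rewrite wedge_sumr wedge_suml; apply: eq_bigr => T _.
rewrite !(wedge_scalel, wedge_scaler) !fscaleA [w T * _]mulrC.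
have [/ev ->|eS] := boolP (odd #|S|).
  by apply/ffunP => U; rewrite !ffunE !mul0r.
congr fscale; rewrite !wedge_monoE disjoint_sym; case: ifP => // dTS.
rewrite setUC; congr fscale; rewrite -signr_odd -[RHS]signr_odd; congr (_ ^+ _).
have := congr1 odd (inversionsC dTS); rewrite oddD oddM (negbTE eS) andbF.
by case: (odd _); case: (odd _).
Qed.

Lemma evenform_wedge v w : evenform v -> evenform w -> evenform (wedge v w).
Proof.
move=> /evenformP ev /evenformP ew; apply/evenformP => S oS.
rewrite ffunE big1 // => T TS; have [/ev ->|eT] := boolP (odd #|T|); first by rewrite mulr0 mul0r.
rewrite [w _]ew ?mulr0 //; move: oS; rewrite cardsD (finset.setIidPr TS).
by rewrite oddB ?subset_leq_card // (negbTE eT) addbF.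
Qed.

End exterior.

Record evform (R : realType) (n : nat) :=
  EvForm { evval : cform R n; _ : evenform evval }.

Section evalg.
Variables (R : realType) (n : nat).
Local Notation evform := (evform R n).
Local Notation evval := (@evval R n).

HB.instance Definition _ := [isSub for evval].
HB.instance Definition _ := [Choice of evform by <:].

Lemma evenform_zmod_closed : zmod_closed (@evenform R n).
Proof.
split=> [|u v /evenformP eu /evenformP ev]; apply/evenformP => S oS.
  by rewrite ffunE.
by rewrite !ffunE eu // ev // subrr.
Qed.

HB.instance Definition _ := GRing.isZmodClosed.Build (cform R n) (@evenform R n)
  evenform_zmod_closed.
HB.instance Definition _ := [SubChoice_isSubZmodule of evform by <:].

Lemma evenform_scale1 c : evenform (fscale c (form1 R n)).
Proof.
apply/evenformP => S; rewrite !ffunE; case: eqP => [->|_]; rewrite ?mulr0 //.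
by rewrite cards0.
Qed.

Definition evscalar c : evform := EvForm (evenform_scale1 c).

Definition evmul (u v : evform) : evform :=
  EvForm (evenform_wedge (valP u) (valP v)).

Lemma evmulA : associative evmul.
Proof. by move=> u v w; apply/val_inj; exact: wedgeA. Qed.

Lemma evmulC : commutative evmul.
Proof. by move=> u v; apply/val_inj/wedgeC/valP. Qed.

Lemma evmul1 : left_id (evscalar 1) evmul.
Proof. by move=> u; apply/val_inj; rewrite /= fscale1 wedge_form1l. Qed.

Lemma evmulDl : left_distributive evmul +%R.
Proof. by move=> u v w; apply/val_inj; exact: wedge_addl. Qed.

Lemma ev1_neq0 : evscalar 1 != 0.
Proof.
apply/eqP => /(congr1 evval)/ffunP/(_ finset.set0).
by rewrite !ffunE eqxx mulr1 => /eqP; rewrite oner_eq0.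
Qed.

HB.instance Definition _ := GRing.Zmodule_isComNzRing.Build evform
  evmulA evmulC evmul1 evmulDl ev1_neq0.

Lemma evval_mul (u v : evform) : evval (u * v) = wedge (evval u) (evval v).
Proof. by []. Qed.

Lemma evval1 : evval 1 = form1 R n.
Proof. exact: fscale1. Qed.

Lemma evval_exp (u : evform) k : evval (u ^+ k) = wedgeX (evval u) k.
Proof. by elim: k => [|k IH]; [exact: evval1|rewrite exprS evval_mul IH]. Qed.

Lemma evval_prod (I : Type) (r : seq I) (F : I -> evform) :
  evval (\prod_(i <- r) F i) = \big[@wedge R n/form1 R n]_(i <- r) evval (F i).
Proof. exact: (big_morph _ evval_mul evval1). Qed.

Lemma evscalar_zmod_morphism : zmod_morphism evscalar.
Proof. by move=> a b; apply/val_inj/ffunP => S; rewrite /= !ffunE mulrBl. Qed.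

Lemma evscalar_monoid_morphism : monoid_morphism evscalar.
Proof.
split=> // a b; apply/val_inj.
by rewrite /= wedge_scalel wedge_form1l fscaleA.
Qed.

HB.instance Definition _ := GRing.isZmodMorphism.Build R[i] evform evscalar
  evscalar_zmod_morphism.
HB.instance Definition _ := GRing.isMonoidMorphism.Build R[i] evform evscalar
  evscalar_monoid_morphism.

Lemma evval_scalar_mul c (u : evform) : evval (evscalar c * u) = fscale c (evval u).
Proof. by rewrite evval_mul wedge_scalel wedge_form1l. Qed.

Definition evtop (u : evform) : R[i] := topcoef (evval u).

Lemma evtop_zmod_morphism : zmod_morphism evtop.
Proof. by move=> u v; rewrite /evtop /topcoef !ffunE mulrBl. Qed.

HB.instance Definition _ := GRing.isZmodMorphism.Build evform R[i] evtop
  evtop_zmod_morphism.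

Lemma evtop_scalar_mul c u : evtop (evscalar c * u) = c * evtop u.
Proof. by rewrite /evtop /topcoef evval_scalar_mul ffunE mulrA. Qed.

End evalg.

(** * Top powers of (1,1)-forms and the determinant *)

Lemma sqzero_addX (K : comNzRingType) (a b : K) m : b * b = 0 ->
  (a + b) ^+ m.+1 = a ^+ m.+1 + (a ^+ m * b) *+ m.+1.
Proof.
move=> b2; elim: m => [|m IH]; first by rewrite !expr1 expr0 mul1r.
rewrite exprS IH !exprS -[_ *+ m.+1]mulr_natr -[_ *+ m.+2]mulr_natr [m.+2%:R]mulrSr.
transitivity (a * (a * a ^+ m) + a * a ^+ m * b * (m.+1%:R + 1) + a ^+ m * m.+1%:R * (b * b)).
  by move: (a ^+ m) (m.+1%:R : K) => p q; ring.
by rewrite b2 mulr0 addr0.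
Qed.

Lemma sqzero_sumX (K : comNzRingType) n (w : 'I_n -> K) :
  (forall j, w j * w j = 0) -> (\sum_j w j) ^+ n = (\prod_j w j) *+ n`!.
Proof.
(* The vanishing of the next power is carried along: after splitting off the last term, it kills the
   power of the remaining sum in the binomial formula. *)
move=> w2; suff [] : (\sum_j w j) ^+ n = (\prod_j w j) *+ n`! /\ (\sum_j w j) ^+ n.+1 = 0 by [].
elim: n w w2 => [|n IH] w w2; first by rewrite !big_ord0 expr0 expr1.
rewrite !big_ord_recr /= !sqzero_addX //.
have [-> E0] := IH (fun j => w (widen_ord (leqnSn n) j)) (fun j => w2 _).
rewrite E0 exprS E0 mulr0 mul0r mul0rn !add0r; split=> //.
by rewrite mulrnAl -mulrnA factS mulnC.
Qed.

Section det_form.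
Variables (R : realType) (n : nat).

Lemma wedgeNl (v w : cform R n) : wedge (- v) w = - wedge v w.
Proof. by apply/eqP; rewrite -addr_eq0 -wedge_addl addNr wedge0l. Qed.

Lemma wedgeNr (v w : cform R n) : wedge v (- w) = - wedge v w.
Proof. by apply/eqP; rewrite -addr_eq0 -wedge_addr addNr wedge0r. Qed.

Lemma inversions1 (N : nat) (i j : 'I_N) :
  inversions (finset.set1 i) (finset.set1 j) = (j < i)%N.
Proof.
rewrite /inversions; case: (ltnP j i) => ji.
  transitivity #|pred1 (i, j)|; last exact: card1.
  apply: eq_card => -[a b].
  rewrite !inE /= xpair_eqE; case: eqP => [->|] //=; case: eqP => [->|] //=.
apply: eq_card0 => -[a b]; rewrite !inE /=.
by apply/negP => /and3P[/eqP -> /eqP ->]; rewrite ltnNge ji.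
Qed.

Lemma genC (i j : 'I_(n + n)) : wedge (gen R i) (gen R j) = - wedge (gen R j) (gen R i).
Proof.
have E k : gen R k = mono R (finset.set1 k) :> cform R n by [].
rewrite !E !wedge_monoE.
have -> : [disjoint [set j]%SET & [set i]%SET] = [disjoint [set i]%SET & [set j]%SET].
  by rewrite disjoint_sym.
case: ifPn => [|_]; last by rewrite oppr0.
rewrite disjoints1 inE => ij; rewrite !inversions1 setUC.
apply/ffunP => S; rewrite !ffunE -mulNr; congr (_ * _).
case: (ltngtP i j) => [||/val_inj E']; rewrite ?opprK //.
by rewrite E' eqxx in ij.
Qed.

Definition E11 (j k : 'I_n) : cform R n := wedge (dz R j) (dzb R k).

Lemma evenform_E11 j k : evenform (E11 j k).
Proof.
have E i : gen R i = mono R (finset.set1 i) :> cform R n by [].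
rewrite /E11 /dz /dzb !E wedge_monoE disjoints1 inE eq_lrshift /=.
apply/evenformP => S oS; rewrite !ffunE; case: eqP => [ES|_]; last by rewrite mulr0.
by move: oS; rewrite ES cardsU1 inE eq_lrshift cards1.
Qed.

Definition ev1 j k : evform R n := EvForm (evenform_E11 j k).

(** Exchanging the two conjugate generators is an odd permutation of four anticommuting factors. The
    signs of the Leibniz formula come from here. *)
Lemma ev1M j k j' k' : ev1 j k * ev1 j' k' = - (ev1 j k' * ev1 j' k).
Proof.
apply/val_inj => /=; rewrite /E11.
rewrite -!wedgeA -wedgeNr; congr wedge.
have gN u v w : wedge (gen R u) (wedge (gen R v) w) = - wedge (gen R v) (wedge (gen R u) w) :> cform R n.
  by rewrite wedgeA genC; apply: etrans (wedgeNl _ _) _; rewrite wedgeA.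
rewrite /dz /dzb gN [wedge _ (gen R (rshift n k'))]genC wedgeNr opprK.
by rewrite gN.
Qed.

Lemma evform_double0 (x : evform R n) : x = - x -> x = 0.
Proof.
move=> xN; apply/val_inj/ffunP => S; have /(congr1 (@evval R n))/ffunP/(_ S) := xN.
rewrite !ffunE => /eqP; rewrite -subr_eq0 opprK -mulr2n mulrn_eq0 /=.
by move/eqP.
Qed.

Lemma prod_ev1_inj (f : {ffun 'I_n -> 'I_n}) :
  ~~ injectiveb f -> \prod_j ev1 j (f j) = 0.
Proof.
case/injectivePn => i1 [i2 Di12 Ef12].
rewrite (bigD1 i1) //= (bigD1 i2) //= 1?eq_sym // mulrA Ef12.
by rewrite (evform_double0 (ev1M i1 (f i2) i2 (f i2))) mul0r.
Qed.

Lemma prod_ev1_tperm (s : 'S_n) (x y : 'I_n) : x != y ->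
  \prod_j ev1 j ((tperm x y * s)%g j) = - \prod_j ev1 j (s j).
Proof.
move=> xy; have yx : y != x by rewrite eq_sym.
rewrite (bigD1 x) //= [in RHS](bigD1 x) //= (bigD1 y) //= [in RHS](bigD1 y) //= !mulrA -mulNr.
rewrite !permM tpermL tpermR ev1M; congr (_ * _); apply: eq_bigr => j /andP[jx jy].
by rewrite permM tpermD // eq_sym.
Qed.

Lemma prod_ev1_perm (s : 'S_n) :
  \prod_j ev1 j (s j) = (-1) ^+ s * \prod_j ev1 j j.
Proof.
have [ts -> dts] := prod_tpermP s.
elim: ts dts => [_|[x y] ts IH /= /andP[xy dts]].
  rewrite big_nil odd_perm1 mul1r; apply: eq_bigr => j _; by rewrite perm1.
rewrite big_cons prod_ev1_tperm // IH // odd_permM odd_tperm xy /=.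
by rewrite signrN mulNr.
Qed.

Lemma evenform_form11 (A : 'M[R[i]]_n) : evenform (form11 A).
Proof.
apply/evenformP => S oS; rewrite /form11 sum_ffunE big1 // => j _.
rewrite sum_ffunE big1 // => k _; rewrite ffunE.
by rewrite (evenformP _ (evenform_E11 j k)) // mulr0.
Qed.

Definition ev11 (A : 'M[R[i]]_n) : evform R n := EvForm (evenform_form11 A).

Lemma evval_sum (I : Type) (r : seq I) P (F : I -> evform R n) :
  evval (\sum_(i <- r | P i) F i) = \sum_(i <- r | P i) evval (F i).
Proof. exact: (big_morph (@evval R n)). Qed.

Lemma ev11E A : ev11 A = \sum_j \sum_k evscalar n (Complex 0 2 * A j k) * ev1 j k.
Proof.
apply/val_inj; rewrite /= evval_sum; apply: eq_bigr => j _.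
by rewrite evval_sum; apply: eq_bigr => k _; rewrite evval_scalar_mul.
Qed.

Lemma ev11D A B : ev11 (A + B) = ev11 A + ev11 B.
Proof.
rewrite !ev11E -big_split; apply: eq_bigr => j _; rewrite -big_split; apply: eq_bigr => k _.
by rewrite !mxE mulrDr rmorphD mulrDl.
Qed.

Lemma ev11Z c A : ev11 (c *: A) = evscalar n c * ev11 A.
Proof.
rewrite !ev11E mulr_sumr; apply: eq_bigr => j _; rewrite mulr_sumr; apply: eq_bigr => k _.
by rewrite !mxE mulrCA rmorphM mulrA.
Qed.

(** The volume form is the product of the (i/2) dz_j dzb_j, and 4 (i/2) = 2i. The value is written
    with (2i)^(-n) so that it cancels the factors 2i of [form11]. *)
Lemma evtop_prod_ev1 : evtop (\prod_j ev1 j j) = (Complex 0 2 : R[i]) ^- n * (4%:R) ^+ n.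
Proof.
pose V := \prod_j (evscalar n (Complex 0 2^-1) * ev1 j j).
have EV : evval V = vol R n.
  by rewrite evval_prod /vol; apply: eq_bigr => j _; rewrite evval_scalar_mul.
have : evtop V = 1 by rewrite /evtop /topcoef EV divff // vol_neq0.
rewrite /V big_split /= prodr_const card_ord -rmorphXn evtop_scalar_mul => H.
have u0 : (Complex 0 2 : R[i]) != 0 by rewrite eq_complex /= pnatr_eq0 andbF.
have c0 : (Complex 0 2^-1 : R[i]) != 0 by rewrite eq_complex /= invr_eq0 pnatr_eq0 andbF.
apply: (mulfI (expf_neq0 n c0)); rewrite H -exprVn -!exprMn.
rewrite [X in X ^+ _](_ : _ = 1) ?expr1n //.
have cu : (Complex 0 2^-1 : R[i]) * 4 = Complex 0 2.
  by rewrite mulr_natr !mulrS mulr0n; apply/eqP; rewrite eq_complex /=; apply/andP; split;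
     apply/eqP; field.
by rewrite mulrCA cu mulVf.
Qed.

(** All terms of the j-th row contain dz_j, so the row sums square to zero and the n-th power is n!
    times their product. Expanding this product over all maps of the indices leaves the permutations
    with their signs, which is the Leibniz formula. Questions about forms thereby become questions
    about Hermitian matrices. *)
Lemma evtop_ev11X A : evtop (ev11 A ^+ n) = (n`! * 4 ^ n)%:R * \det A.
Proof.
rewrite ev11E sqzero_sumX; last first.
  move=> j; rewrite mulr_suml big1 // => k _; rewrite mulr_sumr big1 // => k' _.
  rewrite mulrACA (_ : ev1 j k * _ = 0) ?mulr0 //.
  by apply: evform_double0; rewrite {1}ev1M [in RHS]mulrC.
rewrite raddfMn natrM -mulrA mulr_natl; congr (_ *+ _).
rewrite bigA_distr_bigA /= raddf_sum /=.
rewrite (bigID (fun f : {ffun 'I_n -> 'I_n} => injectiveb f)) /= addrC big1 ?add0r; last first.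
  by move=> f fN; rewrite big_split /= prod_ev1_inj // mulr0 raddf0.
rewrite (reindex (@pval _)) /=; last first.
  pose in_Sn := insubd (1%g : 'S_n).
  by exists in_Sn => /= f Uf; first apply: val_inj; apply: insubdK.
rewrite /determinant mulr_sumr; apply: eq_big => /= [s | s _]; first by rewrite (valP s).
rewrite big_split /= -rmorph_prod evtop_scalar_mul.
under [X in _ * evtop X]eq_bigr => j _ do rewrite pvalE.
under eq_bigr => j _ do rewrite pvalE.
rewrite prod_ev1_perm big_split /= prodr_const card_ord.
rewrite -[(-1) ^+ s](rmorph_sign (evscalar n)) evtop_scalar_mul evtop_prod_ev1.
have u0 : (Complex 0 2 : R[i]) != 0 by rewrite eq_complex /= pnatr_eq0 andbF.
rewrite natrX. rewrite mulrCA [RHS]mulrCA; congr (_ * _).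
by rewrite mulrACA mulfV ?expf_neq0 // mul1r mulrC.
Qed.
End det_form.

From mathcomp Require Import all_classical all_reals all_analysis.
From mathcomp Require Import measurable_realfun.

Import numFieldNormedType.Exports.

Local Open Scope classical_set_scope.
Local Open Scope ring_scope.

(** * Garding's inequality *)

Import Normc.

(** * Polynomials without zeros in the closed upper half plane *)

Section complex_poly.
Variable R : realType.
Implicit Types (p : {poly R[i]}) (z : R[i]) (rs : seq R[i]).
Local Notation Im := complex.Im.
Local Notation Re := complex.Re.

Lemma normc_ge0 z : 0 <= normc z.
Proof. by case: z => a b; exact: sqrtr_ge0. Qed.

Lemma normc_eq0 z : (normc z == 0) = (z == 0).
Proof. by apply/eqP/eqP => [/eq0_normc //|->]; rewrite normc0. Qed.

Lemma normc_gt0 z : (0 < normc z) = (z != 0).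
Proof. by rewrite lt0r normc_ge0 andbT normc_eq0. Qed.

Lemma normc_Im z : `|Im z| <= normc z.
Proof.
case: z => a b /=; rewrite -sqrtr_sqr ler_wsqrtr // lerDr sqr_ge0 //.
Qed.

Lemma normc_real (x : R) : normc x%:C%C = `|x|.
Proof. by rewrite /normc /= expr0n /= addr0 sqrtr_sqr. Qed.

Lemma normcX z k : normc (z ^+ k) = normc z ^+ k.
Proof. by elim: k => [|k IH]; rewrite ?normc1 // !exprS normcM IH. Qed.

Lemma normc_sum (I : Type) (r : seq I) P (F : I -> R[i]) :
  normc (\sum_(i <- r | P i) F i) <= \sum_(i <- r | P i) normc (F i).
Proof.
elim/big_ind2: _ => [|x1 x2 y1 y2 h1 h2|//]; first by rewrite normc0.
by apply: le_trans (le_normcD _ _) _; rewrite lerD.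
Qed.

Lemma ImB (u v : R[i]) : Im (u - v) = Im u - Im v.
Proof. by case: u; case: v. Qed.

Definition im_neg_roots p := forall z, 0 <= Im z -> p.[z] != 0.

Lemma im_neg_rootsP p : p != 0 -> im_neg_roots p ->
  exists2 rs, p = lead_coef p *: \prod_(z <- rs) ('X - z%:P) & {in rs, forall z, Im z < 0}.
Proof.
move=> p0 gp; have [rs E] := closed_field_poly_normal p; exists rs => // z zrs.
rewrite ltNge; apply/negP => /gp; rewrite E hornerZ mulf_eq0 lead_coef_eq0 (negbTE p0) /=.
by rewrite -[_ == 0]/(root _ _) root_prod_XsubC zrs.
Qed.

Lemma size_prod_seq_XsubC rs p : p != 0 ->
  p = lead_coef p *: \prod_(z <- rs) ('X - z%:P) -> (size p).-1 = size rs.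
Proof. by move=> p0 ->; rewrite size_scale ?lead_coef_eq0 // size_prod_XsubC. Qed.

(** Gauss-Lucas at the point 0: the logarithmic derivative there is the sum of -1/z over the roots
    z, and Im z < 0 makes the imaginary part of each term negative. *)
Lemma im_neg_roots_deriv0 p : (1 < size p)%N -> im_neg_roots p -> p^`().[0] != 0.
Proof.
move=> sp gp; have p0 : p != 0 by rewrite -size_poly_gt0 ltnW.
have [rs E rsN] := im_neg_rootsP p0 gp.
have srs : (0 < size rs)%N by rewrite -(size_prod_seq_XsubC p0 E); case: size sp => [|[]].
rewrite E derivZ hornerZ mulf_neq0 ?lead_coef_eq0 //.
pose P := \prod_(z <- rs) ('X - z%:P).
suff : Im (P^`().[0] / P.[0]) < 0 by apply: contraTN => /eqP ->; rewrite mul0r ltxx.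
suff : P.[0] != 0 /\ if (rs == [::]) then P^`().[0] = 0 else Im (P^`().[0] / P.[0]) < 0.
  by case: (rs) srs => // a l _ [].
rewrite /P; elim: rs {E srs P} rsN => [_|z rs IH rsN].
  by rewrite big_nil derivC hornerC hornerC oner_eq0.
have zN : Im z < 0 by apply: rsN; rewrite inE eqxx.
have [|P0 H] := IH; first by move=> x xrs; apply: rsN; rewrite inE xrs orbT.
rewrite big_cons; set P := \prod_(_ <- _) _ in P0 H *.
have z0 : z != 0 by apply: contraTN zN => /eqP ->; rewrite ltxx.
rewrite derivM derivXsubC !hornerE /=; split; first by rewrite mulf_neq0 ?oppr_eq0.
have -> : (P.[0] + - z * P^`().[0]) / (- z * P.[0]) = - z^-1 + P^`().[0] / P.[0].
  by move: (P.[0]) (P^`().[0]) P0 => a b a0; field; rewrite a0 z0.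
have : Im (- z^-1) < 0.
  case: z zN z0 {IH rsN} => a b /= b0 _; rewrite opprK pmulr_llt0 // invr_gt0.
  by rewrite ltr_wpDl ?sqr_ge0 // exprn_even_gt0 //= lt_eqF.
case: ifP H => [_ ->|_]; first by rewrite mul0r addr0.
move=> h1 h2; have -> (x y : R[i]) : Im (x + y) = Im x + Im y by case: x; case: y.
by rewrite -oppr_gt0 opprD addr_gt0 ?oppr_gt0.
Qed.

(** Each factor satisfies |z - x| >= Im z because Im x < 0. The bound sees [p] only through its
    degree and leading coefficient, so it survives a limit along a homotopy. *)
Lemma im_neg_roots_lower p z : p != 0 -> im_neg_roots p -> 0 < Im z ->
  normc (lead_coef p) * Im z ^+ (size p).-1 <= normc p.[z].
Proof.
move=> p0 gp zp; have [rs E rsN] := im_neg_rootsP p0 gp.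
rewrite (size_prod_seq_XsubC p0 E) [in leRHS]E hornerZ normcM ler_wpM2l ?normc_ge0 //.
elim: rs {E} rsN => [_|x rs IH rsN]; first by rewrite big_nil hornerC normc1.
rewrite big_cons hornerM normcM exprS ler_pM ?exprn_ge0 ?(ltW zp) //; last first.
  by apply: IH => y yrs; apply: rsN; rewrite inE yrs orbT.
rewrite !hornerE; apply: le_trans (normc_Im _).
have : Im x < 0 by apply: rsN; rewrite inE eqxx.
move=> xN; apply: le_trans (ler_norm _).
by rewrite ImB lerDl oppr_ge0 ltW.
Qed.

(** The power of 1 + |z| makes the bound effective near infinity as well: a small change of the
    coefficients then creates no zero anywhere in the closed half plane. *)
Lemma im_neg_roots_lower_unif p : p != 0 -> im_neg_roots p ->
  exists2 k, 0 < k & forall z, 0 <= Im z -> k * (1 + normc z) ^+ (size p).-1 <= normc p.[z].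
Proof.
move=> p0 gp; have [rs E rsN] := im_neg_rootsP p0 gp.
rewrite (size_prod_seq_XsubC p0 E).
suff [k k0 H] : exists2 k, 0 < k & forall z, 0 <= Im z ->
    k * (1 + normc z) ^+ size rs <= normc (\prod_(z <- rs) ('X - z%:P)).[z].
  exists (normc (lead_coef p) * k); first by rewrite mulr_gt0 ?normc_gt0 ?lead_coef_eq0.
  by move=> z z0; rewrite [in leRHS]E hornerZ normcM -mulrA ler_wpM2l ?normc_ge0 ?H.
elim: rs {E} rsN => [_|x rs IH rsN].
  by exists 1 => // z _; rewrite big_nil hornerC normc1 expr0 mul1r.
have [|k k0 H] := IH; first by move=> y yrs; apply: rsN; rewrite inE yrs orbT.
have xN : 0 < - Im x by rewrite oppr_gt0; apply: rsN; rewrite inE eqxx.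
(* From 1 + |z| <= (1 + |x|) + |z - x| and |z - x| >= - Im x, one gets 1 + |z| <= C |z - x|. *)
pose C := (1 + normc x) / (- Im x) + 1.
have C0 : 0 < C by rewrite ltr_pwDr // divr_ge0 ?(ltW xN) // addr_ge0 ?normc_ge0.
exists (C^-1 * k); first by rewrite mulr_gt0 ?invr_gt0.
move=> z z0; rewrite big_cons hornerM normcM /= exprS mulrACA.
have z1 : 0 <= 1 + normc z by rewrite addr_ge0 ?normc_ge0.
rewrite ler_pM ?H ?mulr_ge0 ?exprn_ge0 ?invr_ge0 ?(ltW C0) ?(ltW k0) //.
rewrite mulrC ler_pdivrMr // !hornerE.
have h1 : - Im x <= normc (z - x).
  apply: le_trans (normc_Im _); apply: le_trans (ler_norm _).
  by rewrite ImB lerDr.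
have h2 : normc z <= normc (z - x) + normc x by rewrite -{1}(subrK x z) le_normcD.
rewrite /C mulrDr mulr1 mulrA.
apply: le_trans (_ : 1 + (normc (z - x) + normc x) <= _); first by rewrite lerD2l.
rewrite [normc (z - x) + _]addrC addrA lerD2r ler_pdivlMr // mulrC ler_wpM2r //.
by rewrite addr_ge0 ?normc_ge0.
Qed.

Lemma normc_horner p (t : R) : 0 <= t <= 1 -> normc p.[t%:C%C] <= \sum_(i < size p) normc p`_i.
Proof.
move=> /andP[t0 t1]; rewrite horner_coef; apply: le_trans (normc_sum _ _ _) _.
apply: ler_sum => i _; rewrite normcM normcX normc_real ger0_norm // ler_piMr ?normc_ge0 //.
by rewrite exprn_ile1.
Qed.

(** The quotient of p - p(t0) by X - t0 is bounded on [0, 1] by the sum of the moduli of its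
    coefficients, which gives an explicit Lipschitz constant at t0. *)
Definition lipc p (t0 : R) : R :=
  let q := (p - p.[t0%:C%C]%:P) %/ ('X - t0%:C%C%:P) in \sum_(i < size q) normc q`_i.

Lemma lipc_ge0 p t0 : 0 <= lipc p t0.
Proof. by apply: sumr_ge0 => i _; exact: normc_ge0. Qed.

Lemma lipcP p t0 t : 0 <= t <= 1 ->
  normc (p.[t%:C%C] - p.[t0%:C%C]) <= lipc p t0 * `|t - t0|.
Proof.
move=> t01; have dv : 'X - t0%:C%C%:P %| p - p.[t0%:C%C]%:P.
  by rewrite dvdp_XsubCl /root !hornerE subrr.
have -> : p.[t%:C%C] - p.[t0%:C%C] = (p - p.[t0%:C%C]%:P).[t%:C%C] by rewrite !hornerE.
rewrite -[in leLHS](divpK dv) hornerM normcM !hornerE -rmorphB normc_real.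
by rewrite ler_wpM2r // normc_horner.
Qed.

(** The outer variable of [Q] is z; its coefficients are polynomials in the homotopy parameter t,
    which is specialized here. *)
Definition polyat (Q : {poly {poly R[i]}}) (t : R) : {poly R[i]} :=
  map_poly (horner_eval t%:C%C) Q.

Lemma polyat_lip m (Q : {poly {poly R[i]}}) t0 : (size Q <= m.+1)%N ->
  exists2 M, 0 <= M & forall t z, 0 <= t <= 1 ->
  normc ((polyat Q t).[z] - (polyat Q t0).[z]) <= M * `|t - t0| * (1 + normc z) ^+ m.
Proof.
move=> sQ; exists (\sum_(i < m.+1) lipc Q`_i t0); first by apply: sumr_ge0 => i _; exact: lipc_ge0.
move=> t z t01.
have E u : (polyat Q u).[z] = \sum_(i < m.+1) (Q`_i).[u%:C%C] * z ^+ i.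
  rewrite (@horner_coef_wide _ m.+1); last exact: leq_trans (size_poly _ _) sQ.
  by apply: eq_bigr => i _; rewrite coef_map.
rewrite !E -sumrB; apply: le_trans (normc_sum _ _ _) _; rewrite !mulr_suml.
apply: ler_sum => i _; rewrite -mulrBl normcM ler_pM ?normc_ge0 ?lipcP // normcX.
apply: le_trans (_ : (1 + normc z) ^+ i <= _).
  by rewrite lerXn2r ?nnegrE ?addr_ge0 ?normc_ge0 // lerDr.
by rewrite ler_weXn2l ?lerDl ?normc_ge0 // -ltnS.
Qed.

Let step_lt (A B : R) : 0 < A -> 0 <= B -> B * (A / (B + 1) / 2) < A.
Proof.
move=> A0 B0; have B1 : 0 < B + 1 by rewrite ltr_pwDr.
rewrite !mulrA ltr_pdivrMr // ltr_pdivrMr //; nra.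
Qed.

(* No root can cross the real line, so the roots stay in the lower half plane. *)
Lemma im_neg_roots_homotopy m (Q : {poly {poly R[i]}}) c : c != 0 ->
  size Q = m.+1 -> lead_coef Q = c%:P ->
  (forall t (x : R), 0 <= t <= 1 -> (polyat Q t).[x%:C%C] != 0) ->
  im_neg_roots (polyat Q 0) -> im_neg_roots (polyat Q 1).
Proof.
move=> c0 sQ lQ nr g0.
have lc t : (polyat Q t)`_m = c.
  by rewrite coef_map /= -[m]/(m.+1.-1) -sQ -lead_coefE lQ /horner_eval hornerC.
have sz t : size (polyat Q t) = m.+1.
  apply/anti_leq; rewrite -{1}sQ size_poly /= ltnNge; apply/negP => /leq_sizeP/(_ m (leqnn _)).
  by rewrite lc => /eqP; rewrite (negbTE c0).
have nz t : polyat Q t != 0 by rewrite -size_poly_gt0 sz.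
have lcE t : lead_coef (polyat Q t) = c by rewrite lead_coefE sz lc.
pose S := [set t : R | 0 <= t <= 1 /\ forall t', 0 <= t' <= t -> im_neg_roots (polyat Q t')].
have S0 : S 0.
  by split; [rewrite lexx ler01|move=> t' /le_anti <-].
have hS : has_sup S by split; [exists 0|exists 1 => t [] /andP[]].
set s := sup S.
have s01 : 0 <= s <= 1.
  rewrite (ub_le_sup hS.2 S0) /=; apply: ge_sup; first by exists 0.
  by move=> t [] /andP[].
have below t : 0 <= t -> t < s -> im_neg_roots (polyat Q t).
  move=> t0 ts; have [|e Se /ltW te] := @sup_adherent _ S (s - t) _ hS; first by rewrite subr_gt0.
  by apply: Se.2; rewrite t0; move: te; rewrite -/s opprB addrC subrK.
have gs : im_neg_roots (polyat Q s).
  have [->//|sN0] := eqVneq s 0.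
  have s0 : 0 < s by rewrite lt0r sN0; case/andP: s01.
  move=> z; rewrite le_eqVlt => /orP[/eqP z0|z0].
    have -> : z = (Re z)%:C%C by case: z z0 => a b /= <-.
    exact: nr.
  (* A zero z with Im z > 0 at parameter s would make the value at z small for the parameter s - d,
     of order d, while [im_neg_roots_lower] keeps it above a constant independent of d. *)
  have [M M0 HM] := @polyat_lip m Q s (eq_leq sQ).
  apply/negP => /eqP qz.
  pose A := normc c * Im z ^+ m; have A0 : 0 < A by rewrite mulr_gt0 ?normc_gt0 ?exprn_gt0.
  pose B := M * (1 + normc z) ^+ m.
  have B0 : 0 <= B by rewrite mulr_ge0 ?exprn_ge0 ?addr_ge0 ?normc_ge0.
  pose d := Num.min s (A / (B + 1) / 2).
  have d0 : 0 < d by rewrite lt_min s0 /= !divr_gt0 // ltr_pwDr.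
  have ds : d <= s by rewrite ge_min lexx.
  have t0 : 0 <= s - d by rewrite subr_ge0.
  have := im_neg_roots_lower (nz (s - d)) (below _ t0 _) z0.
  rewrite ltrBlDr ltrDl d0 => /(_ isT); rewrite lcE sz /= -/A.
  have := HM (s - d) z; rewrite t0 qz subr0 /= => /(_ _)/[swap] h.
  have t1 : s - d <= 1 by case/andP: s01 => _; apply: le_trans; rewrite lerBlDr lerDl ltW.
  move=> /(_ t1); rewrite addrAC subrr add0r normrN gtr0_norm // mulrAC -/B => h2.
  have : A <= B * (A / (B + 1) / 2).
    apply: le_trans h _; apply: le_trans h2 _; apply: ler_wpM2l => //.
    by rewrite ge_min lexx orbT.
  by rewrite leNgt (step_lt A0 B0).
have gS t : 0 <= t <= s -> im_neg_roots (polyat Q t).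
  by move=> /andP[t0]; rewrite le_eqVlt => /orP[/eqP -> //|]; exact: below.
have [<-//|s1] := eqVneq s 1.
have {}s1 : s < 1 by rewrite lt_neqAle s1; case/andP: s01.
exfalso.
(* Past the supremum, the lower bound at s and the change of the polynomial are both of order (1 +
   |z|)^m. For a short time d the former wins at every z at once, so s + d would belong to S. *)
have [k k0 Hk] := im_neg_roots_lower_unif (nz s) gs.
have [M M0 HM] := @polyat_lip m Q s (eq_leq sQ).
rewrite sz /= in Hk.
pose d := Num.min (1 - s) (k / (M + 1) / 2).
have d0 : 0 < d by rewrite lt_min subr_gt0 s1 /= !divr_gt0 // ltr_pwDr.
have : S (s + d).
  have d1 : s + d <= 1 by rewrite addrC -lerBrDr ge_min lexx.
  split; first by rewrite d1 andbT addr_ge0 ?(ltW d0) //; case/andP: s01.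
  move=> t /andP[t0 td]; have [ts|st] := leP t s; first by apply: gS; rewrite t0 ts.
  move=> z z0; apply/negP => /eqP qz.
  have := HM t z; rewrite t0 (le_trans td d1) => /(_ isT); rewrite qz sub0r normcN.
  move=> /(le_trans (Hk z z0)); rewrite ler_pM2r; last first.
    by rewrite exprn_gt0 // ltr_pwDl // normc_ge0.
  rewrite gtr0_norm ?subr_gt0 // => h.
  have : k <= M * (k / (M + 1) / 2).
    apply: le_trans h _; apply: ler_wpM2l => //; apply: (@le_trans _ _ d).
      by rewrite lerBlDl.
    by rewrite ge_min lexx orbT.
  by rewrite leNgt (step_lt k0 M0).
move=> /(ub_le_sup hS.2); rewrite -/s => h.
by move: d0; lra.
Qed.

End complex_poly.

Section real_poly.
Variable R : realType.
Implicit Types p : {poly R[i]}.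

Definition real_on_reals p := forall t : R, complex.Im p.[t%:C%C] = 0.

(** The polynomial with the coefficients Im p_k takes the value Im p(t) at every real t, so it
    vanishes at more integers than its degree allows. *)
Lemma real_on_reals_coef p k : real_on_reals p -> complex.Im p`_k = 0.
Proof.
move=> rp; pose q : {poly R[i]} := \poly_(j < size p) (complex.Im p`_j)%:C%C.
suff q0 : q = 0.
  have : q`_k = 0 by rewrite q0 coef0.
  by rewrite coef_poly; case: ltnP => [_ []//|pk _]; rewrite nth_default.
apply: (@roots_geq_poly_eq0 _ _ [seq (j%:R : R)%:C%C | j <- iota 0 (size q)]).
- apply/allP => _ /mapP[j _ ->]; rewrite /root /q horner_poly.
  have := rp j%:R; rewrite !horner_coef.
  have -> (I : Type) (r : seq I) (F : I -> R[i]) : complex.Im (\sum_(i <- r) F i) = \sum_(i <- r) complex.Im (F i).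
    by apply: (big_morph (@complex.Im R)) => // -[a b] [c d].
  move=> E; apply/eqP; transitivity ((\sum_(i < size p) complex.Im (p`_i * (j%:R : R)%:C%C ^+ i))%:C%C : R[i]).
    rewrite rmorph_sum; apply: eq_bigr => i _; rewrite -rmorphXn -rmorphM; congr (_%:C)%C.
    by case: (p`_i) => a b /=; rewrite mulr0 add0r.
  by rewrite E.
- rewrite map_inj_uniq ?iota_uniq // => a b /complexI /eqP; by rewrite eqr_nat => /eqP.
- by rewrite size_map size_iota.
Qed.

End real_poly.

Section complex_ivt.
Variable R : realType.

Lemma horner_Re (p : {poly R[i]}) (t : R) :
  (\poly_(j < size p) complex.Re p`_j).[t] = complex.Re p.[t%:C%C].
Proof.
rewrite horner_poly horner_coef.
have -> (I : Type) (r : seq I) (F : I -> R[i]) : complex.Re (\sum_(i <- r) F i) = \sum_(i <- r) complex.Re (F i).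
  by apply: (big_morph (@complex.Re R)) => // -[a b] [c d].
by apply: eq_bigr => i _; rewrite -rmorphXn; case: (p`_i) => a b /=; rewrite mulr0 subr0.
Qed.

(** Intermediate value theorem for a polynomial real on [0, 1]. The endpoint 0 may be a zero, so
    positivity carried towards it becomes nonstrict. *)
Lemma complex_poly_pos (p : {poly R[i]}) :
  (forall t, 0 <= t <= 1 -> complex.Im p.[t%:C%C] = 0) ->
  (forall t, 0 < t <= 1 -> p.[t%:C%C] != 0) ->
  (0 < p.[0] -> 0 < p.[1]) /\ (0 < p.[1] -> 0 <= p.[0]).
Proof.
move=> pr p0; pose q := \poly_(j < size p) complex.Re p`_j.
have E t : 0 <= t <= 1 -> p.[t%:C%C] = q.[t]%:C%C.
  by move=> t01; rewrite horner_Re; move: (pr t t01); case: (p.[_]) => x y /= ->.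
have E0 : p.[0] = q.[0]%:C%C by rewrite -E ?lexx ?ler01.
have E1 : p.[1] = q.[1]%:C%C by rewrite -E ?lexx ?ler01.
have qn t : 0 < t <= 1 -> q.[t] != 0.
  move=> /andP[t0 t1]; apply: contra (p0 t _); rewrite ?t0 // => /eqP.
  by rewrite E ?(ltW t0) // => ->.
rewrite E0 E1 !ltcR !lecR; split=> h; rewrite leNgt || rewrite ltNge; apply/negP => h'.
  have [||x /andP[x0 x1] /eqP qx] := @poly_ivt R (- q) 0 1; rewrite ?ler01 ?hornerN ?oppr_le0 ?oppr_ge0 ?(ltW h) //.
  have [x00|] := eqVneq x 0.
    by move: qx; rewrite x00 hornerN => /eqP; rewrite oppr_eq0 gt_eqF.
  move=> xn0; have := qn x; rewrite x1 lt0r xn0 x0 => /(_ isT)/eqP; apply.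
  by apply/eqP; rewrite -oppr_eq0 -hornerN qx.
have [||x /andP[x0 x1] /eqP qx] := @poly_ivt R q 0 1; rewrite ?ler01 ?(ltW h) ?(ltW h') //.
have [x00|xn0] := eqVneq x 0; first by move: h'; rewrite -{1}x00 qx ltxx.
by have := qn x; rewrite x1 lt0r xn0 x0 qx eqxx => /(_ isT).
Qed.

End complex_ivt.

Section linpow.
Variable K : comNzRingType.
Implicit Types (u v Om : K) (d : nat).

Definition linpow d Om u v : {poly K} := (u%:P + 'X * v%:P) ^+ d * Om%:P.

Lemma horner_linpow d Om u v z : (linpow d Om u v).[z] = (u + z * v) ^+ d * Om.
Proof. by rewrite /linpow !(hornerE, horner_exp). Qed.

Lemma size_linpow_le d Om u v : (size (linpow d Om u v) <= d.+1)%N.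
Proof.
have s1 : (size (u%:P + 'X * v%:P)%R <= 2)%N.
  rewrite (leq_trans (size_polyD _ _)) // geq_max (leq_trans (size_polyC_leq1 _)) //=.
  by rewrite (leq_trans (size_polyMleq _ _)) // size_polyX; have := size_polyC_leq1 v; case: size => [|[]].
rewrite /linpow (leq_trans (size_polyMleq _ _)) //.
have := size_polyC_leq1 Om; have : (size ((u%:P + 'X * v%:P) ^+ d) <= d.+1)%N.
  by rewrite (leq_trans (size_poly_exp_leq _ _)) // ltnS -[leqRHS]mul1n leq_mul2r; case: size s1 => [|[|[]]] //; rewrite orbT.
by case: (size Om%:P) => [|[]] //; rewrite ?addn0 ?addn1 //= => h _; apply: leq_trans h => //; case: size.
Qed.

Lemma coef_linpow d Om u v : (linpow d Om u v)`_d = v ^+ d * Om.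
Proof.
rewrite /linpow coefMC; congr (_ * _).
elim: d => [|d IH]; first by rewrite !expr0 coef1.
rewrite exprS mulrDl coefD coefCM -mulrA coefXM /= coefCM IH -exprS.
have := @size_linpow_le d 1 u v; rewrite /linpow mulr1 => /leq_sizeP -> //.
by rewrite mulr0 add0r.
Qed.

Lemma deriv_linpow d Om u v : (linpow d.+1 Om u v)^`() = (linpow d (v * Om) u v) *+ d.+1.
Proof.
rewrite /linpow derivM derivC mulr0 addr0 deriv_exp derivD derivC add0r derivM derivX derivC mulr0 addr0 mul1r.
by rewrite /= polyCM mulrnAl -mulrA mulrCA.
Qed.

End linpow.

Lemma map_linpow (K K' : comNzRingType) (f : {rmorphism K -> K'}) d (Om u v : K) :
  map_poly f (linpow d Om u v) = @linpow K' d (f Om) (f u) (f v).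
Proof.
rewrite /linpow rmorphM /= map_polyC rmorphXn /= rmorphD /= map_polyC.
by rewrite rmorphM /= map_polyX map_polyC.
Qed.

(** * Stability in tubes over cones, in a commutative ring *)

Section garding.
(** Intended reading: [K] is the ring of even forms, [io] embeds the scalars, [L] is the coefficient
    of the volume form, and [V] consists of the real (1,1)-forms. *)
Variables (R : realType) (K : comNzRingType) (io : {rmorphism R[i] -> K}).
Variables (L : {additive K -> R[i]}).
Hypothesis Lscale : forall c u, L (io c * u) = c * L u.
Variable V : K -> Prop.
Hypothesis VD : forall x y, V x -> V y -> V (x + y).
Hypothesis VZ : forall (t : R) x, V x -> V (io t%:C%C * x).
Implicit Types (u v x y b e Om : K) (C : K -> Prop) (d m : nat) (t : R).
Local Notation "'ii'" := (io (Complex 0 1)).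
Local Notation r2K t := (io t%:C%C).

Lemma horner_map_scale (q : {poly K}) z : (map_poly L q).[z] = L q.[io z].
Proof.
rewrite (@horner_coef_wide _ (size q)) ?size_poly // horner_coef raddf_sum.
by apply: eq_bigr => j _; rewrite coef_map_id0 ?raddf0 // -rmorphXn mulrC -Lscale mulrC.
Qed.

(* For forms, [L (x ^+ d * Om)] is a polynomial in the coefficients of [x];
   [stab] says that it has no zeros in the tube over the cone [C], that is,
   that it is hyperbolic in the directions of [C]. *)
Definition stab d Om C := forall x y, V x -> C y -> L ((x + ii * y) ^+ d * Om) != 0.

Definition cone C := [/\ forall y, C y -> V y,
  forall y y' t, C y -> C y' -> 0 <= t -> C (y + r2K t * y') &
  forall y t, C y -> 0 < t -> C (r2K t * y)].

Lemma complex_split (z : R[i]) : z = (complex.Re z)%:C%C + Complex 0 1 * (complex.Im z)%:C%C.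
Proof. exact: complexE. Qed.

Lemma Lscale_exp c d u Om : L ((io c * u) ^+ d * Om) = c ^+ d * L (u ^+ d * Om).
Proof. by rewrite exprMn -mulrA -rmorphXn Lscale. Qed.

Lemma stab_lead d Om C v : cone C -> V 0 -> stab d Om C -> C v -> L (v ^+ d * Om) != 0.
Proof.
move=> cC V0 sC Cv; have := sC 0 v V0 Cv; rewrite add0r Lscale_exp.
by rewrite mulf_eq0 negb_or => /andP[].
Qed.

(* Up to a factor, [L ((x + ii * y) ^+ d * (v * Om))] is the derivative at 0 of
   [z |-> L ((x + ii * y + io z * v) ^+ d.+1 * Om)], to which Gauss-Lucas applies. *)
Lemma stab_deriv d Om C v : cone C -> V 0 -> C v -> stab d.+1 Om C -> stab d (v * Om) C.
Proof.
move=> cC V0 Cv sC x y Vx Cy; have [CV CD CZ] := cC.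
pose p := map_poly L (linpow d.+1 Om (x + ii * y) v).
have sp : (1 < size p)%N.
  rewrite ltnNge; apply/negP => /leq_sizeP/(_ d.+1 isT).
  rewrite coef_map_id0 ?raddf0 // coef_linpow => /eqP; apply/negP.
  exact: stab_lead cC _ sC Cv.
have : im_neg_roots p.
  move=> z z0; rewrite horner_map_scale horner_linpow.
  have -> : x + ii * y + io z * v = (x + r2K (complex.Re z) * v) + ii * (y + r2K (complex.Im z) * v).
    rewrite [in LHS](complex_split z) rmorphD rmorphM /= mulrDl mulrDr -!addrA; congr (_ + _).
    by rewrite addrCA mulrA.
  by apply: sC; [apply: VD => //; apply: VZ; exact: CV|exact: CD].
move=> /(im_neg_roots_deriv0 sp).
have -> : p^`() = map_poly L ((linpow d.+1 Om (x + ii * y) v)^`()).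
  by apply/polyP => j; rewrite !(coef_map_id0, coef_deriv) ?raddf0 // raddfMn.
rewrite horner_map_scale deriv_linpow hornerMn horner_linpow rmorph0 mul0r addr0 raddfMn.
by rewrite mulrn_eq0 negb_or => /andP[].
Qed.

Definition realL d Om := forall x, V x -> complex.Im (L (x ^+ d * Om)) = 0.

(** Up to the factor d + 1, the value is the linear coefficient of a polynomial in t that is real
    for real t. *)
Lemma realL_deriv d Om v : V v -> realL d.+1 Om -> realL d (v * Om).
Proof.
move=> Vv rL x Vx; pose p := map_poly L (linpow d.+1 Om x v).
have rp : real_on_reals p.
  move=> t; rewrite horner_map_scale horner_linpow; apply: rL.
  by apply: VD => //; exact: VZ.
have := real_on_reals_coef 1 rp.
have -> : p`_1 = L (linpow d.+1 Om x v)^`().[0].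
  by rewrite horner_coef0 coef_deriv mulr1n coef_map_id0 ?raddf0.
rewrite deriv_linpow hornerMn horner_linpow mul0r addr0 raddfMn.
have ImMn (z : R[i]) k : complex.Im (z *+ k) = complex.Im z *+ k.
  by elim: k => // k IH; rewrite !mulrS -IH; case: z {IH} => a b; case: (_ *+ _).
by rewrite ImMn => /eqP; rewrite mulrn_eq0 /= => /eqP.
Qed.

Definition span_ray C b y := exists2 y0, C y0 & exists2 s, 0 <= s & y = y0 + r2K s * b.

Lemma cone_ray C b : cone C -> V b -> cone (span_ray C b).
Proof.
move=> [CV CD CZ] Vb; split.
- by move=> _ [y Cy [s s0 ->]]; apply: VD; [exact: CV|exact: VZ].
- move=> _ _ t [y Cy [s s0 ->]] [y' Cy' [s' s0' ->]] t0.
  exists (y + r2K t * y'); first exact: CD.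
  exists (s + t * s'); first by rewrite addr_ge0 ?mulr_ge0.
  by rewrite mulrDr addrACA mulrA -mulrDl -!rmorphM -!rmorphD.
- move=> _ t [y Cy [s s0 ->]] t0; exists (r2K t * y); first exact: CZ.
  by exists (t * s); [rewrite mulr_ge0 // ltW|rewrite mulrDr mulrA -!rmorphM].
Qed.

(** Openness in the single direction [e]: each point of the cone can give up a small multiple of
    [e], and this multiple is where the homotopy starts. *)
Definition open_at e C := forall y, C y -> exists2 s, 0 < s & C (y - r2K s * e).

Lemma open_ray e C b : open_at e C -> open_at e (span_ray C b).
Proof.
move=> oC _ [y Cy [s s0 ->]]; have [t t0 Cyt] := oC y Cy; exists t => //.
by exists (y - r2K t * e) => //; exists s => //; rewrite addrAC.
Qed.

(** For z nonzero the argument is z (b + tau e) with tau = i s / z. If Im tau > 0, the point b + tau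
    e lies in the tube; if Im tau < 0, its opposite does; if tau is real, then Im z >= 0 makes it
    nonnegative and the hypothesis on b + t e applies. *)
Lemma im_neg_roots_init m Om C e b (s : R) : cone C -> V 0 -> stab m Om C -> C e -> V b -> 0 < s ->
  (forall t, 0 <= t -> L ((b + r2K t * e) ^+ m * Om) != 0) ->
  forall z, 0 <= complex.Im z -> L ((io z * b + ii * (r2K s * e)) ^+ m * Om) != 0.
Proof.
move=> cC V0 sC Ce Vb s0 bt z z0; have [CV CD CZ] := cC.
have [->|zn0] := eqVneq z 0.
  by rewrite rmorph0 mul0r; apply: sC => //; exact: CZ.
pose tau := Complex 0 1 * s%:C%C / z.
have -> : io z * b + ii * (r2K s * e) = io z * (b + io tau * e).
  rewrite mulrDr !mulrA -!rmorphM; congr (_ + io _ * _).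
  by rewrite /tau [in RHS]mulrC divfK.
rewrite Lscale_exp mulf_neq0 ?expf_neq0 //.
have NV (w : R) x : V x -> V (x + r2K w * e).
  by move=> Vx; apply: VD => //; apply: VZ; exact: CV.
have Et : b + io tau * e = b + r2K (complex.Re tau) * e + ii * (r2K (complex.Im tau) * e).
  by rewrite {1}(complex_split tau) rmorphD rmorphM mulrDl -!addrA !mulrA.
have [t0|t0|t0] := ltgtP (complex.Im tau) 0.
- rewrite Et.
  have -> : b + r2K (complex.Re tau) * e + ii * (r2K (complex.Im tau) * e) =
     io (-1) * (r2K (-1) * (b + r2K (complex.Re tau) * e) + ii * (r2K (- complex.Im tau) * e)).
    by rewrite !rmorphN !rmorph1 !mulN1r mulNr mulrN -opprD opprK.
  rewrite Lscale_exp mulf_neq0 ?expf_neq0 ?oppr_eq0 ?oner_eq0 //.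
  apply: sC; first by apply: VZ; exact: NV.
  by apply: CZ => //; rewrite oppr_gt0.
- by rewrite Et; apply: sC; [exact: NV|exact: CZ].
- rewrite Et t0 !rmorph0 mul0r mulr0 addr0; apply: bt.
  move: z0 zn0; rewrite /tau; case: (z) => a c /= c0 _.
  rewrite !(mul0r, mulr0, mul1r, subrr, sub0r, add0r, oppr0) mulrN opprK mulr_ge0 ?(ltW s0) //.
  by rewrite divr_ge0 // addr_ge0 ?sqr_ge0.
Qed.

(** Write y = y' + h e and deform from i h e to x + i y by adding t (x + i y'). The polynomials in z
    are L((i h e + t (x + i y') + z b)^m Om). For real z the argument stays in the tube over [C], so
    no zero is real; the initial polynomial is [im_neg_roots_init], and z = i s at time 1 is the
    claim. The hypothesis at t = 0 makes the leading coefficient L(b^m Om) nonzero. *)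
Lemma stab_ray0 m Om C e b : cone C -> V 0 -> stab m Om C -> C e -> open_at e C -> V b ->
  (forall t, 0 <= t -> L ((b + r2K t * e) ^+ m * Om) != 0) -> stab m Om (span_ray C b).
Proof.
move=> cC V0 sC Ce oC Vb bt x _ Vx [y Cy [s s0 ->]]; have [CV CD CZ] := cC.
have [h h0 Cyh] := oC y Cy; set y' := y - r2K h * e in Cyh.
pose q : {poly {poly K}} :=
  linpow m Om%:P ((ii * (r2K h * e))%:P + 'X * (x + ii * y')%:P) b%:P.
pose Q : {poly {poly R[i]}} := map_poly (map_poly L) q.
have E t : polyat Q t = map_poly L (linpow m Om (ii * (r2K h * e) + r2K t * (x + ii * y')) b).
  have <- : map_poly (horner_eval (r2K t)) q = linpow m Om (ii * (r2K h * e) + r2K t * (x + ii * y')) b.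
    by rewrite map_linpow /= /horner_eval !hornerE.
  apply/polyP => j; rewrite coef_map /= !coef_map_id0 ?raddf0 //.
  by rewrite /horner_eval horner_map_scale.
have Lb : L (b ^+ m * Om) != 0 by have := bt 0 (lexx _); rewrite rmorph0 mul0r addr0.
have Qm : Q`_m = (L (b ^+ m * Om))%:P.
  rewrite coef_map_id0 ?raddf0 // coef_linpow -polyC_exp -polyCM.
  by apply/polyP => j; rewrite coef_map_id0 ?raddf0 // !coefC; case: ifP; rewrite ?raddf0.
have sQ : size Q = m.+1.
  apply/anti_leq/andP; split.
    by apply: leq_trans (size_poly _ _) _; exact: size_linpow_le.
  rewrite ltnNge; apply/negP => /leq_sizeP/(_ m (leqnn _)).
  by rewrite Qm => /eqP; rewrite polyC_eq0 (negbTE Lb).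
have lQ : lead_coef Q = (L (b ^+ m * Om))%:P by rewrite lead_coefE sQ.
have arg t z : ii * (r2K h * e) + r2K t * (x + ii * y') + z * b =
    (r2K t * x + z * b) + ii * (r2K h * e + r2K t * y').
  by move: (y') ii (r2K h) (r2K t) => w i1 h1 t1; ring.
have := im_neg_roots_homotopy Lb sQ lQ.
have nr t (z : R) : 0 <= t <= 1 -> (polyat Q t).[z%:C%C] != 0.
  move=> /andP[t0 _]; rewrite E horner_map_scale horner_linpow arg; apply: sC.
    by apply: VD; exact: VZ.
  by apply: CD => //; exact: CZ.
move=> /(_ nr); rewrite !E => H.
have /H/(_ (Complex 0 s) s0) : im_neg_roots (map_poly L (linpow m Om (ii * (r2K h * e) + r2K 0 * (x + ii * y')) b)).
  move=> z z0; rewrite horner_map_scale horner_linpow !rmorph0 mul0r addr0 addrC.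
  exact: im_neg_roots_init cC V0 sC Ce Vb h0 bt z z0.
rewrite horner_map_scale horner_linpow arg !rmorph1 !mul1r -addrA.
suff -> : io (Complex 0 s) * b + ii * (r2K h * e + y') = ii * (y + r2K s * b) by [].
have -> : Complex 0 s = Complex 0 1 * s%:C%C.
  by apply/eqP; rewrite eq_complex /= !(mul0r, mul1r, mulr0, subr0, add0r, subrr, oppr0) !eqxx.
by rewrite /y' rmorphM -mulrA -mulrDr [r2K h * e + _]addrC subrK addrC.
Qed.

(** Here L(b^m Om) may vanish, as it can for an m-positive form on the boundary of the cone. A piece
    of y is moved to the ray: y + s b = (y - h e) + s (b + (h / s) e), and the new ray generator
    satisfies the hypothesis of [stab_ray0]. *)
Lemma stab_ray m Om C e b : cone C -> V 0 -> stab m Om C -> C e -> open_at e C -> V b ->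
  (forall t, 0 < t -> L ((b + r2K t * e) ^+ m * Om) != 0) -> stab m Om (span_ray C b).
Proof.
move=> cC V0 sC Ce oC Vb bt x _ Vx [y Cy [s s0 ->]]; have [CV CD CZ] := cC.
have [->|sn0] := eqVneq s 0; first by rewrite rmorph0 mul0r addr0; exact: sC.
have [h h0 Cyh] := oC y Cy; have {}s0 : 0 < s by rewrite lt0r sn0.
have -> : y + r2K s * b = y - r2K h * e + r2K s * (b + r2K (h / s) * e).
  rewrite mulrDr mulrA -!rmorphM [s * _]mulrC divfK //.
  by rewrite addrACA addNr addr0.
have sb : stab m Om (span_ray C (b + r2K (h / s) * e)).
  apply: (stab_ray0 cC V0 sC Ce oC).
    by apply: VD => //; apply: VZ; exact: CV.
  move=> t t0; rewrite -addrA -mulrDl -!rmorphD; apply: bt.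
  by rewrite ltr_wpDr // divr_gt0.
by apply: sb => //; exists (y - r2K h * e) => //; exists s => //; rewrite ltW.
Qed.

Fixpoint span_rays C (bs : seq K) : K -> Prop :=
  if bs is b :: bs' then span_ray (span_rays C bs') b else C.

Lemma span_rays_sub C bs y : C y -> span_rays C bs y.
Proof.
move=> Cy; elim: bs => //= b bs IH; exists y => //; exists 0 => //.
by rewrite rmorph0 mul0r addr0.
Qed.

Lemma span_rays_mem C bs e b t : C e -> 0 <= t -> List.In b bs -> span_rays C bs (e + r2K t * b).
Proof.
move=> Ce t0; elim: bs => //= b' bs IH [<-|/IH H].
  by exists e; [exact: span_rays_sub|exists t].
by exists (e + r2K t * b) => //; exists 0 => //; rewrite rmorph0 mul0r addr0.
Qed.

Lemma stab_rays m Om C e bs : cone C -> V 0 -> stab m Om C -> C e -> open_at e C ->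
  (forall b, List.In b bs -> V b /\ forall t, 0 < t -> L ((b + r2K t * e) ^+ m * Om) != 0) ->
  [/\ cone (span_rays C bs), stab m Om (span_rays C bs) & open_at e (span_rays C bs)].
Proof.
move=> cC V0 sC Ce oC; elim: bs => [_|b bs IH H] /=; first by split.
have [|cC' sC' oC'] := IH; first by move=> b' ib'; apply: H; right.
have [Vb bt] := H b (or_introl erefl).
split; [exact: cone_ray|apply: stab_ray bt => //; exact: span_rays_sub|exact: open_ray].
Qed.

Lemma stab_prod m Om C (cs : seq K) : cone C -> V 0 -> (forall c, List.In c cs -> C c) ->
  stab (size cs + m) Om C -> stab m ((\prod_(c <- cs) c) * Om) C.
Proof.
move=> cC V0; elim: cs m => [|c cs IH] m Cc sC; first by rewrite big_nil mul1r.
rewrite big_cons -mulrA; apply: stab_deriv => //; first by apply: Cc; left.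
by apply: IH => [c' ic'|]; [apply: Cc; right|rewrite addnS].
Qed.

Lemma realL_prod m Om (cs : seq K) : (forall c, List.In c cs -> V c) ->
  realL (size cs + m) Om -> realL m ((\prod_(c <- cs) c) * Om).
Proof.
elim: cs m => [|c cs IH] m Cc sC; first by rewrite big_nil mul1r.
rewrite big_cons -mulrA; apply: realL_deriv => //; first by apply: Cc; left.
by apply: IH => [c' ic'|]; [apply: Cc; right|rewrite addnS].
Qed.

Lemma prod_homog (t : R) e bs : t != 0 ->
  \prod_(b <- bs) (b + r2K t * e) = r2K t ^+ size bs * \prod_(b <- bs) (e + r2K t^-1 * b).
Proof.
move=> t0; elim: bs => [|b bs IH]; first by rewrite !big_nil mulr1.
rewrite !big_cons IH /= exprS mulrACA; congr (_ * _).
by rewrite mulrDr mulrA -!rmorphM divff // !rmorph1 mul1r addrC.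
Qed.

Lemma cone_halfline e : V e -> cone (fun y => exists2 s, 0 < s & y = r2K s * e).
Proof.
move=> Ve; split=> [_ [s _ ->]|_ _ t [s s1 ->] [s' s1' ->] t0|_ t [s s1 ->] t0]; first exact: VZ.
    by exists (s + t * s'); [rewrite ltr_wpDr // mulr_ge0 // ltW|rewrite mulrA -!rmorphM -mulrDl -!rmorphD].
  by exists (t * s); [rewrite mulr_gt0|rewrite mulrA -!rmorphM].
Qed.

(** All [bs] are adjoined to the half line of [e] without losing stability. Products of elements of
    the enlarged cone are then nonzero under L, by repeated differentiation, and real. Each b may
    lie on the boundary, so the sign is transported in two moves: from the power of [e] to the
    product of the e + b, then down to the product of the b. *)
Theorem garding Om e bs : V 0 -> V e ->
  stab (size bs) Om (fun y => exists2 s, 0 < s & y = r2K s * e) ->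
  realL (size bs) Om -> 0 < L (e ^+ size bs * Om) ->
  (forall b, List.In b bs -> V b /\
     forall t, 0 < t -> L ((b + r2K t * e) ^+ size bs * Om) != 0) ->
  0 <= L ((\prod_(b <- bs) b) * Om).
Proof.
move=> V0 Ve s0 rL L0 Hb; pose C0 y := exists2 s, 0 < s & y = r2K s * e.
have cC0 : cone C0 by exact: cone_halfline.
have C0e : C0 e by exists 1 => //; rewrite !rmorph1 mul1r.
have oC0 : open_at e C0.
  move=> _ [s s1 ->]; exists (s / 2); first by rewrite divr_gt0.
  exists (s / 2); first by rewrite divr_gt0.
  by rewrite -mulrBl -!rmorphB {1}[s]splitr addrK.
have [cC sC oC] := stab_rays cC0 V0 s0 C0e oC0 Hb.
pose c t := [seq e + r2K t * b | b <- bs].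
have cP t : 0 <= t -> L ((\prod_(x <- c t) x) * Om) != 0 /\ complex.Im (L ((\prod_(x <- c t) x) * Om)) = 0.
  move=> t0; split.
    have /(_ 0 e V0 (span_rays_sub _ C0e)) : stab 0 ((\prod_(x <- c t) x) * Om) (span_rays C0 bs).
      apply: stab_prod => //; last by rewrite size_map addn0.
      move=> x /List.in_map_iff[b [<- ib]]; exact: span_rays_mem.
    by rewrite expr0 mul1r.
  have /(_ 0 V0) : realL 0 ((\prod_(x <- c t) x) * Om).
    apply: realL_prod; last by rewrite size_map addn0.
    move=> x /List.in_map_iff[b [<- ib]]; apply: VD => //; apply: VZ.
    by case: (Hb b ib).
  by rewrite expr0 mul1r.
have Lprod (u v : K -> {poly K}) t : (map_poly L (\prod_(b <- bs) (u b + v b) * Om%:P)).[t%:C%C] =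
    L (\prod_(b <- bs) ((u b).[r2K t] + (v b).[r2K t]) * Om).
  rewrite horner_map_scale hornerM hornerC horner_prod; congr (L (_ * _)).
  by apply: eq_bigr => b _; rewrite hornerD.
(* [g] starts at L(e^k Om) > 0, with k the number of factors, and has no zero on [0, 1], so it is
   positive at 1. *)
pose g := map_poly L (\prod_(b <- bs) (e%:P + 'X * b%:P) * Om%:P).
have gE t : g.[t%:C%C] = L ((\prod_(x <- c t) x) * Om).
  by rewrite Lprod big_map; congr (L (_ * _)); apply: eq_bigr => b _; rewrite !hornerE.
(* [h] agrees with [g] at 1, and homogeneity relates h(t) to g(1/t) for t > 0, so it has no zero
   there; its value at 0 is the product sought. *)
pose h := map_poly L (\prod_(b <- bs) (b%:P + 'X * e%:P) * Om%:P).
have hE t : h.[t%:C%C] = L (\prod_(b <- bs) (b + r2K t * e) * Om).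
  by rewrite Lprod; congr (L (_ * _)); apply: eq_bigr => b _; rewrite !hornerE.
have hg t : 0 < t -> h.[t%:C%C] = t%:C%C ^+ size bs * g.[t^-1%:C%C].
  move=> t0; rewrite hE gE -Lscale mulrA rmorphXn /= /c big_map -prod_homog ?gt_eqF //.
have unit_gt0 (t : R) : 0 < t -> 0 < t^-1 by rewrite invr_gt0.
have [t /andP[t0 _]|t /andP[/ltW t0 _]|g01 _] := @complex_poly_pos _ g.
- by rewrite gE; case: (cP t t0).
- by rewrite gE; case: (cP t t0).
have hb : h.[0] = L ((\prod_(b <- bs) b) * Om).
  rewrite -(rmorph0 (real_complex R)) hE; congr (L (_ * _)); apply: eq_bigr => b _.
  by rewrite !rmorph0 mul0r addr0.
have [t /andP[]|t /andP[t0 _]|_ h10] := @complex_poly_pos _ h.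
- rewrite le_eqVlt => /orP[/eqP <-|t0] _.
    rewrite rmorph0 hb; have /(_ 0 V0) : realL 0 ((\prod_(b <- bs) b) * Om).
      apply: realL_prod; last by rewrite addn0.
      by move=> b ib; case: (Hb b ib).
    by rewrite expr0 mul1r.
  rewrite hg // gE -rmorphXn; have [_] := cP _ (ltW (unit_gt0 _ t0)).
  by case: (L _) => x y /= ->; rewrite mulr0 mul0r addr0.
- rewrite hg // mulf_neq0 ?expf_neq0 //; last by rewrite gE; case: (cP _ (ltW (unit_gt0 _ t0))).
  by rewrite -(rmorph0 (real_complex R)) (inj_eq (@complexI R)) gt_eqF.
rewrite -hb; apply: h10.
have := hg 1 ltr01; rewrite invr1 !rmorph1 expr1n mul1r => ->; apply: g01.
rewrite -(rmorph0 (real_complex R)) gE /c big_map.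
have -> : \prod_(b <- bs) (e + r2K 0 * b) = e ^+ size bs.
  rewrite (eq_bigr (fun=> e)); last by move=> b _; rewrite !rmorph0 mul0r addr0.
  by rewrite big_const_seq count_predT; elim: (size bs) => /= [|k ->]; rewrite ?expr0 ?exprS.
by [].
Qed.

End garding.

(** * Mixed products of m-positive forms *)

Section mixed_positivity.
Variables (R : realType) (n : nat).
Implicit Types (A : 'M[R[i]]_n) (t s : R).
Local Notation L := (@evtop R n).
Local Notation io := (evscalar n).

Definition herm_mx A := forall j k, A k j = ((A j k)^*)%C.

Definition hform (x : evform R n) := exists2 A, herm_mx A & x = ev11 A.

Definition ebeta : evform R n := ev11 1%:M.

Lemma herm_mxD A B : herm_mx A -> herm_mx B -> herm_mx (A + B).
Proof. by move=> hA hB j k; rewrite !mxE hA hB rmorphD. Qed.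

Lemma herm_mxZ t A : herm_mx A -> herm_mx (t%:C%C *: A).
Proof. by move=> hA j k; rewrite !mxE hA rmorphM /= oppr0. Qed.

Lemma herm_mx1 : herm_mx 1%:M.
Proof. by move=> j k; rewrite !mxE eq_sym; case: eqP => _ /=; rewrite ?oppr0. Qed.

Lemma hformD x y : hform x -> hform y -> hform (x + y).
Proof.
by move=> [A hA ->] [B hB ->]; exists (A + B); [exact: herm_mxD|rewrite ev11D].
Qed.

Lemma hformZ t x : hform x -> hform (io t%:C%C * x).
Proof.
by move=> [A hA ->]; exists (t%:C%C *: A); [exact: herm_mxZ|rewrite ev11Z].
Qed.

Lemma det_hermitian A : herm_mx A -> complex.Im (\det A) = 0.
Proof.
move=> hA; have : ((\det A)^*)%C = \det A.
  rewrite -det_map_mx -[RHS]det_tr; congr (\det _).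
  by apply/matrixP => j k; rewrite !mxE [RHS]hA.
by case: (\det A) => a b /= [] /eqP; rewrite -subr_eq0 -opprD oppr_eq0 -mulr2n mulrn_eq0 /= => /eqP.
Qed.

(** For an eigenvector v of the eigenvalue -is, the number v A v^* would be -is |v|^2, but it is
    real for a Hermitian A. *)
Lemma det_hermitian_shift A s : herm_mx A -> s != 0 ->
  \det (A + (Complex 0 s)%:M) != 0.
Proof.
move=> hA s0; apply/negP => /det0P[v v0].
rewrite mulmxDr mul_mx_scalar => /eqP; rewrite addr_eq0 => /eqP vA.
pose w := map_mx (@conjc R) v^T.
pose q := \sum_j \sum_k v 0 j * A j k * ((v 0 k)^*)%C.
have qr : ((q)^*)%C = q.
  rewrite /q rmorph_sum exchange_big /=; apply: eq_bigr => j _; rewrite rmorph_sum; apply: eq_bigr => k _.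
  have cM (x y : R[i]) : ((x * y)^*)%C = (x^*)%C * (y^*)%C by rewrite -rmorphM.
  rewrite [LHS]cM [in LHS]cM (conjcK (v 0 k)) [A k j]hA.
  by rewrite [LHS]mulrC mulrA mulrAC.
pose W := \sum_k (complex.Re (v 0 k) ^+ 2 + complex.Im (v 0 k) ^+ 2).
have W0 : 0 < W.
  rewrite lt0r; apply/andP; split; last by apply: sumr_ge0 => k _; rewrite addr_ge0 ?sqr_ge0.
  apply: contra v0; rewrite psumr_eq0; last by move=> k _; rewrite addr_ge0 ?sqr_ge0.
  move=> /allP h; apply/eqP/rowP => k; rewrite mxE; have := h k (mem_index_enum _).
  rewrite paddr_eq0 ?sqr_ge0 // !expf_eq0 /=; case: (v 0 k) => a b /= /andP[/eqP -> /eqP ->] //.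
have qE : q = - Complex 0 s * W%:C%C.
  rewrite /q exchange_big /= rmorph_sum mulr_sumr; apply: eq_bigr => k _.
  have /rowP/(_ k) := vA; rewrite !mxE -mulr_suml => ->.
  rewrite !mulNr; congr (- _); rewrite -mulrA; congr (_ * _).
  by rewrite -sqr_normc -add_Re2_Im2.
have {}qE : q = Complex 0 (- (s * W)).
  rewrite qE.
  by apply/eqP; rewrite eq_complex /=; apply/andP; split; apply/eqP; ring.
move: qr; rewrite qE => -[sW].
by have /eqP := mulf_neq0 s0 (lt0r_neq0 W0); apply; lra.
Qed.

Lemma realL_ev : realL L hform n 1.
Proof.
move=> _ [A hA ->] /=; rewrite mulr1 evtop_ev11X.
have := det_hermitian hA; case: (\det A) => a b /= ->.
by rewrite mulr_natl; elim: (_ * _)%N => [|k IH]; rewrite ?mulr0n // mulrS /=; case: (_ *+ k) IH => x y /= ->; rewrite addr0.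
Qed.

Lemma stab_ev : stab io L hform n 1 (fun y => exists2 s, 0 < s & y = io s%:C%C * ebeta).
Proof.
move=> _ _ [A hA ->] [s s0 ->] /=; rewrite mulr1 mulrA -rmorphM.
rewrite -ev11Z -ev11D evtop_ev11X mulf_neq0 //.
have -> : 'i%C * s%:C%C = Complex 0 s :> R[i].
  by apply/eqP; rewrite eq_complex /= !(mul0r, mul1r, mulr0, subr0, add0r, subrr, oppr0) !eqxx.
by rewrite scalemx1 det_hermitian_shift ?gt_eqF.
Qed.

Lemma evtop_beta_gt0 : 0 < L (ebeta ^+ n).
Proof. by rewrite evtop_ev11X det1 mulr1 ltr0n muln_gt0 fact_gt0 expn_gt0. Qed.

(** Garding's inequality with Om = beta^(n - m): the stability of L(x^n) passes through n - m
    derivatives in the direction beta. *)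
Lemma mixed_positivity m (bs : seq (evform R n)) : (m <= n)%N -> size bs = m ->
  (forall b, List.In b bs -> hform b /\
     forall k, (1 <= k <= m)%N -> 0 <= L (b ^+ k * ebeta ^+ (n - k))) ->
  0 <= L ((\prod_(b <- bs) b) * ebeta ^+ (n - m)).
Proof.
move=> mn sb Hb.
have V0 : hform 0.
  exists 0; first by move=> j k; rewrite !mxE /= oppr0.
  by rewrite -[0]addr0 -{1}(scale0r 0) ev11Z rmorph0 mul0r addr0.
have Ve : hform ebeta by exists 1%:M => //; exact: herm_mx1.
have pe : \prod_(b <- nseq (n - m) ebeta) b = ebeta ^+ (n - m).
  by rewrite big_nseq; elim: (n - m)%N => //= k ->; rewrite exprS.
have inE (b : evform R n) : List.In b (nseq (n - m) ebeta) -> b = ebeta.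
  by elim: (n - m)%N => //= k IH [<-|/IH].
apply: (garding (@evtop_scalar_mul R n) hformD hformZ V0 Ve); rewrite ?sb.
- have := @stab_prod _ _ _ _ (@evtop_scalar_mul R n) hform hformD hformZ m 1
    (fun y => exists2 s, 0 < s & y = io s%:C%C * ebeta) (nseq (n - m) ebeta).
  rewrite pe mulr1 size_nseq subnK //; apply => //; last exact: stab_ev.
  + exact: (cone_halfline hformZ Ve).
  + by move=> b /inE ->; exists 1 => //; rewrite !rmorph1 mul1r.
- have := @realL_prod _ _ _ _ (@evtop_scalar_mul R n) hform hformD hformZ m 1 (nseq (n - m) ebeta).
  rewrite pe mulr1 size_nseq subnK //; apply => //; last exact: realL_ev.
  by move=> b /inE ->.
- by rewrite -exprD subnKC // evtop_beta_gt0.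
- move=> b ib; have [hb pb] := Hb b ib; split=> // t t0.
  (* In the binomial expansion of (b + t beta)^m the terms containing b are nonnegative by
     hypothesis, and the remaining one is t^m L(beta^n) > 0. *)
  rewrite gt_eqF // addrC exprDn mulr_suml raddf_sum big_ord_recl /=.
  have E (k : nat) : (k <= m)%N -> L ((io t%:C%C * ebeta) ^+ (m - k) * b ^+ k *+ 'C(m, k) * ebeta ^+ (n - m)) =
      (t%:C%C ^+ (m - k) * L (b ^+ k * ebeta ^+ (n - k))) *+ 'C(m, k).
    move=> km; rewrite mulrnAl raddfMn /= exprMn -rmorphXn -!mulrA evtop_scalar_mul.
    congr (_ * L _ *+ _); rewrite mulrCA -exprD; congr (_ * _ ^+ _).
    by rewrite addnC addnBA // subnK.
  have tk k : 0 < (t%:C%C : R[i]) ^+ k by rewrite exprn_gt0 // ltcR.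
  rewrite ltr_pwDl //.
    by rewrite (E 0%N) // expr0 mul1r !subn0 bin0 mulr1n mulr_gt0 ?evtop_beta_gt0 ?tk.
  apply: sumr_ge0 => k _; rewrite E; last exact: ltn_ord.
  by rewrite mulrn_wge0 // mulr_ge0 ?(ltW (tk _)) // pb //=; exact: ltn_ord.
Qed.

End mixed_positivity.

(** * A multiple of beta plus a form of rank one *)

Section radial_hessian.
Variables (R : realType) (n : nat).
Local Notation L := (@evtop R n).
Local Notation io := (evscalar n).
Implicit Types (a b : 'I_n -> R[i]).

Definition rank1 a b : 'M[R[i]]_n := \matrix_(j, k) (a j * b k).

(** Exchanging the two conjugate indices changes the sign of the product of generators by [ev1M] and
    preserves the coefficients, so the square equals its opposite. *)
Lemma ev11_rank1_sqr a b : ev11 (rank1 a b) * ev11 (rank1 a b) = 0.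
Proof.
pose S j k := io (Complex 0 2 * (a j * b k)) * ev1 R j k.
have E : ev11 (rank1 a b) = \sum_j \sum_k S j k.
  by rewrite ev11E; apply: eq_bigr => j _; apply: eq_bigr => k _; rewrite mxE.
pose T j k j' k' : evform R n := io (Complex 0 2 * Complex 0 2 * (a j * b k * (a j' * b k'))).
have E2 : ev11 (rank1 a b) * ev11 (rank1 a b) =
    \sum_j \sum_k \sum_j' \sum_k' T j k j' k' * (ev1 R j k * ev1 R j' k').
  rewrite {1}E mulr_suml; apply: eq_bigr => j _; rewrite mulr_suml; apply: eq_bigr => k _.
  rewrite E mulr_sumr; apply: eq_bigr => j' _; rewrite mulr_sumr; apply: eq_bigr => k' _.
  by rewrite /S mulrACA -rmorphM /T /= mulrACA.
have E3 : ev11 (rank1 a b) * ev11 (rank1 a b) =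
    \sum_j \sum_j' \sum_k \sum_k' T j k j' k' * (ev1 R j k * ev1 R j' k').
  by rewrite E2; apply: eq_bigr => j _; rewrite exchange_big.
apply: evform_double0; rewrite {1}E3 E3 -sumrN; apply: eq_bigr => j _.
rewrite -sumrN; apply: eq_bigr => j' _; rewrite [LHS]exchange_big /= -sumrN; apply: eq_bigr => k _.
rewrite -sumrN; apply: eq_bigr => k' _.
rewrite ev1M mulrN. congr (- _); congr (_ * _).
rewrite /T; congr (io (_ * _)).
by rewrite /= mulrACA [b k' * b k]mulrC mulrACA.
Qed.

(** Sylvester's identity det(1 + uv) = det(1 + vu), read off two triangularizations of the same
    block matrix. *)
Lemma det_1_rank1 a b : \det (1%:M + rank1 a b) = 1 + \sum_j a j * b j.
Proof.
pose u : 'cV[R[i]]_n := \col_j a j; pose v : 'rV[R[i]]_n := \row_k b k.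
have E : rank1 a b = u *m v.
  by apply/matrixP => j k; rewrite !mxE big_ord1 !mxE.
pose P := block_mx 1%:M (- v) u 1%:M.
have P1 : block_mx 1%:M 0 (- u) 1%:M *m P = block_mx 1%:M (- v) 0 (1%:M + u *m v).
  rewrite mulmx_block !mul1mx !mul0mx !addr0 mulmx1 addNr; congr block_mx.
  by rewrite mulmxN mulNmx opprK addrC.
have P2 : block_mx 1%:M v 0 1%:M *m P = block_mx (1%:M + v *m u) 0 u 1%:M.
  by rewrite mulmx_block !mul1mx !mul0mx !add0r mulmx1 addNr.
have D1 : \det P = \det (1%:M + u *m v).
  by have := congr1 determinant P1; rewrite det_mulmx det_lblock det_ublock !det1 !mul1r.
have D2 : \det P = \det (1%:M + v *m u).
  by have := congr1 determinant P2; rewrite det_mulmx det_lblock det_ublock !det1 !mul1r mulr1.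
rewrite E -D1 D2 det_mx11 !mxE /= mulr1n; congr (_ + _).
by apply: eq_bigr => j _; rewrite !mxE mulrC.
Qed.

(** Two evaluations of L((beta + g)^n) are compared: by the determinant, and by the binomial formula
    with g^2 = 0. *)
Lemma evtop_rank1 a b :
  L (ev11 (rank1 a b) * ebeta R n ^+ n.-1) *+ n = L (ebeta R n ^+ n) * \sum_j a j * b j.
Proof.
have := evtop_ev11X (1%:M + rank1 a b).
rewrite det_1_rank1 ev11D.
have -> : (ev11 1%:M + ev11 (rank1 a b)) ^+ n =
    ebeta R n ^+ n + (ebeta R n ^+ n.-1 * ev11 (rank1 a b)) *+ n.
  by case: (n) (ev11 _) (ev11_rank1_sqr a b) => [|k] w w2; rewrite ?addr0 // sqzero_addX.
rewrite raddfD raddfMn /= mulrDr mulr1.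
have -> : L (ebeta R n ^+ n) = (n`! * 4 ^ n)%:R by rewrite evtop_ev11X det1 mulr1.
by move/addrI; rewrite mulrC.
Qed.

(** Since g^2 = 0, the k-th power has only two terms, and n times its top coefficient is c1^(k-1)
    L(beta^n) (n c1 + k c2 S). As c2 <= 0, the worst case is k = m, which is the last hypothesis. *)
Lemma radial_power_ge0 (z : 'I_n -> R[i]) (c1 c2 S : R) m k : (1 <= k <= m)%N -> (m <= n)%N ->
  0 <= c1 -> c2 <= 0 -> \sum_j (z j)^*%C * z j = S%:C%C -> 0 <= S ->
  0 <= n%:R * c1 + m%:R * (c2 * S) ->
  0 <= L (ev11 (c1%:C%C *: 1%:M + c2%:C%C *: rank1 (fun j => (z j)^*%C) z) ^+ k *
          ebeta R n ^+ (n - k)).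
Proof.
move=> /andP[k0 km] mn c10 c20 zS S0 h; have n0 : (0 < n)%N by apply: leq_trans mn; exact: leq_trans km.
case: k k0 km => // k _ km; set G := rank1 _ _.
rewrite ev11D !ev11Z -[ev11 1%:M]/(ebeta R n) sqzero_addX; last first.
  by rewrite mulrACA ev11_rank1_sqr mulr0.
rewrite mulrDl raddfD mulrnAl raddfMn /= !exprMn.
have eX j : (io c1%:C%C) ^+ j = io (c1%:C%C ^+ j) by rewrite rmorphXn.
rewrite !eX.
have LG := evtop_rank1 (fun j => (z j)^*%C) z; rewrite -/G zS in LG.
have E1 : L (io (c1%:C%C ^+ k.+1) * ebeta R n ^+ k.+1 * ebeta R n ^+ (n - k.+1)) =
    c1%:C%C ^+ k.+1 * L (ebeta R n ^+ n).
  by rewrite -mulrA -exprD subnKC ?(leq_trans km) // evtop_scalar_mul.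
have E2 : L (io (c1%:C%C ^+ k) * ebeta R n ^+ k * (io c2%:C%C * ev11 G) * ebeta R n ^+ (n - k.+1)) =
    c1%:C%C ^+ k * c2%:C%C * L (ev11 G * ebeta R n ^+ n.-1).
  rewrite [X in X * ebeta R n ^+ _]mulrACA -rmorphM -!mulrA evtop_scalar_mul -!mulrA.
  congr (_ * (_ * L _)); rewrite mulrCA -exprD; congr (_ * _ ^+ _).
  by lia.
rewrite E1 E2; have n0' : (0 : R[i]) < n%:R by rewrite ltr0n.
rewrite -(pmulr_rge0 _ n0') mulrDr.
have -> : n%:R * (c1%:C%C ^+ k * c2%:C%C * L (ev11 G * ebeta R n ^+ n.-1) *+ k.+1) =
    c1%:C%C ^+ k * L (ebeta R n ^+ n) * (k.+1%:R * (c2%:C%C * S%:C%C)).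
  rewrite mulrnAr mulrCA [n%:R * _]mulr_natl LG mulr_natl mulrnAr; congr (_ *+ _).
  exact: mulrACA.
rewrite exprS; set p := _ ^+ k; set E := L (ebeta R n ^+ n).
have -> : n%:R * (c1%:C%C * p * E) = p * E * (n%:R * c1%:C%C).
  by rewrite -[c1%:C%C * p * E]mulrA mulrA mulrC.
rewrite -mulrDr mulr_ge0 //.
  by rewrite mulr_ge0 ?exprn_ge0 ?ler0c // ltW // evtop_beta_gt0.
rewrite -!(rmorph_nat (real_complex R)) -!rmorphM -rmorphD ler0c.
apply: le_trans h _; rewrite lerD2l ler_wnM2r ?ler_nat //.
by rewrite mulr_le0_ge0.
Qed.

(** The radial form satisfies the power inequalities by [radial_power_ge0], and completes the m - 1
    given forms to the m factors of [mixed_positivity]. *)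
Lemma radial_mixed_positivity (z : 'I_n -> R[i]) (c1 c2 S : R) m (a : 'I_(m - 1) -> cform R n) :
  (1 <= m)%N -> (m <= n)%N -> (forall j, m_positive m (a j)) ->
  0 <= c1 -> c2 <= 0 -> \sum_j (z j)^*%C * z j = S%:C%C -> 0 <= S ->
  0 <= n%:R * c1 + m%:R * (c2 * S) ->
  top_ge0 (wedge (form11 (c1%:C%C *: 1%:M + c2%:C%C *: rank1 (fun j => (z j)^*%C) z))
    (wedge (\big[@wedge R n/form1 R n]_(j < m - 1) a j) (wedgeX (beta R n) (n - m)))).
Proof.
move=> m1 mn ma c10 c20 zS S0 h; set M := (_ + _).
have /choice[A HA] : forall j, exists A : 'M[R[i]]_n, herm_mx A /\ a j = form11 A.
  by move=> j; have [[A hA ->] _] := ma j; exists A.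
pose bs := ev11 M :: [seq ev11 (A j) | j <- enum 'I_(m - 1)].
have be : evval (ebeta R n) = beta R n by rewrite betaE.
suff : 0 <= L ((\prod_(b <- bs) b) * ebeta R n ^+ (n - m)).
  rewrite /bs big_cons big_map big_enum /= -mulrA /evtop /top_ge0 !evval_mul evval_exp be evval_prod.
  by under eq_bigr => j _ do rewrite /= -(HA j).2.
apply: mixed_positivity => //; first by rewrite /= size_map size_enum_ord subn1 prednK.
move=> b /= [<-|]; first split.
- exists M => //; apply: herm_mxD; apply: herm_mxZ; first exact: herm_mx1.
  move=> j k; rewrite !mxE; have cM (x y : R[i]) : ((x * y)^*)%C = (x^*)%C * (y^*)%C by rewrite -rmorphM.
  by rewrite cM (conjcK (z j)) mulrC.
- by move=> k km; exact: (@radial_power_ge0 z c1 c2 S m k).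
- move=> /List.in_map_iff[j [<- _]]; split; first by exists (A j) => //; case: (HA j).
  move=> k km; have [_ /(_ k km)] := ma j; rewrite (HA j).2 /top_ge0 /evtop evval_mul.
  by rewrite !evval_exp be.
Qed.

End radial_hessian.

(** * Lebesgue measure and integration by parts *)

Section measurable_open.
Variables (R : realType) (N : nat).
Local Notation E := 'rV[R]_N.

Let box (p : 'rV[rat]_N * nat) : set E :=
  [set y | forall i, `|y 0 i - ratr (p.1 0 i)| < p.2.+1%:R^-1].

Let measurable_box p : measurable (box p).
Proof.
have -> : box p = \bigcap_(i in [set: 'I_N]) [set y : E | `|y 0 i - ratr (p.1 0 i)| < p.2.+1%:R^-1].
  by apply/seteqP; split=> y H i; [move=> _|]; exact: H.
apply: fin_bigcap_measurable => [|i _]; first exact: finite_finset.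
have -> : [set y : E | `|y 0 i - ratr (p.1 0 i)| < p.2.+1%:R^-1] =
    (fun y : E => y 0 i) @^-1` (ball (ratr (p.1 0 i) : R) (p.2.+1%:R^-1)).
  by apply/seteqP; split=> y /=; rewrite /ball /= distrC.
rewrite -[X in measurable X]setTI; apply: measurable_coor => //.
exact: measurable_ball.
Qed.

(** The sigma-algebra is generated by the coordinates, so an open set is written as a countable
    union of boxes with rational centers and radii 1/(k + 1). *)
Lemma measurable_open_rV (U : set E) : open U -> measurable U.
Proof.
move=> oU.
have -> : U = \bigcup_(p in [set p | box p `<=` U]) box p.
  apply/seteqP; split=> [x Ux|x [p pU bx]]; last exact: pU.
  have /nbhs_ballP[e /= e0 xeU] : nbhs x U by exact: open_nbhs_nbhs.
  have [k k0 ke] : exists2 k : nat, 0 < k.+1%:R^-1 :> R & k.+1%:R^-1 < e / 2.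
    have e20 : 0 < e / 2 by rewrite divr_gt0.
    exists (Num.truncn (e / 2)^-1); first by rewrite invr_gt0.
    rewrite -[ltRHS]invrK ltf_pV2 ?posrE ?invr_gt0 //.
    have e2 : 0 <= (e / 2)^-1 by rewrite invr_ge0 ltW.
    by have /andP[] := truncn_itv e2.
  have /choice[c Hc] : forall i, exists c : rat, `|x 0 i - ratr c| < k.+1%:R^-1.
    move=> i; have [|c] := @rat_in_itvoo R (x 0 i - k.+1%:R^-1) (x 0 i + k.+1%:R^-1).
      by rewrite ltrD2l gtrN.
    rewrite in_itv /= => /andP[c1 c2]; exists c.
    by rewrite ltr_distlC c1 c2.
  exists (\row_i c i, k); last by move=> i; rewrite mxE; exact: Hc.
  move=> y /= yb; apply: xeU; split=> // i j; rewrite /ball /= (ord1 i).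
  rewrite -(subrK (ratr (c j)) (x 0 j)) -addrA (le_lt_trans (ler_normD _ _)) //.
  rewrite [e]splitr ltrD ?(lt_trans (Hc j)) // distrC.
  by have := yb j; rewrite /= mxE => /lt_trans; apply.
rewrite bigcup_mkcond; apply: countable_bigcupT_measurable => [|p]; first exact: countableP.
by case: ifP => _ //; exact: measurable_box.
Qed.

Lemma continuous_measurable_rV (f : E -> R) : continuous f -> measurable_fun setT f.
Proof.
move=> cf; apply: (measurability _ (RGenOInfty.measurableE R)) => //.
move=> _ [_ [r ->] <-]; rewrite setTI; apply: measurable_open_rV.
by apply: open_comp; [move=> x _; exact: cf|exact: interval_open].
Qed.

Lemma measurable_compact_rV (K : set E) : compact K -> measurable K.
Proof.
move=> cK; rewrite -(setCK K); apply: measurableC; apply: measurable_open_rV.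
by apply: closed_openC; apply: compact_closed => //; exact: norm_hausdorff.
Qed.

End measurable_open.

Lemma consV0 (R : realType) N (t : R) (y : 'rV[R]_N) : consV (t, y) 0 ord0 = t.
Proof.
transitivity ((row_mx (t%:M : 'rV[R]_1) y) 0 (lshift N 0)).
  by congr (fun_of_matrix _ _ _); exact/val_inj.
by rewrite row_mxEl mxE eqxx mulr1n.
Qed.

Lemma consVS (R : realType) N (t : R) (y : 'rV[R]_N) j : consV (t, y) 0 (lift ord0 j) = y 0 j.
Proof.
rewrite (_ : lift _ _ = rshift 1 j); last exact/val_inj.
exact: (row_mxEr (t%:M : 'rV[R]_1) y).
Qed.

Section leb_fubini.
Variables (R : realType) (N : nat).
Implicit Types (f : 'rV[R]_N.+1 -> \bar R) (A : set 'rV[R]_N.+1).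
Local Notation leb1 := (@lebesgue_measure R).
Local Notation mu := (leb1 \x leb R N)%E.

Lemma leb_succE A : leb R N.+1 A = mu (@consV R N @^-1` A).
Proof. by []. Qed.

Lemma leb_ge0_fubini f : measurable_fun setT f -> (forall x, 0 <= f x)%E ->
  (\int[leb R N.+1]_x f x = \int[leb1]_t \int[leb R N]_y f (consV (t, y)))%E.
Proof.
move=> mf f0.
transitivity (\int[pushforward mu (@consV R N)]_x f x)%E.
  reflexivity.
rewrite ge0_integral_pushforward //=; last exact: measurable_consV.
rewrite preimage_setT (@fubini_tonelli1 _ _ _ _ _ leb1 (leb R N) (f \o @consV R N)) //.
  by apply: measurableT_comp => //; exact: measurable_consV.
by move=> x; exact: f0.
Qed.

Lemma leb_integrable_consV f : (leb R N.+1).-integrable setT f ->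
  mu.-integrable setT (f \o @consV R N).
Proof.
move=> /integrableP[mf fi]; apply/integrableP; split.
  by apply: measurableT_comp => //; exact: measurable_consV.
have -> : (\int[mu]_x `|(f \o @consV R N) x| = \int[leb R N.+1]_x `|f x|)%E; last by [].
rewrite leb_ge0_fubini //; last exact: measurableT_comp.
rewrite (@fubini_tonelli1 _ _ _ _ _ leb1 (leb R N) (fun x => `|(f \o @consV R N) x|%E)) //.
by do 2 apply: measurableT_comp => //; exact: measurable_consV.
Qed.

Lemma leb_fubini f : (leb R N.+1).-integrable setT f ->
  (\int[leb R N.+1]_x f x = \int[leb1]_t \int[leb R N]_y f (consV (t, y)))%E.
Proof.
move=> fi; have fi' := leb_integrable_consV fi; have /integrableP[mf _] := fi.
transitivity (\int[pushforward mu (@consV R N)]_x f x)%E.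
  reflexivity.
rewrite integral_pushforward //=; last exact: measurable_consV.
by rewrite preimage_setT -integral12_prod_meas1.
Qed.

Lemma leb_fubiniC f : (leb R N.+1).-integrable setT f ->
  (\int[leb R N.+1]_x f x = \int[leb R N]_y \int[leb1]_t f (consV (t, y)))%E.
Proof.
move=> fi; rewrite leb_fubini //; exact: (Fubini (leb_integrable_consV fi)).
Qed.

End leb_fubini.

(** The closed ball of the sup norm. It has an explicit volume and splits as a product under
    [consV], and so serves as the standard compact set around a support. *)
Definition cube (R : realType) (N : nat) (M : R) : set 'rV[R]_N :=
  [set x | forall i, `|x 0 i| <= M].
Arguments cube {R} N M _.

Section cube.
Variable R : realType.
Implicit Types (N : nat) (M : R).

Lemma compact_cube N M : compact (cube N M).
Proof.
have := @rV_compact R N (fun=> `[- M, M]%classic) (fun=> @segment_compact R _ _).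
congr compact; apply/seteqP; split=> x /= H i; have := H i; by rewrite in_itv /= ler_norml.
Qed.

Lemma measurable_cube N M : measurable (cube N M).
Proof. apply: measurable_compact_rV; exact: compact_cube. Qed.

Lemma leb_cube N M : 0 <= M -> leb R N (cube N M) = ((2 * M) ^+ N)%:E.
Proof.
move=> M0; elim: N => [|N IH].
  rewrite expr0 /= [LHS]diracE mem_set //; by case.
rewrite leb_succE.
have -> : @consV R N @^-1` cube N.+1 M = `[- M, M]%classic `*` cube N M.
  apply/seteqP; split=> -[t y] /=.
    move=> H; split=> [|j] /=.
      by have := H ord0; rewrite consV0 in_itv /= ler_norml.
    by have := H (lift ord0 j); rewrite consVS.
  rewrite /= in_itv /= -ler_norml => -[tM yM] i.
  by case: (unliftP ord0 i) => [j|] ->; rewrite ?consV0 ?consVS //; exact: yM.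
rewrite product_measure1E //; last exact: measurable_cube.
rewrite [X in (_ * X)%E]IH [X in (X * _)%E]lebesgue_measure_itv /= lte_fin.
case: ltP => [|MM]; rewrite -?EFinM ?exprS; last first.
  have -> : M = 0 by lra.
  by rewrite !mulr0 !mul0r ?mul0e.
by rewrite opprK -mulr2n -[M *+ 2]mulr_natl.
Qed.

Lemma integrable_cube N M (f : 'rV[R]_N -> R) B : measurable_fun setT f ->
  (forall x, `|f x| <= B) -> (forall x, ~ cube N M x -> f x = 0) ->
  (leb R N).-integrable setT (EFin \o f).
Proof.
move=> mf fB f0.
have -> : EFin \o f = (EFin \o f) \_ (cube N M).
  apply/funext => x; rewrite patchE; case: ifPn => // /negP.
  by rewrite inE /= => /f0 ->.
apply: (proj1 (integrable_mkcond _ (@measurable_cube N M))).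
apply: measurable_bounded_integrable.
- exact: measurable_cube.
- have [M0|M0] := leP 0 M; first by rewrite [X in (X < _)%E](leb_cube N M0) ltry.
  apply: (@le_lt_trans _ _ (leb R N (cube N 0))); last by rewrite [X in (X < _)%E](leb_cube N (lexx _)) ltry.
  apply: le_measure; rewrite ?inE; [exact: measurable_cube|exact: measurable_cube|].
  by move=> x H i; apply: le_trans (H i) _; exact: ltW.
- exact: measurable_funS mf.
- exists B; split=> [|r Br x _]; first exact: num_real.
  exact: le_trans (fB x) (ltW Br).
Qed.

Lemma continuous_cube_bounded N M (f : 'rV[R]_N -> R) : continuous f ->
  (forall x, ~ cube N M x -> f x = 0) -> exists2 B, 0 <= B & forall x, `|f x| <= B.
Proof.
move=> cf f0.
have : compact (f @` cube N M).
  by apply: continuous_compact; [exact: continuous_subspaceT|exact: compact_cube].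
move=> /compact_bounded[B0 [_ HB]]; exists (`|B0| + 1); first by rewrite addr_ge0.
move=> x; have [xM|/f0 ->] := pselect (cube N M x); last by rewrite normr0 addr_ge0.
apply: HB; last by exists x.
by rewrite (le_lt_trans (ler_norm _)) // ltrDl.
Qed.

Lemma continuous_cube_integrable N M (f : 'rV[R]_N -> R) : continuous f ->
  (forall x, ~ cube N M x -> f x = 0) -> (leb R N).-integrable setT (EFin \o f).
Proof.
move=> cf f0; have [B B0 fB] := continuous_cube_bounded cf f0.
by apply: integrable_cube f0 => //; exact: continuous_measurable_rV.
Qed.

End cube.

(** * Integration by parts for compactly supported functions *)

Section derive_affine.
Variables (R : realType) (V W : normedModType R).
Implicit Types (phi : W -> R) (c : V -> W).

(** The two difference quotients are the same function of h, so derivability in one direction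
    transfers as it stands. *)
Lemma derivable_affine phi c x v w : (forall h, c (h *: v + x) = h *: w + c x) ->
  derivable phi (c x) w -> derivable (phi \o c) x v.
Proof.
move=> E; rewrite /derivable.
by under [X in _ -> cvg (X @ _)]eq_fun => h do rewrite /= E.
Qed.

Lemma derive_affine phi c x v w : (forall h, c (h *: v + x) = h *: w + c x) ->
  'D_v (phi \o c) x = 'D_w phi (c x).
Proof.
move=> E; rewrite /derive.
by under [X in lim (X @ _) = _]eq_fun => h do rewrite /= E.
Qed.

End derive_affine.

Section integral_derive.
Variable R : realType.

Lemma integral_derive1_0 (g : R -> R) M : (forall t, derivable g t 1) ->
  continuous ('D_1 g) -> (forall t, M < `|t| -> g t = 0) ->
  (\int[@lebesgue_measure R]_t ('D_1 g t)%:E = 0)%E.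
Proof.
move=> dg cg g0; pose B := `|M| + 1.
have MB : M < B by rewrite (le_lt_trans (ler_norm _)) // ltrDl.
have B0 : 0 < B by rewrite ltr_wpDl.
have dg0 t : M < `|t| -> 'D_1 g t = 0.
  move=> Mt; rewrite -(derive_cst (0 : R) t 1); apply: near_eq_derive.
  near=> s; apply: g0; near: s.
  exact: (cvgr_gt `|t| (@norm_continuous _ R t) _ Mt).
transitivity (\int[@lebesgue_measure R]_(t in `[(- B)%R, B%R]) ('D_1 g t)%:E)%E.
  rewrite [RHS]integral_mkcond; apply: eq_integral => t _; rewrite patchE.
  case: ifPn => // /negP; rewrite inE /= in_itv /= -ler_norml => /negP.
  by rewrite -ltNge => /(lt_trans MB) /dg0 ->.
rewrite (@continuous_FTC2 _ _ g) //.
- by rewrite !g0 ?subee // ?normrN gtr0_norm.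
- by rewrite gtrN.
- exact: continuous_subspaceT.
- split=> [t _||]; first exact: dg.
  + by apply: cvg_at_right_filter; apply: differentiable_continuous; apply/derivable1_diffP.
  + by apply: cvg_at_left_filter; apply: differentiable_continuous; apply/derivable1_diffP.
- by move=> t _; rewrite derive1E.
Unshelve. all: by end_near. Qed.

Lemma continuous_consVl N (y : 'rV[R]_N) : continuous (fun t : R => consV (t, y)).
Proof.
move=> t A /nbhs_ballP[e /= e0 eA]; apply/nbhs_ballP; exists e => // t' tt'.
apply: eA; split=> // i j; rewrite (ord1 i).
by case: (unliftP ord0 j) => [k|] ->; rewrite ?consV0 ?consVS //; exact: ballxx.
Qed.

Lemma continuous_consVr N (t : R) : continuous (fun y : 'rV[R]_N => consV (t, y)).
Proof.
move=> y A /nbhs_ballP[e /= e0 eA]; apply/nbhs_ballP; exists e => // y' [_ yy'].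
apply: eA; split=> // i j; rewrite (ord1 i).
by case: (unliftP ord0 j) => [k|] ->; rewrite ?consV0 ?consVS //; exact: ballxx.
Qed.

Lemma consV_shiftl N (t h : R) (y : 'rV[R]_N) :
  consV (h *: 1 + t, y) = h *: delta_mx 0 ord0 + consV (t, y).
Proof.
apply/rowP => j; rewrite [RHS]mxE [(_ *: delta_mx _ _) 0 j]mxE [delta_mx _ _ _ _]mxE.
case: (unliftP ord0 j) => [k|] ->; rewrite ?consV0 ?consVS /=; first by rewrite mulr0 add0r.
by rewrite /GRing.scale /= !mulr1.
Qed.

Lemma consV_shiftr N (t h : R) (y : 'rV[R]_N) i :
  consV (t, h *: delta_mx 0 i + y) = h *: delta_mx 0 (lift ord0 i) + consV (t, y).
Proof.
apply/rowP => j; rewrite [RHS]mxE [(_ *: delta_mx _ _) 0 j]mxE [delta_mx _ _ _ _]mxE.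
case: (unliftP ord0 j) => [k|] ->; rewrite ?consV0 ?consVS /=; last by rewrite mulr0 add0r.
by rewrite !mxE (inj_eq lift_inj).
Qed.

Lemma derive_out_cube N M (phi : 'rV[R]_N -> R) v : (forall x, ~ cube N M x -> phi x = 0) ->
  forall x, ~ cube N M x -> 'D_v phi x = 0.
Proof.
move=> p0 x xM.
rewrite -(derive_cst (0 : R) x v); apply: near_eq_derive.
have : nbhs x (~` cube N M).
  apply: open_nbhs_nbhs; split=> //; apply: closed_openC; apply: compact_closed.
    exact: norm_hausdorff.
  exact: compact_cube.
by apply: filterS => y; exact: p0.
Qed.

(** Induction on the dimension. If i is not the first coordinate, the inner integral over the others
    vanishes by induction; if it is, Fubini in the other order makes the inner integral that of a
    derivative on the line. *)
Lemma integral_derive_0 N (i : 'I_N) M (phi : 'rV[R]_N -> R) :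
  (forall x, derivable phi x (delta_mx 0 i)) -> continuous ('D_(delta_mx 0 i) phi) ->
  (forall x, ~ cube N M x -> phi x = 0) ->
  (\int[leb R N]_x ('D_(delta_mx 0 i) phi x)%:E = 0)%E.
Proof.
elim: N i phi => [[]//|N IH] i phi dphi cphi phi0.
have int : (leb R N.+1).-integrable setT (EFin \o 'D_(delta_mx 0 i) phi).
  by apply: continuous_cube_integrable (derive_out_cube _ phi0).
case: (unliftP ord0 i) => [j|] ij; subst i.
  rewrite (leb_fubini int) /=; apply: integral0_eq => t _.
  have sh y h : consV (t, h *: delta_mx 0 j + y) = h *: delta_mx 0 (lift ord0 j) + consV (t, y).
    exact: consV_shiftr.
  under eq_integral => y _ do rewrite -(derive_affine phi (sh y)).
  apply: IH => [y||y yM].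
  - exact: derivable_affine (sh y) _.
  - rewrite (_ : 'D__ _ = 'D_(delta_mx 0 (lift ord0 j)) phi \o (fun y => consV (t, y))); last first.
      by apply/funext => y; exact: derive_affine (sh y).
    by move=> y; apply: continuous_comp; [exact: continuous_consVr|exact: cphi].
  - by apply: phi0 => H; apply: yM => k; have := H (lift ord0 k); rewrite consVS.
rewrite (leb_fubiniC int) /=; apply: integral0_eq => y _.
have sh t h : consV (h *: 1 + t, y) = h *: delta_mx 0 ord0 + consV (t, y) by exact: consV_shiftl.
under eq_integral => t _ do rewrite -(@derive_affine R R _ phi (fun t => consV (t, y)) _ _ _ (sh t)).
apply: (@integral_derive1_0 _ M) => [t||t Mt].
- exact: (@derivable_affine R R _ phi (fun t => consV (t, y)) _ _ _ (sh t)).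
- rewrite (_ : 'D__ _ = 'D_(delta_mx 0 ord0) phi \o (fun t => consV (t, y))); last first.
    by apply/funext => t; exact: (@derive_affine R R _ phi (fun t => consV (t, y)) _ _ _ (sh t)).
  by move=> t; apply: continuous_comp; [exact: continuous_consVl|exact: cphi].
- by apply: phi0 => H; have := H ord0; rewrite consV0 leNgt Mt.
Qed.

End integral_derive.

(** * The regularized functions *)

Section chain_rule.
Variables (R : realType) (V : normedModType R).
Implicit Types (phi : V -> R) (x v : V).

Let line x v : R -> V := fun t => t *: v + x.

Let line_shift x v h : line x v (h *: 1 + 0) = h *: v + line x v 0.
Proof. by rewrite /line scale0r add0r addr0 /GRing.scale /= mulr1. Qed.

Lemma is_derive_lineP phi x v d :
  is_derive (0 : R) (1 : R) (phi \o line x v) d <-> is_derive x v phi d.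
Proof.
have x0 : line x v 0 = x by rewrite /line scale0r add0r.
have E := @derive_affine R R V phi (line x v) 0 1 v (line_shift x v).
have D : derivable (phi \o line x v) (0 : R) (1 : R) = derivable phi x v.
  rewrite /derivable.
  by under [X in cvg (X @ _) = _]eq_fun => h do rewrite /= line_shift x0.
rewrite x0 in E.
by split=> -[d1 d2]; split; [rewrite -D|rewrite -E|rewrite D|rewrite E].
Qed.

Lemma is_derive_chain phi (h : R -> R) x v a b : is_derive x v phi a ->
  is_derive (phi x) 1 h b -> is_derive x v (h \o phi) (b * a).
Proof.
move=> /is_derive_lineP pa hb; apply/is_derive_lineP.
have x0 : (phi \o line x v) 0 = phi x by rewrite /= /line scale0r add0r.
rewrite -x0 in hb.
exact: (@is_derive1_comp _ h (phi \o line x v) 0 _ _ hb pa).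
Qed.

End chain_rule.

Lemma continuous_sum (R : realType) (V : topologicalType) (I : Type) (r : seq I) (f : I -> V -> R) :
  (forall i, continuous (f i)) -> continuous (fun x => \sum_(i <- r) f i x).
Proof.
move=> cf; elim: r => [|i r IH].
  by under eq_fun do rewrite big_nil; move=> x; exact: cst_continuous.
under eq_fun do rewrite big_cons.
by move=> x; apply: continuousD; [exact: cf|exact: IH].
Qed.

Section cnorm2_facts.
Variables (R : realType) (n : nat).
Local Notation E := 'rV[R]_(n + n).
Local Notation q := (@cnorm2 R n).
Implicit Types (x v : E) (i j : 'I_(n + n)).

Lemma continuous_coor N (i : 'I_N) : continuous (fun x : 'rV[R]_N => x 0 i).
Proof. exact: coord_continuous. Qed.

Lemma continuous_cnorm2 : continuous q.
Proof.
apply: (@continuous_sum _ _ _ _ (fun i (x : E) => x 0 i ^+ 2)) => i x.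
by apply: (@continuousM _ _ (fun x : E => x 0 i) (fun x : E => x 0 i)); exact: continuous_coor.
Qed.

Lemma cnorm2_ge0 x : 0 <= q x.
Proof. by apply: sumr_ge0 => i _; exact: sqr_ge0. Qed.

Lemma cnorm2_eq0 x : (q x == 0) = (x == 0).
Proof.
apply/eqP/eqP => [/eqP|->]; last by rewrite /cnorm2 big1 // => i _; rewrite mxE expr0n.
rewrite psumr_eq0 => [|i _]; last exact: sqr_ge0.
move=> /allP H; apply/rowP => i; rewrite mxE; have := H i (mem_index_enum _).
by rewrite /= sqrf_eq0 => /eqP.
Qed.

Lemma sqr_coor_le x i : x 0 i ^+ 2 <= q x.
Proof.
by rewrite /cnorm2 (bigD1 i) //= lerDl; apply: sumr_ge0 => j _; exact: sqr_ge0.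
Qed.

Lemma is_derive_cnorm2 i x : is_derive x (delta_mx 0 i) q (2 * x 0 i).
Proof.
split.
  have -> : q = \sum_(j < n + n) (fun z : E => z 0 j) ^+ 2.
    by apply/funext => z; rewrite fct_sumE; apply: eq_bigr.
  by apply: derivable_sum => j; apply: derivableX; have [] := is_derive_coor j x (delta_mx 0 i).
have /(congr1 (fun F => F x)) /= -> := @derive_cnorm2 R n (delta_mx 0 i).
rewrite (bigD1 i) //= big1 ?addr0 => [|j ji]; last first.
  by rewrite mxE (negbTE ji) andbF mulr0 mul0r.
by rewrite mxE !eqxx mulr1.
Qed.

Variable e : R.
Hypothesis e0 : 0 < e.

Lemma cnorm2D_gt0 x : 0 < q x + e.
Proof. by rewrite ltr_wpDl // cnorm2_ge0. Qed.

Definition qpow (a : R) x : R := (q x + e) `^ a.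

Lemma qpow_gt0 a x : 0 < qpow a x.
Proof. by rewrite powR_gt0 // cnorm2D_gt0. Qed.

Lemma is_derive_qpow a i x :
  is_derive x (delta_mx 0 i) (qpow a) (2 * a * x 0 i * qpow (a - 1) x).
Proof.
have H : is_derive (q x + e) 1 (fun t : R => t `^ a) (a * (q x + e) `^ (a - 1)).
  by apply: is_derive1_powR; exact: cnorm2D_gt0.
have Hq : is_derive x (delta_mx 0 i) (fun x => q x + e) (2 * x 0 i).
  have -> : 2 * x 0 i = 2 * x 0 i + 0 by rewrite addr0.
  by apply: is_deriveD; exact: is_derive_cnorm2.
have := is_derive_chain Hq H.
by congr is_derive; rewrite /qpow; ring.
Qed.

Lemma continuous_qpow a : continuous (qpow a).
Proof.
move=> x; apply: (@continuous_comp _ _ _ (fun x => q x + e) (fun t : R => t `^ a)).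
  by apply: continuousD; [exact: continuous_cnorm2|exact: cst_continuous].
apply: differentiable_continuous; apply/derivable1_diffP.
by have [] : is_derive (q x + e) 1 (fun t : R => t `^ a) (a * (q x + e) `^ (a - 1)) by
   apply: is_derive1_powR; exact: cnorm2D_gt0.
Qed.

Variable s : R.

Definition ureg x : R := - qpow (- s) x.

Definition ureg1 i x : R := 2 * s * x 0 i * qpow (- s - 1) x.

Definition ureg2 i j x : R :=
  2 * s * (i == j)%:R * qpow (- s - 1) x - 4 * s * (s + 1) * x 0 i * x 0 j * qpow (- s - 2) x.

Lemma is_derive_ureg i x : is_derive x (delta_mx 0 i) ureg (ureg1 i x).
Proof.
have := is_deriveN (is_derive_qpow (- s) i x); congr is_derive.
by rewrite /ureg1; ring.
Qed.

Lemma is_derive_ureg1 i j x : is_derive x (delta_mx 0 j) (ureg1 i) (ureg2 i j x).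
Proof.
have Hc : is_derive x (delta_mx 0 j) (fun x : E => x 0 i) ((i == j)%:R).
  have := is_derive_coor i x (delta_mx 0 j); congr is_derive.
  by rewrite mxE.
have := is_deriveZ (2 * s) (is_deriveM Hc (is_derive_qpow (- s - 1) j x)).
rewrite (_ : _ \*: _ = ureg1 i); last by apply/funext => y; rewrite /ureg1 -mulrA.
congr is_derive; rewrite /ureg2 /GRing.scale /=.
have -> : - s - 1 - 1 = - s - 2 by ring.
by ring.
Qed.

End cnorm2_facts.

Section ibp.
Variables (R : realType) (N : nat).
Local Notation E := 'rV[R]_N.
Implicit Types (f g : E -> R) (i : 'I_N).

Lemma ibp i M f f1 g g1 :
  (forall x, is_derive x (delta_mx 0 i) f (f1 x)) -> (forall x, is_derive x (delta_mx 0 i) g (g1 x)) ->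
  continuous f -> continuous f1 -> continuous g -> continuous g1 ->
  (forall x, ~ cube N M x -> f x = 0) ->
  (\int[leb R N]_x (g x * f1 x)%:E = - \int[leb R N]_x (g1 x * f x)%:E)%E.
Proof.
move=> df dg cf cf1 cg cg1 f0.
have f10 x : ~ cube N M x -> f1 x = 0.
  by move=> xM; have [_ <-] := df x; exact: derive_out_cube f0 _ xM.
have dgf x : is_derive x (delta_mx 0 i) (g * f) (g x * f1 x + f x * g1 x).
  exact: is_deriveM.
have DE : 'D_(delta_mx 0 i) (g * f) = (fun x => g x * f1 x + f x * g1 x).
  by apply/funext => x; have [] := dgf x.
have cgf1 : continuous (fun x => g x * f1 x).
  by move=> x; apply: (@continuousM _ _ g f1); [exact: cg|exact: cf1].
have cfg1 : continuous (fun x => g1 x * f x).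
  by move=> x; apply: (@continuousM _ _ g1 f); [exact: cg1|exact: cf].
have i1 : (leb R N).-integrable setT (EFin \o (fun x => g x * f1 x)).
  by apply: continuous_cube_integrable cgf1 _ => x /f10 ->; rewrite mulr0.
have i2 : (leb R N).-integrable setT (EFin \o (fun x => g1 x * f x)).
  by apply: continuous_cube_integrable cfg1 _ => x /f0 ->; rewrite mulr0.
have := @integral_derive_0 R N i M (g * f).
rewrite DE => /(_ _ _ _)/wrap[x||x xM|].
- by have [] := dgf x.
- move=> x; apply: (@continuousD _ _ _ (fun x => g x * f1 x) (fun x => f x * g1 x)).
    exact: cgf1.
  by apply: (@continuousM _ _ f g1); [exact: cf|exact: cg1].
- by rewrite /= [LHS]/GRing.mul /= f0 // mulr0.
have DEx x : 'D_(delta_mx 0 i) (g * f) x = g x * f1 x + f x * g1 x by have [] := dgf x.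
under eq_integral => x _ do rewrite DEx [f x * _]mulrC EFinD.
rewrite (integralD measurableT i1 i2).
rewrite -(fineK (integrable_fin_num measurableT i1)) -(fineK (integrable_fin_num measurableT i2)).
by rewrite -EFinD -EFinN => -[/eqP]; rewrite addr_eq0 => /eqP ->.
Qed.

End ibp.

Section ureg_ddc.
Variables (R : realType) (n : nat).
Local Notation N := (n + n).
Local Notation E := 'rV[R]_N.

Lemma compact_sub_cube (K : set E) : compact K -> exists2 M, 0 <= M & K `<=` cube N M.
Proof.
move=> /compact_bounded[B0 [_ HB]]; exists (`|B0| + 1); first by rewrite addr_ge0.
move=> x Kx i; apply: le_trans (_ : `|x| <= _); last apply: HB => //.
  by rewrite [leRHS]/Num.Def.normr /= mx_normrE; apply/bigmax_geP; right => /=; exists (0, i).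
by rewrite (le_lt_trans (ler_norm _)) // ltrDl.
Qed.

Variable e : R.
Hypothesis e0 : 0 < e.
Variable s : R.

Lemma continuous_ureg : continuous (@ureg R n e s).
Proof. by move=> x; apply: continuousN; exact: continuous_qpow. Qed.

Lemma continuous_ureg1 i : continuous (@ureg1 R n e s i).
Proof.
move=> x; apply: (@continuousM _ _ (fun x : E => 2 * s * x 0 i) (@qpow R n e (- s - 1))); last exact: continuous_qpow.
by apply: (@continuousM _ _ (cst (2 * s)) (fun x : E => x 0 i)); [exact: cst_continuous|exact: continuous_coor].
Qed.

Lemma continuous_ureg2 i j : continuous (@ureg2 R n e s i j).
Proof.
move=> x; apply: (@continuousB _ _ _ (fun x : E => 2 * s * (i == j)%:R * qpow e (- s - 1) x)
   (fun x : E => 4 * s * (s + 1) * x 0 i * x 0 j * qpow e (- s - 2) x)).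
  apply: (@continuousM _ _ (cst (2 * s * (i == j)%:R)) (@qpow R n e (- s - 1))); first exact: cst_continuous.
  exact: continuous_qpow.
apply: (@continuousM _ _ (fun x : E => 4 * s * (s + 1) * x 0 i * x 0 j) (@qpow R n e (- s - 2))); last exact: continuous_qpow.
apply: (@continuousM _ _ (fun x : E => 4 * s * (s + 1) * x 0 i) (fun x : E => x 0 j)); last exact: continuous_coor.
by apply: (@continuousM _ _ (cst (4 * s * (s + 1))) (fun x : E => x 0 i)); [exact: cst_continuous|exact: continuous_coor].
Qed.

Lemma Ck_derive (f : E -> R) v : (forall k, Ck k f) -> forall k, Ck k ('D_v f).
Proof. by move=> Cf k; have [_ /(_ v)[]] := Cf k.+1. Qed.

Lemma Ck_is_derive (f : E -> R) v x : (forall k, Ck k f) -> is_derive x v f ('D_v f x).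
Proof. by move=> Cf; have [_ /(_ v)[d _]] := Cf 1%N; split. Qed.

Lemma Ck_continuous (f : E -> R) : (forall k, Ck k f) -> continuous f.
Proof. by move=> Cf; have [] := Cf 0%N. Qed.

Lemma ureg_ibp2 (f : E -> R) M (p r : 'I_N) : (forall k, Ck k f) ->
  (forall x, ~ cube N M x -> f x = 0) ->
  (\int[leb R N]_x (ureg e s x * 'D_(delta_mx 0 p) ('D_(delta_mx 0 r) f) x)%:E =
   \int[leb R N]_x (ureg2 e s p r x * f x)%:E)%E.
Proof.
move=> Cf f0; have Cr := Ck_derive (delta_mx 0 r) Cf.
rewrite (@ibp R N p M _ _ _ _ (fun x => Ck_is_derive (delta_mx 0 p) x Cr)
  (fun x => is_derive_ureg e0 s p x)
  (Ck_continuous Cr) (Ck_continuous (Ck_derive _ Cr)) continuous_ureg (@continuous_ureg1 p)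
  (derive_out_cube _ f0)).
rewrite (@ibp R N r M _ _ _ _ (fun x => Ck_is_derive (delta_mx 0 r) x Cf)
  (fun x => is_derive_ureg1 e0 s p r x)
  (Ck_continuous Cf) (Ck_continuous Cr) (@continuous_ureg1 p) (@continuous_ureg2 p r) f0).
by rewrite oppeK.
Qed.

End ureg_ddc.

(** * Positivity of the regularized functions *)

Section hessian_functional.
Variables (R : realType) (n : nat).
Local Notation N := (n + n)%N.
Local Notation E := 'rV[R]_N.
Implicit Types (T : cform R n) (H : 'I_N -> 'I_N -> R).

Definition real_hessian_mx H : 'M[R[i]]_n := \matrix_(j, k)
  Complex ((H (lshift n j) (lshift n k) + H (rshift n j) (rshift n k)) / 4)
          ((H (lshift n j) (rshift n k) - H (rshift n j) (lshift n k)) / 4).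

Lemma complex_hessianE (f : E -> R) z : complex_hessian f z =
  real_hessian_mx (fun p r => 'D_(delta_mx 0 p) ('D_(delta_mx 0 r) f) z).
Proof. by apply/matrixP => j k; rewrite !mxE. Qed.

Lemma topcoef_form11 (A : 'M[R[i]]_n) T : topcoef (wedge (form11 A) T) =
  \sum_j \sum_k A j k * (Complex 0 2 * topcoef (wedge (wedge (dz R j) (dzb R k)) T)).
Proof.
have tS (I : Type) (r : seq I) (F : I -> cform R n) :
    topcoef (\sum_(i <- r) F i) = \sum_(i <- r) topcoef (F i).
  by rewrite /topcoef sum_ffunE mulr_suml.
rewrite /form11 wedge_suml tS; apply: eq_bigr => j _; rewrite wedge_suml tS; apply: eq_bigr => k _.
by rewrite wedge_scalel /topcoef !ffunE mulrA mulrA [A j k * _]mulrC.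
Qed.

(** The same real coefficients C serve for the test function and for [ureg]. This permits
    integrating by parts twice, entry by entry, without returning to forms. *)
Lemma hessian_functional T : exists C : 'I_N -> 'I_N -> R, forall H,
  complex.Re (topcoef (wedge (form11 (real_hessian_mx H)) T)) = \sum_p \sum_r C p r * H p r.
Proof.
pose c j k := Complex 0 2 * topcoef (wedge (wedge (dz R j) (dzb R k)) T).
exists (fun p r => match fintype.split p, fintype.split r with
  | inl j, inl k | inr j, inr k => complex.Re (c j k) / 4
  | inl j, inr k => - complex.Im (c j k) / 4
  | inr j, inl k => complex.Im (c j k) / 4
  end) => H.
have ReS (I : Type) (r : seq I) (F : I -> R[i]) :
    complex.Re (\sum_(i <- r) F i) = \sum_(i <- r) complex.Re (F i).
  by apply: (big_morph (@complex.Re R)) => // -[a b] [a' b'].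
rewrite topcoef_form11 ReS big_split_ord /= -big_split /=; apply: eq_bigr => j _.
rewrite ReS !big_split_ord /= -!big_split /=; apply: eq_bigr => k _.
have sl i : fintype.split (lshift n i) = inl i by exact: (unsplitK (inl i)).
have sr i : fintype.split (rshift n i) = inr i by exact: (unsplitK (inr i)).
rewrite !sl !sr mxE -/(c j k); case: (c j k) => a b /=.
by field.
Qed.

Lemma real_hessian_ureg e s (x : E) : real_hessian_mx (fun p r => ureg2 e s p r x) =
  (s * qpow e (- s - 1) x)%:C%C *: 1%:M + (- s * (s + 1) * qpow e (- s - 2) x)%:C%C *:
    rank1 (fun j => (Complex (x 0 (lshift n j)) (x 0 (rshift n j)))^*%C)
          (fun j => Complex (x 0 (lshift n j)) (x 0 (rshift n j))).
Proof.
apply/matrixP => j k; rewrite !mxE /ureg2.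
rewrite (inj_eq (@lshift_inj _ _)) (inj_eq (@rshift_inj _ _)) !eq_lrshift !eq_rlshift /=.
apply/eqP; rewrite eq_complex /=; case: (j == k) => /=; apply/andP; split; apply/eqP; by field.
Qed.

Lemma ureg_m_subharmonic m (a : 'I_(m - 1) -> cform R n) e s (x : E) C : (1 <= m)%N -> (m < n)%N ->
  (forall j, m_positive m (a j)) -> 0 < e -> 0 <= s -> s * m%:R <= 1 ->
  (forall H, complex.Re (topcoef (wedge (form11 (real_hessian_mx H))
     (wedge (\big[@wedge R n/form1 R n]_(j < m - 1) a j) (wedgeX (beta R n) (n - m))))) =
     \sum_p \sum_r C p r * H p r) ->
  0 <= \sum_p \sum_r C p r * ureg2 e s p r x.
Proof.
move=> m1 mn ma e0 s0 sm <-; rewrite real_hessian_ureg.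
set z := fun j => Complex (x 0 (lshift n j)) (x 0 (rshift n j)).
have : top_ge0 (wedge (form11 ((s * qpow e (- s - 1) x)%:C%C *: 1%:M +
    (- s * (s + 1) * qpow e (- s - 2) x)%:C%C *: rank1 (fun j => (z j)^*%C) z))
    (wedge (\big[@wedge R n/form1 R n]_(j < m - 1) a j) (wedgeX (beta R n) (n - m)))).
  apply: (@radial_mixed_positivity R n z _ _ (cnorm2 x)) => //.
  - exact: ltnW.
  - by rewrite mulr_ge0 // ltW // qpow_gt0.
  - by rewrite !mulNr oppr_le0 !mulr_ge0 ?addr_ge0 // ltW // qpow_gt0.
  - rewrite /cnorm2 big_split_ord /= -big_split /= rmorph_sum; apply: eq_bigr => j _.
    by apply/eqP; rewrite eq_complex /z /=; apply/andP; split; apply/eqP; ring.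
  - exact: cnorm2_ge0.
  - have q2 : qpow e (- s - 1) x = (cnorm2 x + e) * qpow e (- s - 2) x.
      have q0 := cnorm2D_gt0 e0 x.
      rewrite /qpow (_ : - s - 1 = 1 + (- s - 2)); last by ring.
      by rewrite powRD ?powRr1 ?(ltW q0) // (gt_eqF q0) implybT.
    rewrite q2; have := qpow_gt0 e0 (- s - 2) x; have := cnorm2_ge0 x.
    have nm : (m%:R : R) + 1 <= n%:R by rewrite natr1 ler_nat.
    move: (qpow _ _ _) (cnorm2 x) => Q q q0 Q0.
    (* The coefficient n - m - s m of q is nonnegative because n - m >= 1 >= s m. *)
    have -> : n%:R * (s * ((q + e) * Q)) + m%:R * (- s * (s + 1) * Q * q) =
        s * Q * (n%:R * e + (n%:R - m%:R - s * m%:R) * q) by ring.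
    rewrite !mulr_ge0 ?(ltW Q0) // addr_ge0 ?mulr_ge0 ?(ltW e0) //; lra.
by rewrite /top_ge0 lecE => /andP[].
Qed.

End hessian_functional.

(** * Local integrability of the singular function *)

Section one_dim_bound.
Variable R : realType.
Implicit Types (s e M t : R).

Let f s e t : R := (t ^+ 2 + e) `^ (- s).

Let pos e t : 0 < e -> 0 < t ^+ 2 + e.
Proof. by move=> e0; rewrite ltr_wpDl // sqr_ge0. Qed.

Let is_derive_f s e t : 0 < e ->
  is_derive t 1 (f s e) (- s * (2 * t) * (t ^+ 2 + e) `^ (- s - 1)).
Proof.
move=> e0; have Hp : is_derive (t ^+ 2 + e) 1 (fun x : R => x `^ (- s)) (- s * (t ^+ 2 + e) `^ (- s - 1)).
  by apply: is_derive1_powR; exact: pos.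
have Hq : is_derive t 1 (fun x : R => x ^+ 2 + e) (2 * t).
  have H2 : is_derive t 1 (fun x : R => x ^+ 2) (2 * t).
    have := is_deriveM (is_derive_id t (1 : R)) (is_derive_id t (1 : R)).
    by congr is_derive; rewrite /GRing.scale /=; ring.
  by rewrite -[2 * t]addr0; apply: is_deriveD.
have := is_derive_chain Hq Hp; congr is_derive.
by ring.
Qed.

Let continuous_f s e : 0 < e -> continuous (f s e).
Proof.
move=> e0 t; apply: differentiable_continuous; apply/derivable1_diffP.
by have [] := is_derive_f s t e0.
Qed.

(** The bound is uniform in e. The function t (t^2 + e)^(-s) has derivative at least (1 - 2 s) (t^2
    + e)^(-s), and its increment over [-M, M] is at most 2 M because M >= 1 gives (M^2 + e)^(-s) <=
    1. *)
Lemma integral_sqrD_powR s e M : 0 < e -> 0 <= s -> 2 * s < 1 -> 1 <= M ->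
  (\int[@lebesgue_measure R]_(t in `[(- M)%R, M]) ((t ^+ 2 + e) `^ (- s))%:E <= (2 * M / (1 - 2 * s))%:E)%E.
Proof.
move=> e0 s0 s1 M1; have M0 : 0 < M by apply: lt_le_trans M1.
have s2 : 0 < 1 - 2 * s by rewrite subr_gt0.
pose F t := t * f s e t.
pose F1 t := f s e t - s * 2 * t ^+ 2 * (t ^+ 2 + e) `^ (- s - 1).
have dF t : is_derive t 1 F (F1 t).
  have := is_deriveM (is_derive_id t 1) (is_derive_f s t e0).
  by congr is_derive; rewrite /GRing.scale /= /F1; ring.
have fF t : (1 - 2 * s) * f s e t <= F1 t.
  rewrite /F1 mulrBl mul1r lerD2l lerN2 (mulrC s 2) -!mulrA ler_pM2l // ler_wpM2l //.
  have -> : f s e t = (t ^+ 2 + e) * (t ^+ 2 + e) `^ (- s - 1).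
    rewrite /f [in LHS](_ : - s = 1 + (- s - 1)); last by ring.
    by rewrite powRD ?(gt_eqF (pos t e0)) ?implybT // powRr1 ?(ltW (pos _ _)).
  by rewrite mulrA -expr2 ler_wpM2r ?powR_ge0 // lerDl ltW.
have cg : continuous (fun t => (t ^+ 2 + e) `^ (- s - 1)).
  have := @continuous_f (s + 1) e e0; rewrite /f opprD; exact.
have cF1 : continuous F1.
  move=> t; apply: (@continuousB _ _ _ (f s e) (fun t => s * 2 * t ^+ 2 * (t ^+ 2 + e) `^ (- s - 1))).
    exact: continuous_f.
  apply: (@continuousM _ _ (fun t => s * 2 * t ^+ 2) (fun t => (t ^+ 2 + e) `^ (- s - 1))); last exact: cg.
  apply: (@continuousM _ _ (cst (s * 2)) (fun t => t ^+ 2)); first exact: cst_continuous.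
  exact: exprn_continuous.
have mf : measurable_fun `[- M, M] (f s e).
  by apply: measurable_funTS; apply: continuous_measurable_fun; exact: continuous_f.
have F1int : (\int[@lebesgue_measure R]_(t in `[(- M)%R, M]) (F1 t)%:E = (F M - F (- M))%:E)%E.
  rewrite EFinB; apply: continuous_FTC2.
  - by rewrite gtrN.
  - exact: continuous_subspaceT.
  - split=> [t _||].
    + by have [] := dF t.
    + apply: cvg_at_right_filter; apply: differentiable_continuous; apply/derivable1_diffP.
      by have [] := dF (- M).
    + apply: cvg_at_left_filter; apply: differentiable_continuous; apply/derivable1_diffP.
      by have [] := dF M.
  - by move=> t _; rewrite derive1E; have [_] := dF t.
have : ((1 - 2 * s)%:E * \int[@lebesgue_measure R]_(t in `[(- M)%R, M]) (f s e t)%:E <= (2 * M)%:E)%E.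
  rewrite -ge0_integralZl_EFin //; last 3 first.
    by move=> t _; rewrite lee_fin powR_ge0.
    by apply/measurable_EFinP.
    exact: ltW.
  apply: (@le_trans _ _ (F M - F (- M))%:E).
    rewrite -F1int; apply: ge0_le_integral => //.
    - by move=> t _; rewrite mule_ge0 // lee_fin ?powR_ge0 // ltW.
    - by apply/measurable_EFinP; apply: measurable_funM => //; exact: measurable_cst.
    - by apply/measurable_EFinP; apply: measurable_funTS; exact: continuous_measurable_fun.
    - by move=> t _; rewrite -EFinM lee_fin.
  rewrite lee_fin /F /f sqrrN mulNr opprK -mulrDl -mulr2n -[M *+ 2]mulr_natl ler_piMr ?mulr_ge0 ?(ltW M0) //.
  rewrite powRN invf_le1 ?powR_gt0 ?pos //.
  by rewrite -[leLHS](powRr0 (M ^+ 2 + e)) ler_powR // (le_trans (exprn_ege1 2 M1)) // lerDl ltW.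
rewrite -lee_pdivlMl //; move=> /le_trans; apply.
by rewrite -EFinM mulrC.
Qed.
Lemma continuous_sqrD_powR s e : 0 < e -> continuous (fun t => (t ^+ 2 + e) `^ (- s)).
Proof. exact: continuous_f. Qed.

End one_dim_bound.

(** The origin is a separate case because the real power of 0 with a nonzero exponent is 0 by
    convention. *)
Definition usng (R : realType) (n : nat) (s : R) (x : 'rV[R]_(n + n)) : \bar R :=
  if x == 0 then -oo%E else (- (cnorm2 x) `^ (- s))%:E.

Section cube_integral.
Variable R : realType.
Implicit Types (M e s : R) (f : R -> R).

Lemma cube_consV N M (t : R) (y : 'rV[R]_N) :
  cube N.+1 M (consV (t, y)) <-> `[- M, M]%classic t /\ cube N M y.
Proof.
rewrite /= in_itv /= -ler_norml; split=> [H|[tM yM] i].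
  split=> [|j]; first by have := H ord0; rewrite consV0.
  by have := H (lift ord0 j); rewrite consVS.
by case: (unliftP ord0 i) => [j|] ->; rewrite ?consV0 ?consVS //; exact: yM.
Qed.

Lemma integral_cube_coor0 N M f : 0 <= M -> measurable_fun setT f -> (forall t, 0 <= f t) ->
  (\int[leb R N.+1]_(x in cube N.+1 M) (f (x 0 ord0))%:E =
   (\int[@lebesgue_measure R]_(t in `[(- M)%R, M]) (f t)%:E) * ((2 * M) ^+ N)%:E)%E.
Proof.
move=> M0 mf f0; rewrite integral_mkcond leb_ge0_fubini; first last.
- by move=> x; rewrite patchE; case: ifP => // _; rewrite lee_fin.
- apply/(measurable_restrictT _ _).1; first exact: measurable_cube.
  apply/measurable_EFinP; apply: measurable_funTS.
  by apply: (measurableT_comp mf); exact: measurable_coor.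
rewrite [in RHS]integral_mkcond -ge0_integralZr //; first last.
- by rewrite lee_fin exprn_ge0 // mulr_ge0.
- by move=> t _; rewrite patchE; case: ifP => // _; rewrite lee_fin.
- apply/(measurable_restrictT _ _).1 => //.
  by apply/measurable_EFinP; exact: measurable_funTS.
apply: eq_integral => t _; rewrite patchE; case: ifPn => tM.
  transitivity (\int[leb R N]_(y in cube N M) (f t)%:E)%E.
    rewrite [RHS]integral_mkcond; apply: eq_integral => y _; rewrite !patchE consV0.
    move: tM; rewrite inE => tM.
    have [yM|yM] := pselect (cube N M y).
      by rewrite !mem_set //; apply/cube_consV.
    by rewrite !memNset // => /cube_consV[].
  rewrite integral_cst; last exact: measurable_cube.
  by congr (_ * _)%E; exact: leb_cube.
rewrite mul0e; apply: integral0_eq => y _; rewrite patchE memNset //.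
by move=> /cube_consV[tM' _]; move: tM; rewrite mem_set.
Qed.

(** Since |x|^2 >= x_i^2, a single coordinate controls the singularity. This costs 2 s < 1 but
    reduces integrability in dimension N to an integral on the line. *)
Lemma integral_cube_sqr N M s : (0 < N)%N -> 1 <= M -> 0 <= s -> 2 * s < 1 ->
  exists (i : 'I_N) (B : R), forall e, 0 < e ->
  (\int[leb R N]_(x in cube N M) ((x 0 i ^+ 2 + e) `^ (- s))%:E <= B%:E)%E.
Proof.
case: N => // N _ M1 s0 s1; have M0 : 0 <= M by apply: le_trans M1.
exists ord0, (2 * M / (1 - 2 * s) * (2 * M) ^+ N) => e e0.
rewrite (@integral_cube_coor0 N M (fun t => (t ^+ 2 + e) `^ (- s))) //.
- rewrite EFinM lee_wpmul2r ?lee_fin ?exprn_ge0 ?mulr_ge0 //.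
  exact: integral_sqrD_powR.
- by apply: continuous_measurable_fun; exact: continuous_sqrD_powR.
- by move=> t; exact: powR_ge0.
Qed.

End cube_integral.

Section usng_facts.
Variables (R : realType) (n : nat).
Local Notation N := (n + n)%N.
Local Notation E := 'rV[R]_N.
Variable s : R.
Hypothesis s0 : 0 < s.
Implicit Types (x : E) (k : nat).

Definition epsk k : R := k.+1%:R^-1.

Lemma epsk_gt0 k : 0 < epsk k. Proof. by rewrite invr_gt0. Qed.

Lemma qpow_anti e e' x : 0 < e -> e <= e' -> qpow e' (- s) x <= qpow e (- s) x.
Proof.
move=> e0 ee'; have e0' := lt_le_trans e0 ee'.
rewrite /qpow !powRN lef_pV2 ?posrE ?powR_gt0 ?cnorm2D_gt0 //.
by apply: ge0_ler_powR; rewrite ?nnegrE ?(ltW s0) ?(ltW (cnorm2D_gt0 _ _)) // lerD2l.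
Qed.

Lemma qpow_le_usng e x : 0 < e -> ((qpow e (- s) x)%:E <= `|usng s x|)%E.
Proof.
move=> e0; rewrite /usng; case: eqP => [_|/eqP x0] /=; first by rewrite leey.
have q0 : 0 < cnorm2 x by rewrite lt0r cnorm2_eq0 x0 cnorm2_ge0.
rewrite lee_fin normrN ger0_norm ?powR_ge0 // /qpow !powRN.
rewrite lef_pV2 ?posrE ?powR_gt0 ?cnorm2D_gt0 //.
by apply: ge0_ler_powR; rewrite ?nnegrE ?(ltW s0) ?(ltW q0) ?(ltW (cnorm2D_gt0 _ _)) // lerDl ltW.
Qed.

Lemma usng_le0 x : (usng s x <= 0)%E.
Proof. by rewrite /usng; case: ifP => // _; rewrite lee_fin oppr_le0 powR_ge0. Qed.

Lemma usng_abse x : `|usng s x|%E = (- usng s x)%E.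
Proof. exact: lee0_abs (usng_le0 x). Qed.

Lemma qpow_cvg x : (qpow (epsk k) (- s) x)%:E @[k --> \oo] --> `|usng s x|%E.
Proof.
rewrite /usng; case: eqP => [->|/eqP x0] /=.
  apply/cvgeyPge => A.
  have q0 : cnorm2 (0 : E) = 0 by apply/eqP; rewrite cnorm2_eq0.
  pose B := `|A| `^ s^-1.
  near=> k; rewrite lee_fin /qpow q0 add0r /epsk.
  rewrite -(powR_inv1 (ler0n _ k.+1)) -powRrM mulrN mulNr mul1r opprK.
  apply: le_trans (ler_norm A) _.
  have -> : `|A| = B `^ s by rewrite /B -powRrM mulVf ?powRr1 // gt_eqF.
  apply: ge0_ler_powR; rewrite ?nnegrE ?powR_ge0 // ?(ltW s0) //.
  apply: (@le_trans _ _ k%:R); last by rewrite ler_nat.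
  near: k; exact: nbhs_infty_ger.
have q0 : 0 < cnorm2 x by rewrite lt0r cnorm2_eq0 x0 cnorm2_ge0.
rewrite normrN ger0_norm ?powR_ge0 //; apply: cvg_EFin; first by near=> k.
apply: (@continuous_cvg _ _ _ _ _ _ (fun t : R => t `^ (- s))).
  apply: differentiable_continuous; apply/derivable1_diffP.
  by have [] := is_derive1_powR (- s) q0.
rewrite -[X in _ --> X]addr0; apply: cvgD; [exact: cvg_cst|exact: cvg_harmonic].
Unshelve. all: by end_near. Qed.

Lemma ureg_cvg x : (ureg (epsk k) s x)%:E @[k --> \oo] --> usng s x.
Proof.
have -> : usng s x = (- `|usng s x|)%E by rewrite usng_abse oppeK.
under eq_fun => k do rewrite /ureg EFinN.
by apply: cvgeN; exact: qpow_cvg.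
Qed.

Lemma usng_le_ureg e x : 0 < e -> (usng s x <= (ureg e s x)%:E)%E.
Proof.
by move=> e0; rewrite -[leLHS]oppeK -usng_abse /ureg EFinN leeN2 qpow_le_usng.
Qed.

Lemma ureg_abse e x : `|(ureg e s x)%:E|%E = (qpow e (- s) x)%:E.
Proof. by rewrite /= /ureg normrN ger0_norm // powR_ge0. Qed.

Lemma measurable_usng : measurable_fun setT (usng s : E -> \bar R).
Proof.
apply: (emeasurable_fun_cvg (fun k x => (ureg (epsk k) s x)%:E)) => [k|x _].
  apply/measurable_EFinP; apply: continuous_measurable_rV.
  by apply: continuous_ureg; exact: epsk_gt0.
exact: ureg_cvg.
Qed.

Hypothesis s1 : 2 * s < 1.
Hypothesis n0 : (0 < n)%N.

Lemma usng_integrable_cube M : (leb R N).-integrable (cube N M) (usng s : E -> \bar R).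
Proof.
apply: (@integrableS _ _ _ _ (cube N (Num.max M 1))); [exact: measurable_cube|exact: measurable_cube| |].
  by move=> x H i; rewrite le_max H.
set M' := Num.max _ _; have M1 : 1 <= M' by rewrite le_max lexx orbT.
apply/integrableP; split; first by apply: measurable_funTS; exact: measurable_usng.
have N0 : (0 < N)%N by rewrite addn_gt0 n0.
have [i [B HB]] := @integral_cube_sqr R N M' s N0 M1 (ltW s0) s1.
apply: (@le_lt_trans _ _ B%:E); last exact: ltry.
have H : (\int[leb R N]_(x in cube N M') (qpow (epsk k) (- s) x)%:E)%E @[k --> \oo] -->
    (\int[leb R N]_(x in cube N M') `|usng s x|)%E.
  have <- : (fun x : E => limn (fun k => (qpow (epsk k) (- s) x)%:E)) = (fun x => `|usng s x|)%E.
    by apply/funext => x; apply/cvg_lim => //; exact: qpow_cvg.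
  apply: (@cvg_monotone_convergence _ _ _ (leb R N) (cube N M') (@measurable_cube R N M')
    (fun k x => (qpow (epsk k) (- s) x)%:E)) => [k|k x _|x _ k l kl].
- apply/measurable_EFinP; apply: measurable_funTS; apply: continuous_measurable_rV.
  by apply: continuous_qpow; exact: epsk_gt0.
- by rewrite lee_fin powR_ge0.
- rewrite lee_fin; apply: qpow_anti; first exact: epsk_gt0.
  by rewrite /epsk lef_pV2 ?posrE // ler_nat.
rewrite -(cvg_lim _ H) //; apply: lime_le; first exact: cvgP H.
near=> k; apply: le_trans (HB (epsk k) (epsk_gt0 k)).
apply: ge0_le_integral.
- exact: measurable_cube.
- by move=> x _; rewrite lee_fin powR_ge0.
- apply/measurable_EFinP; apply: measurable_funTS; apply: continuous_measurable_rV.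
  by apply: continuous_qpow; exact: epsk_gt0.
- apply/measurable_EFinP; apply: measurable_funTS.
  exact: measurableT_comp (continuous_measurable_fun
    (@continuous_sqrD_powR R s (epsk k) (epsk_gt0 k))) (@measurable_coor R N i).
- move=> x _; rewrite lee_fin /qpow !powRN.
  have p1 : 0 < x 0 i ^+ 2 + epsk k by rewrite ltr_wpDl ?sqr_ge0 ?epsk_gt0.
  have p2 : 0 < cnorm2 x + epsk k by apply: cnorm2D_gt0; exact: epsk_gt0.
  rewrite lef_pV2 ?posrE ?powR_gt0 //.
  by apply: ge0_ler_powR; rewrite ?nnegrE ?(ltW s0) ?(ltW p1) ?(ltW p2) // lerD2r sqr_coor_le.
Unshelve. all: by end_near. Qed.

Lemma usng_loc_integrable : loc_integrable_on setT (usng s : E -> \bar R).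
Proof.
move=> K cK _; have [M M0 KM] := compact_sub_cube cK.
apply: integrableS KM _; [exact: measurable_cube|exact: measurable_compact_rV|].
exact: usng_integrable_cube.
Qed.

End usng_facts.

(** * Positivity of the current in the limit *)

Section usng_ddc.
Variables (R : realType) (n : nat).
Local Notation N := (n + n)%N.
Local Notation E := 'rV[R]_N.

Lemma integral_sum_eq (I : Type) (r : seq I) (F G : I -> E -> R) :
  (forall i, (leb R N).-integrable setT (EFin \o F i)) ->
  (forall i, (leb R N).-integrable setT (EFin \o G i)) ->
  (forall i, \int[leb R N]_x (F i x)%:E = \int[leb R N]_x (G i x)%:E)%E ->
  (\int[leb R N]_x (\sum_(i <- r) F i x)%:E = \int[leb R N]_x (\sum_(i <- r) G i x)%:E)%E.
Proof.
move=> iF iG FG.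
have iS (H : I -> E -> R) : (forall i, (leb R N).-integrable setT (EFin \o H i)) ->
    forall l, (leb R N).-integrable setT (fun x => (\sum_(i <- l) H i x)%:E).
  move=> iH; elim=> [|i l IH].
    by under eq_fun do rewrite big_nil; exact: integrable0.
  under eq_fun do rewrite big_cons EFinD.
  by apply: (integrableD measurableT) => //; exact: iH.
elim: r => [|i r IH]; first by under eq_integral do rewrite big_nil; under [RHS]eq_integral do rewrite big_nil.
under eq_integral do rewrite big_cons EFinD.
under [RHS]eq_integral do rewrite big_cons EFinD.
rewrite (integralD measurableT (iF i) (iS F iF r)) (integralD measurableT (iG i) (iS G iG r)).
by rewrite IH; congr (_ + _)%E; exact: FG.
Qed.

Variable s : R.
Hypotheses (s0 : 0 < s) (s1 : 2 * s < 1) (n0 : (0 < n)%N).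

Lemma ureg_ddc_integral (C : 'I_N -> 'I_N -> R) (f : E -> R) M e : 0 < e ->
  (forall k, Ck k f) -> (forall x, ~ cube N M x -> f x = 0) -> (forall x, 0 <= f x) ->
  (forall x, 0 <= \sum_p \sum_r C p r * ureg2 e s p r x) ->
  (0 <= \int[leb R N]_x (ureg e s x *
     (\sum_p \sum_r C p r * 'D_(delta_mx 0 p) ('D_(delta_mx 0 r) f) x))%:E)%E.
Proof.
move=> e0 Cf fM f0 H.
have cD p r : continuous ('D_(delta_mx 0 p) ('D_(delta_mx 0 r) f)).
  by apply: Ck_continuous; do 2 apply: Ck_derive.
have D0 p r x : ~ cube N M x -> 'D_(delta_mx 0 p) ('D_(delta_mx 0 r) f) x = 0.
  by move=> xM; apply: derive_out_cube xM => y yM; exact: derive_out_cube fM _ yM.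
pose F (pr : 'I_N * 'I_N) x := C pr.1 pr.2 * (ureg e s x * 'D_(delta_mx 0 pr.1) ('D_(delta_mx 0 pr.2) f) x).
pose G (pr : 'I_N * 'I_N) x := C pr.1 pr.2 * (ureg2 e s pr.1 pr.2 x * f x).
have i1 p r : (leb R N).-integrable setT (EFin \o (fun x => ureg e s x * 'D_(delta_mx 0 p) ('D_(delta_mx 0 r) f) x)).
  apply: (@continuous_cube_integrable R N M) => [x|x xM]; last by rewrite D0 ?mulr0.
  by apply: (@continuousM _ _ (ureg e s) ('D_(delta_mx 0 p) ('D_(delta_mx 0 r) f))); [exact: continuous_ureg|exact: cD].
have i2 p r : (leb R N).-integrable setT (EFin \o (fun x => ureg2 e s p r x * f x)).
  apply: (@continuous_cube_integrable R N M) => [x|x xM]; last by rewrite fM ?mulr0.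
  by apply: (@continuousM _ _ (ureg2 e s p r) f); [exact: continuous_ureg2|exact: Ck_continuous].
rewrite (_ : (\int[leb R N]_x _)%E = (\int[leb R N]_x (\sum_pr F pr x)%:E)%E); last first.
  apply: eq_integral => x _; congr EFin.
  transitivity (\sum_p \sum_r F (p, r) x); last by rewrite pair_bigA.
  rewrite mulr_sumr; apply: eq_bigr => p _; rewrite mulr_sumr; apply: eq_bigr => r _.
  by rewrite mulrCA.
rewrite (@integral_sum_eq _ _ F G).
- apply: integral_ge0 => x _; rewrite lee_fin.
  have -> : \sum_pr G pr x = (\sum_p \sum_r C p r * ureg2 e s p r x) * f x.
    transitivity (\sum_p \sum_r G (p, r) x); first by rewrite pair_bigA.
    rewrite mulr_suml; apply: eq_bigr => p _; rewrite mulr_suml; apply: eq_bigr => r _.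
    exact: mulrA.
  by rewrite mulr_ge0.
- by move=> [p r]; have := integrableZl measurableT (C p r) (i1 p r).
- by move=> [p r]; have := integrableZl measurableT (C p r) (i2 p r).
- move=> [p r]; rewrite /F /G /=; under eq_integral do rewrite EFinM; under [RHS]eq_integral do rewrite EFinM.
  rewrite (integralZl measurableT (i1 p r)) (integralZl measurableT (i2 p r)); congr (_ * _)%E.
  exact: ureg_ibp2 e0 _ _ _ _ _ Cf fM.
Qed.

(** The weight w coming from the test function is continuous with compact support, and the
    regularizations satisfy |u_e| <= |u|. A bound of w times |u| on a cube is then an integrable
    majorant for dominated convergence. *)
Lemma usng_ddc_wedge_ge0 m (a : 'I_(m - 1) -> cform R n) : (1 <= m)%N -> (m < n)%N ->
  s * m%:R <= 1 -> (forall j, m_positive m (a j)) ->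
  ddc_wedge_ge0 setT (usng s : E -> \bar R)
    (wedge (\big[@wedge R n/form1 R n]_(j < m - 1) a j) (wedgeX (beta R n) (n - m))).
Proof.
move=> m1 mn sm ma f [Cf [K [cK _ fK]]] f0; set T := wedge _ _.
have [M M0 KM] := compact_sub_cube cK.
have fM x : ~ cube N M x -> f x = 0 by move=> xM; apply: fK => /KM.
have [C HC] := hessian_functional T.
pose w x := \sum_p \sum_r C p r * 'D_(delta_mx 0 p) ('D_(delta_mx 0 r) f) x.
have wE x : complex.Re (topcoef (wedge (ddc f x) T)) = w x.
  by rewrite /ddc complex_hessianE HC.
under eq_integral do rewrite wE.
have cw : continuous w.
  apply: continuous_sum => p; apply: continuous_sum => r x.
  apply: (@continuousM _ _ (cst (C p r)) ('D_(delta_mx 0 p) ('D_(delta_mx 0 r) f))).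
    exact: cst_continuous.
  by apply: Ck_continuous; do 2 apply: Ck_derive.
have w0 x : ~ cube N M x -> w x = 0.
  move=> xM; rewrite /w big1 // => p _; rewrite big1 // => r _.
  by rewrite (derive_out_cube _ _ xM) ?mulr0 // => y yM; exact: derive_out_cube fM _ yM.
have [B B0 wB] := continuous_cube_bounded cw w0.
have mw : measurable_fun setT w by exact: continuous_measurable_rV.
have := @dominated_convergence _ _ _ (leb R N) setT measurableT
  (fun k x => (ureg (epsk R k) s x * w x)%:E) (fun x => usng s x * (w x)%:E)%E
  (fun x => B%:E * (abse \o usng s) \_ (cube N M) x)%E.
have H1 k : measurable_fun setT (fun x : E => (ureg (epsk R k) s x * w x)%:E).
  apply/measurable_EFinP; apply: measurable_funM => //; apply: continuous_measurable_rV.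
  by apply: continuous_ureg; exact: epsk_gt0.
have H2 : measurable_fun setT (fun x : E => usng s x * (w x)%:E)%E.
  apply: emeasurable_funM; first exact: measurable_usng.
  exact/measurable_EFinP.
have H3 : {ae leb R N, forall x : E, setT x -> (ureg (epsk R k) s x * w x)%:E @[k --> \oo] --> (usng s x * (w x)%:E)%E}.
  apply: aeW => x _; under eq_fun do rewrite EFinM.
  apply: cvgeZr => //; exact: ureg_cvg.
have H4 : (leb R N).-integrable setT (fun x : E => B%:E * (abse \o usng s) \_ (cube N M) x)%E.
  apply: integrableZl => //; apply/(integrable_mkcond _ (@measurable_cube R N M)).
  by apply: integrable_abse; exact: usng_integrable_cube.
have H5 : {ae leb R N, forall x : E, forall k, setT x -> (`|(ureg (epsk R k) s x * w x)%:E| <= B%:E * (abse \o usng s) \_ (cube N M) x)%E}.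
  apply: aeW => x k _; rewrite patchE; case: ifPn => xM; last first.
    have -> : w x = 0 by apply: w0; move/negP: xM; rewrite inE.
    by rewrite mulr0 mule0 /= normr0.
  rewrite EFinM abseM muleC lee_pmul //; first by rewrite /= lee_fin.
  by rewrite ureg_abse; apply: qpow_le_usng => //; exact: epsk_gt0.
move=> /(_ H1 H2 H3 H4 H5)[_ _ H].
rewrite -(cvg_lim _ H) //; apply: lime_ge; first exact: cvgP H.
near=> k; apply: ureg_ddc_integral Cf fM f0 _; first exact: epsk_gt0.
move=> x; apply: ureg_m_subharmonic ma (epsk_gt0 R k) (ltW s0) sm HC => //.
Unshelve. all: by end_near. Qed.

End usng_ddc.

(** * Lelong number and integrability *)

Section usng_usc.
Variables (R : realType) (n : nat) (s : R).
Local Notation N := (n + n)%N.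
Local Notation E := 'rV[R]_N.
Hypothesis s0 : 0 < s.

(** As an infimum of continuous functions: some regularization is already below c at x, hence near
    x, and it dominates u. *)
Lemma usng_usc : usc_on setT (usng s : E -> \bar R).
Proof.
move=> x _ c xc.
have : \forall k \near \oo, ((ureg (epsk R k) s x)%:E < c%:E)%E.
  apply: (@ureg_cvg R n s s0 x [set y | (y < c%:E)%E]).
  by apply: open_nbhs_nbhs; split=> //; exact: open_ereal_lt_ereal.
move=> [k _ /(_ k (leqnn _))]; rewrite lte_fin => kc.
have cu : continuous (ureg (epsk R k) s : E -> R) by apply: continuous_ureg; exact: epsk_gt0.
near=> y; apply: le_lt_trans (usng_le_ureg s0 y (epsk_gt0 R k)) _; rewrite lte_fin.
by near: y; exact: (cvgr_lt _ (cu x) _ kc).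
Unshelve. all: by end_near. Qed.

Lemma usng_lty (x : E) : (usng s x < +oo)%E.
Proof. by apply: le_lt_trans (usng_le0 s x) _; exact: ltry. Qed.

End usng_usc.

Section unit_ball_measure.
Variables (R : realType) (n : nat).
Local Notation N := (n + n)%N.
Local Notation E := 'rV[R]_N.

Lemma cnorm_ge0 (x : E) : 0 <= cnorm x.
Proof. exact: sqrtr_ge0. Qed.

Lemma sqr_cnorm (x : E) : cnorm x ^+ 2 = cnorm2 x.
Proof. by rewrite sqr_sqrtr // cnorm2_ge0. Qed.

Lemma cnorm_eq0 (x : E) : (cnorm x == 0) = (x == 0).
Proof. by rewrite -sqrf_eq0 sqr_cnorm cnorm2_eq0. Qed.

Lemma cnorm_gt0 (x : E) : (0 < cnorm x) = (x != 0).
Proof. by rewrite lt0r cnorm_eq0 cnorm_ge0 andbT. Qed.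

Lemma cnorm2Z (c : R) (x : E) : cnorm2 (c *: x) = c ^+ 2 * cnorm2 x.
Proof. by rewrite /cnorm2 mulr_sumr; apply: eq_bigr => i _; rewrite mxE exprMn. Qed.

Lemma continuous_cnorm : continuous (@cnorm R n).
Proof.
move=> x; apply: (@continuous_comp _ _ _ (@cnorm2 R n) Num.sqrt).
  exact: continuous_cnorm2.
exact: sqrt_continuous.
Qed.

Lemma measurable_cnorm_lt (r : R) : measurable [set x : E | cnorm x < r].
Proof.
apply: measurable_open_rV.
by apply: (@open_comp _ _ (@cnorm R n) [set y | y < r]) => [x _|]; [exact: continuous_cnorm|exact: open_lt].
Qed.

Lemma measurable_unit_ball : measurable (@unit_ball R n).
Proof. exact: measurable_cnorm_lt. Qed.

Lemma unit_ball_cube : @unit_ball R n `<=` cube N 1.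
Proof.
move=> x /= x1 i; rewrite -(@ler_pXn2r _ 2) ?nnegrE // expr1n real_normK ?num_real //.
apply: le_trans (sqr_coor_le x i) _; rewrite -sqr_cnorm -(expr1n _ 2).
by rewrite ler_pXn2r ?nnegrE ?cnorm_ge0 // ltW.
Qed.

Lemma unit_ball_lty : (leb R N (@unit_ball R n) < +oo)%E.
Proof.
apply: (@le_lt_trans _ _ (leb R N (cube N 1))).
  apply: le_measure; rewrite ?inE; [exact: measurable_unit_ball|exact: measurable_cube|exact: unit_ball_cube].
by rewrite [X in (X < _)%E](leb_cube N ler01) ltry.
Qed.

Lemma unit_ball_gt0 : (0 < leb R N (@unit_ball R n))%E.
Proof.
(* For d = 1/(N + 1) one has N d^2 < 1, so the cube of half side d lies in the unit ball. *)
have d0 : 0 < (N%:R + 1)^-1 :> R by rewrite invr_gt0 ltr_wpDl.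
apply: (@lt_le_trans _ _ (leb R N (cube N (N%:R + 1)^-1))).
  by rewrite [X in (_ < X)%E](leb_cube N (ltW d0)) lte_fin exprn_gt0 // mulr_gt0.
apply: le_measure; rewrite ?inE; [exact: measurable_cube|exact: measurable_unit_ball|].
move=> x xd; rewrite /unit_ball /= -(@ltr_pXn2r _ 2) ?nnegrE ?cnorm_ge0 // expr1n sqr_cnorm.
apply: (@le_lt_trans _ _ (\sum_(i < N) (N%:R + 1)^-1 ^+ 2)).
  apply: ler_sum => i _; rewrite -[x 0 i ^+ 2]real_normK ?num_real //.
  by rewrite lerXn2r ?nnegrE ?(ltW d0).
rewrite sumr_const card_ord -[_ *+ N]mulr_natl.
have : N%:R / (N%:R + 1) < 1 :> R by rewrite ltr_pdivrMr ?mul1r ?ltrDl // ltr_wpDl.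
have : (N%:R + 1)^-1 <= 1 :> R by rewrite invf_le1 ?lerDr // ltr_wpDl.
move: d0; set d := (_)^-1 => d0 d1 Nd; nra.
Qed.

Lemma leb_set1 : (0 < N)%N -> leb R N [set 0 : E] = 0%E.
Proof.
move=> N0; apply/eqP; rewrite eq_le measure_ge0 andbT.
have <- : leb R N (cube N 0) = 0%E.
  by rewrite leb_cube // mulr0 expr0n gtn_eqF.
apply: le_measure; rewrite ?inE; [|exact: measurable_cube|].
  by apply: measurable_compact_rV; exact: compact_set1.
by move=> y -> i; rewrite mxE normr0.
Qed.

End unit_ball_measure.

Section radial_map.
Variables (R : realType) (n : nat).
Local Notation N := (n + n)%N.
Local Notation E := 'rV[R]_N.

Lemma measurable_radial (r : R) : measurable_fun setT (fun z : E => (r / cnorm z) *: z).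
Proof.
apply: measurable_fun_rVP => i.
rewrite (_ : (fun t => _) = (fun z : E => r * (cnorm2 z) `^ (- 2^-1) * z 0 i)); last first.
  by apply/funext => z; rewrite mxE powRN powR12_sqrt // cnorm2_ge0.
apply: measurable_funM; last exact: measurable_coor.
apply: measurable_funM; first exact: measurable_cst.
apply: (measurableT_comp (measurable_powR _)).
by apply: continuous_measurable_rV; exact: continuous_cnorm2.
Qed.

Lemma cnorm2_radial (r : R) (z : E) : z != 0 -> cnorm2 ((r / cnorm z) *: z) = r ^+ 2.
Proof.
move=> z0; rewrite cnorm2Z expr_div_n -mulrA sqr_cnorm mulVf ?mulr1 //.
by rewrite cnorm2_eq0.
Qed.

End radial_map.

Section usng_origin.
Variables (R : realType) (n : nat) (s : R).
Local Notation N := (n + n)%N.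
Local Notation E := 'rV[R]_N.
Hypotheses (s0 : 0 < s) (n0 : (0 < n)%N).

Lemma ae_neq0 : {ae leb R N, forall x : E, x != 0}.
Proof.
exists [set 0]; split.
- by apply: measurable_compact_rV; exact: compact_set1.
- by apply: leb_set1; rewrite addn_gt0 n0.
- by move=> x /= /negP; rewrite negbK => /eqP.
Qed.

Lemma sphere_mean_usng r : 0 < r ->
  sphere_mean (usng s : E -> \bar R) 0 r = (- r `^ (- (2 * s)))%:E.
Proof.
move=> r0; rewrite /sphere_mean.
rewrite (@ae_eq_integral _ _ _ _ _ (cst (- r `^ (- (2 * s)))%:E)).
- rewrite integral_cst; last exact: measurable_unit_ball.
  have vE : leb R N (@unit_ball R n) = (fine (leb R N (@unit_ball R n)))%:E.
    by rewrite fineK // ge0_fin_numE //; exact: unit_ball_lty.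
  rewrite [X in (_ * X * _)%E]vE -!EFinM mulfK // gt_eqF // fine_gt0 //.
  by rewrite unit_ball_gt0; exact: unit_ball_lty.
- exact: measurable_unit_ball.
- apply: measurable_funTS; apply: measurableT_comp; first exact: measurable_usng.
  rewrite (_ : (fun _ => _) = (fun z : E => (r / cnorm z) *: z)); first exact: measurable_radial.
  by apply/funext => z; rewrite add0r.
- exact: measurable_cst.
- have := ae_neq0; apply: filterS => z z0 _; rewrite add0r /usng.
  rewrite -cnorm2_eq0 cnorm2_radial // sqrf_eq0 gt_eqF //=; congr (- _)%:E.
  by rewrite -powR_mulrn ?ltW // -powRrM mulrN.
Qed.

Lemma usng_lelong m : (0 < m)%N -> (m < n)%N -> s * m%:R < 1 ->
  is_lelong m (usng s : E -> \bar R) 0 0%E.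
Proof.
move=> m0 mn sm; exists 0%E; last by rewrite mule0.
set q : R := n%:R / m%:R - 1.
have m0' : 0 < m%:R :> R by rewrite ltr0n.
(* From n >= m + 1 follows q >= 1/m > s. The quotient of the mean by [phi] is q r^(2 (q - s)), which
   therefore tends to 0. *)
have q0 : 0 < q - s.
  rewrite /q -addrA -opprD subr_gt0 ltr_pdivlMr // mulrDl mul1r.
  have : (m%:R : R) + 1 <= n%:R by rewrite natr1 ler_nat.
  by lra.
apply: (@cvg_trans _ ((q * r `^ (2 * (q - s)))%:E @[r --> 0^'+])).
  apply: near_eq_cvg; near=> r.
  have r0 : 0 < r by near: r; exact: nbhs_right_gt.
  rewrite sphere_mean_usng // -EFinM; congr EFin.
  rewrite /phi -/q invrN invrK mulrNN mulrCA -powRD ?(gt_eqF r0) ?implybT //.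
  by congr (_ * _ `^ _); ring.
apply: cvg_EFin; first by near=> r.
rewrite -[X in _ --> X](mulr0 q); apply: cvgMr; apply: powR_cvg0.
by rewrite mulr_gt0.
Unshelve. all: by end_near. Qed.

(** On the cube of half side 1/(k + 1), where |x|^2 <= N/(k + 1)^2, the integrand is at least exp(c
    (k + 1)^(2 s)), while the volume is only of order (k + 1)^(-N). One Taylor term of the
    exponential outweighs the volume, and the lower bound grows linearly in k. *)
Lemma usng_not_exp_integrable gamma (U : set E) : s = (n%:R * 4)^-1 -> 0 < gamma -> open_nbhs (0 : E) U ->
  ~ (leb R N).-integrable U (fun z => expeR (- (gamma%:E * usng s z))%E).
Proof.
move=> sE g0 [oU U0] /integrableP[mf]; apply/negP; rewrite -leNgt.
have /nbhs_ballP[d /= d0 dU] : nbhs (0 : E) U by exact: open_nbhs_nbhs.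
have cubeU k : epsk R k < d -> cube N (epsk R k) `<=` U.
  move=> kd x xk; apply: dU; split=> // i j; rewrite /ball /= (ord1 i) mxE sub0r normrN.
  exact: le_lt_trans (xk j) kd.
pose c : R := gamma * N%:R `^ (- s).
have N0 : (0 < N)%N by rewrite addn_gt0 n0.
have N0' : 0 < N%:R :> R by rewrite ltr0n.
have c0 : 0 < c by rewrite mulr_gt0 // powR_gt0.
(* With s = 1/(2 N), the K-th Taylor term is of order (k + 1)^(2 s K) = (k + 1)^(N + 1), one power
   more than the volume loses. *)
pose K := (N * N.+1)%N.
have K0 : (0 < K)%N by rewrite muln_gt0 N0.
pose B : R := 2 ^+ N * (c ^+ K / K`!%:R).
have B0 : 0 < B by rewrite mulr_gt0 ?exprn_gt0 // divr_gt0 ?exprn_gt0 // ltr0n fact_gt0.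
have low k : epsk R k < d -> ((B * k.+1%:R)%:E <= \int[leb R N]_(x in U) `|expeR (- (gamma%:E * usng s x))|)%E.
  move=> kd; pose y : R := c * k.+1%:R `^ (2 * s).
  have y0 : 0 <= y by rewrite mulr_ge0 ?powR_ge0 // ltW.
  apply: (@le_trans _ _ (\int[leb R N]_(x in cube N (epsk R k)) (expR y)%:E)%E).
    rewrite integral_cst; last exact: measurable_cube.
    rewrite [X in (_ <= _ * X)%E](leb_cube N (ltW (epsk_gt0 R k))) -EFinM lee_fin.
    have -> : B * k.+1%:R = (2 * epsk R k) ^+ N * (y ^+ K / K`!%:R).
      rewrite /y [(c * _) ^+ K]exprMn [(2 * _) ^+ N]exprMn -[(k.+1%:R `^ (2 * s)) ^+ K]powR_mulrn ?powR_ge0 // -powRrM.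
      have -> : 2 * s * K%:R = N.+1%:R.
        rewrite sE /K natrM natrD; field.
        by rewrite pnatr_eq0 -lt0n.
      rewrite powR_mulrn // /epsk exprVn exprS /B.
      have kN : k.+1%:R ^+ N != 0 :> R by rewrite expf_neq0 // pnatr_eq0.
      have KF : K`!%:R != 0 :> R by rewrite pnatr_eq0 -lt0n fact_gt0.
      move: kN KF; move: (k.+1%:R ^+ N) (K`!%:R : R) (c ^+ K) (2 ^+ N) => a b p t; move=> a0 b0.
      by field; rewrite a0 b0.
    rewrite mulrC ler_wpM2r ?exprn_ge0 ?mulr_ge0 ?(ltW (epsk_gt0 _ _)) //.
    have := expR_ge1Dxn K.-1 y0; rewrite prednK //; apply: le_trans.
    by rewrite lerDr.
  apply: (@le_trans _ _ (\int[leb R N]_(x in cube N (epsk R k)) `|expeR (- (gamma%:E * usng s x))|)%E); last first.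
    apply: ge0_subset_integral; [exact: measurable_cube|exact: measurable_open_rV| | |exact: cubeU].
    - exact: measurableT_comp.
    - by move=> x _.
  apply: ge0_le_integral.
  - exact: measurable_cube.
  - by move=> x _; rewrite lee_fin expR_ge0.
  - exact: measurable_cst.
  - apply: measurableT_comp => //; apply: measurable_funS mf; [exact: measurable_open_rV|exact: cubeU].
  - move=> x xk; rewrite gee0_abs ?expeR_ge0 // /usng; case: eqP => [_|/eqP x0].
      by rewrite gt0_muleNy ?lte_fin //= leey.
    rewrite /= lee_fin ler_expR mulrN opprK /y /c -mulrA ler_pM2l //.
    have q0 : 0 < cnorm2 x by rewrite lt0r cnorm2_eq0 x0 cnorm2_ge0.
    have qN : cnorm2 x <= N%:R * epsk R k ^+ 2.
      rewrite /cnorm2 -[N in leRHS]card_ord mulr_natl -sumr_const; apply: ler_sum => i _.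
      rewrite -[x 0 i ^+ 2]real_normK ?num_real // lerXn2r ?nnegrE ?(ltW (epsk_gt0 _ _)) //.
    have -> : N%:R `^ (- s) * k.+1%:R `^ (2 * s) = (N%:R * epsk R k ^+ 2) `^ (- s).
      rewrite powRM ?sqr_ge0 // -[epsk R k ^+ 2]powR_mulrn ?(ltW (epsk_gt0 _ _)) //.
      by rewrite /epsk -powR_inv1 // -!powRrM; congr (_ * _ `^ _); ring.
    rewrite !powRN lef_pV2 ?posrE ?powR_gt0 ?mulr_gt0 ?exprn_gt0 ?epsk_gt0 //.
    by apply: ge0_ler_powR; rewrite ?nnegrE ?(ltW s0) ?(ltW q0) // mulr_ge0 ?sqr_ge0.
move: low; move: (\int[leb R N]_(x in U) _)%E => I low.
have trunc_gt (t : R) : t < (Num.truncn `|t|).+1%:R.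
  by apply: le_lt_trans (ler_norm t) _; have /andP[] := truncn_itv (normr_ge0 t).
have epsd k : (Num.truncn `|d^-1| <= k)%N -> epsk R k < d.
  move=> kd; rewrite /epsk -[ltRHS]invrK ltf_pV2 ?posrE ?invr_gt0 //.
  by apply: lt_le_trans (trunc_gt _) _; rewrite ler_nat ltnS.
case: I low => [r| |] low; last 2 first.
- exact: lexx.
- by have := low _ (epsd _ (leqnn _)).
exfalso; pose k := maxn (Num.truncn `|d^-1|) (Num.truncn `|r / B|).
have := low k (epsd k (leq_maxl _ _)); rewrite lee_fin leNgt => /negP; apply.
rewrite mulrC -ltr_pdivrMr //; apply: lt_le_trans (trunc_gt _) _.
by rewrite ler_nat ltnS leq_maxr.
Qed.

End usng_origin.

(** * Spherical means *)

Section directional.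
Variables (R : realType) (V : normedModType R).

Lemma is_derive_scaledir (phi : V -> R) (x v : V) (r d : R) :
  is_derive x v phi d -> is_derive x (r *: v) phi (r * d).
Proof.
move=> /is_derive_lineP H; apply/is_derive_lineP.
rewrite (_ : _ \o _ = (fun t => phi (t *: v + x)) \o (fun t : R => r * t)); last first.
  by apply/funext => t /=; rewrite scalerA mulrC.
have Hr : is_derive (0 : R) (1 : R) (fun t : R => r * t) r.
  have := is_deriveZ r (is_derive_id (0 : R) (1 : R)).
  by congr is_derive; rewrite /GRing.scale /= mulr1.
rewrite mulrC; apply: (@is_derive1_comp _ _ _ _ _ _ _ Hr).
by rewrite mulr0; exact: H.
Qed.

Lemma is_derive_affine (phi : V -> R) (a x v : V) (r d : R) :
  is_derive (a + r *: x) v phi d -> is_derive x v (fun z => phi (a + r *: z)) (r * d).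
Proof.
move=> /(is_derive_scaledir r) [H1 H2].
have sh h : a + r *: (h *: v + x) = h *: (r *: v) + (a + r *: x).
  by rewrite scalerDr !scalerA mulrC addrCA.
split; first exact: (@derivable_affine R V V phi (fun z => a + r *: z) x v (r *: v) sh).
by rewrite (@derive_affine R V V phi (fun z => a + r *: z) x v (r *: v) sh).
Qed.

End directional.

(** * Monotonicity of weighted means in the radius *)

Section weighted_mean.
Variables (R : realType) (n : nat) (e s : R).
Local Notation N := (n + n)%N.
Local Notation E := 'rV[R]_N.
Hypotheses (e0 : 0 < e) (s0 : 0 < s) (sN : 2 * (s + 1) <= N%:R).
Local Notation g := (@ureg R n e s).
Local Notation q := (@cnorm2 R n).

(** The trace is a positive multiple of N e + (N - 2 (s + 1)) |x|^2, whence the hypothesis [sN]. *)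
Lemma ureg_laplacian_ge0 x : 0 <= \sum_i @ureg2 R n e s i i x.
Proof.
have -> : \sum_i @ureg2 R n e s i i x =
    2 * s * qpow e (- s - 1) x * N%:R - 4 * s * (s + 1) * qpow e (- s - 2) x * q x.
  rewrite /ureg2 sumrB; congr (_ - _).
    rewrite (eq_bigr (fun=> 2 * s * qpow e (- s - 1) x)); last by move=> i _; rewrite eqxx mulr1.
    by rewrite sumr_const card_ord mulr_natr.
  rewrite /cnorm2 mulr_sumr; apply: eq_bigr => i _; ring.
have -> : qpow e (- s - 1) x = (q x + e) * qpow e (- s - 2) x.
  have q0 := cnorm2D_gt0 e0 x.
  rewrite /qpow (_ : - s - 1 = 1 + (- s - 2)); last by ring.
  by rewrite powRD ?powRr1 ?(ltW q0) // (gt_eqF q0) implybT.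
have := qpow_gt0 e0 (- s - 2) x; have := cnorm2_ge0 x.
move: (qpow _ _ _) (q x) => Q p p0 Q0.
have -> : 2 * s * ((p + e) * Q) * N%:R - 4 * s * (s + 1) * Q * p =
   2 * s * Q * (N%:R * e + (N%:R - 2 * (s + 1)) * p) by ring.
by rewrite !mulr_ge0 ?(ltW s0) ?(ltW Q0) // addr_ge0 ?mulr_ge0 ?(ltW e0) // subr_ge0.
Qed.

Lemma qpow_le (x : E) : qpow e (- s) x <= e `^ (- s).
Proof.
rewrite /qpow !powRN lef_pV2 ?posrE ?powR_gt0 ?cnorm2D_gt0 //.
by apply: ge0_ler_powR; rewrite ?nnegrE ?(ltW s0) ?(ltW e0) ?(ltW (cnorm2D_gt0 _ _)) // lerDr cnorm2_ge0.
Qed.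

Lemma ureg_bounded (x : E) : `|g x| <= e `^ (- s).
Proof. by rewrite /ureg normrN ger0_norm ?qpow_le // powR_ge0. Qed.

(** A crude gradient bound, valid on the whole space: |x_i| <= |x|^2 + 1 <= (1 + 1/e) (|x|^2 +
    e). *)
Definition ureg1_bound : R := 2 * s * (1 + e^-1) * e `^ (- s).

Lemma ureg1_bounded i x : `|@ureg1 R n e s i x| <= ureg1_bound.
Proof.
rewrite /ureg1 /ureg1_bound !normrM (ger0_norm (ltW s0)) (ger0_norm (ltW (qpow_gt0 e0 _ _))) ger0_norm //.
rewrite -!mulrA ler_pM2l // ler_pM2l //.
have q0 := cnorm2D_gt0 e0 x.
have -> : qpow e (- s - 1) x = (q x + e)^-1 * qpow e (- s) x.
  rewrite /qpow (_ : - s - 1 = -1 + - s); last by ring.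
  by rewrite powRD ?powR_inv1 ?(ltW q0) // (gt_eqF q0) implybT.
rewrite mulrA ler_pM ?qpow_le ?mulr_ge0 ?invr_ge0 ?(ltW q0) ?powR_ge0 //.
rewrite ler_pdivrMr // mulrDl mul1r.
have h1 : `|x 0 i| <= x 0 i ^+ 2 + 1.
  rewrite -real_normK ?num_real //; move: (`|x 0 i|) (normr_ge0 (x 0 i)) => t t0; nra.
have h2 := sqr_coor_le x i.
apply: le_trans h1 _; rewrite mulrDr mulVf ?gt_eqF // addrA lerD ?ler_wpDr //.
- by rewrite mulr_ge0 ?invr_ge0 ?cnorm2_ge0 // ltW.
- exact: ltW.
Qed.

Lemma is_derive_ureg_radial (a z : E) (r : R) :
  is_derive r 1 (fun r => g (a + r *: z)) (\sum_i z 0 i * ureg1 e s i (a + r *: z)).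
Proof.
have Hq : is_derive r 1 (fun r => q (a + r *: z) + e) (\sum_i 2 * (a 0 i + r * z 0 i) * z 0 i).
  pose A := \sum_i a 0 i * z 0 i.
  have -> : (fun r => q (a + r *: z) + e) = (fun r => (q a + 2 * A * r + q z * r ^+ 2) + e).
    apply/funext => t; congr (_ + _); rewrite /cnorm2 /A mulr_sumr !mulr_suml -!big_split /=.
    by apply: eq_bigr => i _; rewrite !mxE; ring.
  have id1 := is_derive_id r (1 : R).
  have D2 : is_derive r 1 (fun r => r ^+ 2) (2 * r).
    by have := is_deriveM id1 id1; congr is_derive; rewrite /GRing.scale /=; ring.
  have := is_deriveD (is_deriveD (is_deriveD (is_derive_cst (q a) r (1 : R))
    (is_deriveZ (2 * A) id1)) (is_deriveZ (q z) D2)) (is_derive_cst e r (1 : R)).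
  congr is_derive; rewrite add0r addr0 /GRing.scale /= mulr1 /A /cnorm2 mulr_sumr mulr_suml -big_split /=.
  by apply: eq_bigr => i _; ring.
have q0 : 0 < q (a + r *: z) + e by exact: cnorm2D_gt0.
have Hp : is_derive (q (a + r *: z) + e) 1 (fun x : R => x `^ (- s)) (- s * (q (a + r *: z) + e) `^ (- s - 1)).
  exact: is_derive1_powR.
have := is_deriveN (is_derive_chain Hq Hp); congr is_derive.
rewrite mulr_sumr -sumrN; apply: eq_bigr => i _; rewrite /ureg1 /qpow !mxE; ring.
Qed.

End weighted_mean.

Section weighted_monotone.
Variables (R : realType) (n : nat) (e s : R).
Local Notation N := (n + n)%N.
Local Notation E := 'rV[R]_N.
Hypotheses (e0 : 0 < e) (s0 : 0 < s) (sN : 2 * (s + 1) <= N%:R).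
Local Notation g := (@ureg R n e s).
Local Notation q := (@cnorm2 R n).
(** The factor 1/2 in the derivative of [V] cancels the 2 of the gradient 2 z of |z|^2. The sign of
    [V] and the vanishing for t >= 1 give positivity and compact support in the integration by
    parts. *)
Variables (V w : R -> R).
Hypothesis dV : forall t : R, is_derive t (1 : R) V (w t / 2).
Hypothesis cw : continuous w.
Hypothesis w01 : forall t, 0 <= w t <= 1.
Hypothesis V0 : forall t, V t <= 0.
Hypothesis V1 : forall t, 1 <= t -> V t = 0.
Hypothesis w1 : forall t, 1 <= t -> w t = 0.
Variable a : E.

Let q1 x : ~ cube N 1 x -> 1 <= q x.
Proof.
move=> x1; rewrite leNgt; apply/negP => q1; apply: x1; apply: unit_ball_cube.
rewrite /unit_ball /= -(@ltr_pXn2r _ 2) ?nnegrE ?cnorm_ge0 // expr1n.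
by rewrite sqr_cnorm.
Qed.

Let cwq : continuous (fun z : E => w (q z)).
Proof. by move=> z; apply: continuous_comp; [exact: continuous_cnorm2|exact: cw]. Qed.

Let cV : continuous V.
Proof.
by move=> t; apply: differentiable_continuous; apply/derivable1_diffP; have [] := dV t.
Qed.

Let cVq : continuous (fun z : E => V (q z)).
Proof. by move=> z; apply: continuous_comp; [exact: continuous_cnorm2|exact: cV]. Qed.

Lemma continuous_affine r : continuous (fun z : E => a + r *: z).
Proof. by move=> z; apply: continuousD; [exact: cst_continuous|exact: scaler_continuous]. Qed.

Let continuous_comp_affine (r : R) (f : E -> R) : continuous f -> continuous (fun z : E => f (a + r *: z)).
Proof.
by move=> cf z; exact: (@continuous_comp _ _ _ (fun z : E => a + r *: z) f z (@continuous_affine r z) (cf _)).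
Qed.

Let dsum (r : R) (z : E) := \sum_i z 0 i * ureg1 e s i (a + r *: z) * w (q z).

(* The field [z |-> w (q z) z] is the gradient of [V \o q], so an integration by
   parts turns the integral into that of [- r * (V \o q)] against the Laplacian. *)
Lemma radial_derivative_integral_ge0 r : 0 <= r ->
  (0 <= \int[leb R N]_z (dsum r z)%:E)%E.
Proof.
move=> r0.
pose F i (z : E) := ureg1 e s i (a + r *: z) * (z 0 i * w (q z)).
pose G i (z : E) := - (r * ureg2 e s i i (a + r *: z) * V (q z)).
have cu1 i : continuous (fun z : E => ureg1 e s i (a + r *: z)).
  by apply: continuous_comp_affine; exact: continuous_ureg1.
have cu2 i : continuous (fun z : E => r * ureg2 e s i i (a + r *: z)).
  move=> z; apply: (@continuousM _ _ (cst r) (fun z : E => ureg2 e s i i (a + r *: z))).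
    exact: cst_continuous.
  by apply: continuous_comp_affine; exact: continuous_ureg2.
have czw i : continuous (fun z : E => z 0 i * w (q z)).
  by move=> z; apply: (@continuousM _ _ (fun z : E => z 0 i) (fun z => w (q z))); [exact: continuous_coor|exact: cwq].
have cG i : continuous (fun z : E => r * ureg2 e s i i (a + r *: z) * V (q z)).
  by move=> z; apply: (@continuousM _ _ (fun z : E => r * ureg2 e s i i (a + r *: z)) (fun z => V (q z))); [exact: cu2|exact: cVq].
have iF i : (leb R N).-integrable setT (EFin \o F i).
  apply: (@continuous_cube_integrable _ _ 1) => [z|z /q1 /w1 wz]; last by rewrite /F wz !mulr0.
  by apply: (@continuousM _ _ (fun z : E => ureg1 e s i (a + r *: z)) (fun z : E => z 0 i * w (q z))); [exact: cu1|exact: czw].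
have iG' i : (leb R N).-integrable setT (EFin \o (fun z : E => r * ureg2 e s i i (a + r *: z) * V (q z))).
  by apply: (@continuous_cube_integrable _ _ 1) => [|z /q1 /V1 ->]; [exact: cG|rewrite mulr0].
have iG i : (leb R N).-integrable setT (EFin \o G i).
  exact: (integrableN (iG' i)).
rewrite (_ : (\int[leb R N]_z _)%E = (\int[leb R N]_z (\sum_i F i z)%:E)%E); last first.
  by apply: eq_integral => z _; congr EFin; apply: eq_bigr => i _; rewrite /F; ring.
rewrite (@integral_sum_eq _ _ _ _ F G) //.
  apply: integral_ge0 => z _; rewrite lee_fin.
  have -> : \sum_i G i z = (r * - V (q z)) * \sum_i ureg2 e s i i (a + r *: z).
    by rewrite mulr_sumr; apply: eq_bigr => i _; rewrite /G; ring.
  by rewrite mulr_ge0 ?ureg_laplacian_ge0 // mulr_ge0 // oppr_ge0.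
move=> i.
have df (z : E) : is_derive z (delta_mx 0 i) (fun z : E => V (q z)) (z 0 i * w (q z)).
  by have := is_derive_chain (is_derive_cnorm2 i z) (dV (q z)); congr is_derive; field.
have dg (z : E) : is_derive z (delta_mx 0 i) (fun z : E => ureg1 e s i (a + r *: z)) (r * ureg2 e s i i (a + r *: z)).
  by apply: is_derive_affine; exact: is_derive_ureg1.
rewrite (@ibp R N i 1 _ _ _ _ df dg cVq (czw i) (cu1 i) (cu2 i)); last by move=> z /q1 /V1.
by rewrite -(integralN (integrable_add_def measurableT (iG' i))).
Qed.

Definition weighted_integral (r : R) : R :=
  \int[leb R N]_(z in cube N 1) (g (a + r *: z) * w (q z)).

Let integrable_bounded_cube (h : E -> R) (B : R) : measurable_fun setT h ->
  (forall z, cube N 1 z -> `|h z| <= B) -> (leb R N).-integrable (cube N 1) (EFin \o h).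
Proof.
move=> mh hB; apply: measurable_bounded_integrable.
- exact: measurable_cube.
- by rewrite [X in (X < _)%E](leb_cube N ler01) ltry.
- exact: measurable_funS mh.
- exists B; split=> [|b Bb z zc]; first exact: num_real.
  exact: le_trans (hB z zc) (ltW Bb).
Qed.

Let w_norm t : `|w t| <= 1.
Proof. by have /andP[h0 h1] := w01 t; rewrite ger0_norm. Qed.

Let wint r : (leb R N).-integrable (cube N 1) (EFin \o (fun z => g (a + r *: z) * w (q z))).
Proof.
apply: (@integrable_bounded_cube _ (e `^ (- s))) => [|z _].
  apply: continuous_measurable_rV => z.
  apply: (@continuousM _ _ (fun z : E => g (a + r *: z)) (fun z => w (q z))); last exact: cwq.
  by apply: continuous_comp_affine; exact: continuous_ureg.
by rewrite normrM -[leRHS]mulr1 ler_pM ?ureg_bounded.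
Qed.

Let dwint r (z : E) : is_derive r (1 : R) (fun r => g (a + r *: z) * w (q z)) (dsum r z).
Proof.
have := is_deriveM (@is_derive_ureg_radial R n e s e0 a z r) (is_derive_cst (w (q z)) r (1 : R)).
congr is_derive; rewrite /GRing.scale /= mulr0 add0r mulrC mulr_suml.
by apply: eq_bigr.
Qed.

(** The gradient bound [ureg1_bound] does not depend on r, so a constant on the cube dominates the
    derivatives and allows differentiation under the integral. *)
Lemma weighted_integral_derive r :
  derivable weighted_integral r (1 : R) /\ (0 <= r -> 0 <= derive1 weighted_integral r).
Proof.
pose f r (z : E) := g (a + r *: z) * w (q z).
pose B := N%:R * ureg1_bound e s.
have B0 : 0 <= B.
  by rewrite mulr_ge0 // /ureg1_bound !mulr_ge0 ?powR_ge0 ?addr_ge0 ?invr_ge0 ?(ltW s0) ?(ltW e0).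
have rI : `]r - 1, r + 1[%classic r by rewrite /= in_itv /= gtrBl ltrDl ltr01.
have iB : (leb R N).-integrable (cube N 1) (EFin \o (fun=> B)).
  by apply: (@integrable_bounded_cube _ B) => // z _; rewrite ger0_norm.
have d1 (t : R) (y : E) : derive1 (fun t => f t y) t = dsum t y.
  by rewrite derive1E; have [_] := dwint t y.
have fB (t : R) (y : E) : `]r - 1, r + 1[%classic t -> cube N 1 y -> `|derive1 (fun t => f t y) t| <= B.
  move=> _ yc; rewrite d1 /dsum; apply: le_trans (ler_norm_sum _ _ _) _.
  rewrite /B -[N in leRHS]card_ord mulr_natl -sumr_const; apply: ler_sum => i _.
  rewrite 2!normrM -[leRHS]mulr1 ler_pM ?mulr_ge0 // -[leRHS]mul1r ler_pM ?yc //.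
  exact: (ureg1_bounded e0 s0).
have df (t : R) (y : E) : `]r - 1, r + 1[%classic t -> cube N 1 y -> derivable (fun t => f t y) t 1.
  by move=> _ _; have [] := dwint t y.
have intf t : `]r - 1, r + 1[%classic t -> (leb R N).-integrable (cube N 1) (EFin \o f t).
  by move=> _; exact: wint.
split.
  exact: (@derivable_under_integral R _ _ (leb R N) f (cube N 1) (@measurable_cube R N 1) r (r - 1) (r + 1) rI
    intf df (fun=> B) (fun=> B0) iB fB).
move=> r0.
have -> := @differentiation_under_integral R _ _ (leb R N) f (cube N 1) (@measurable_cube R N 1) r (r - 1) (r + 1) rI
    intf df (fun=> B) (fun=> B0) iB fB.
rewrite /Rintegral fine_ge0 //.
rewrite (_ : (\int[leb R N]_(x in _) _)%E = (\int[leb R N]_z (dsum r z)%:E)%E).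
  exact: radial_derivative_integral_ge0.
rewrite [LHS]integral_mkcond; apply: eq_integral => z _; rewrite patchE; case: ifPn => zc.
  by congr EFin; exact: d1.
have wz : w (q z) = 0 by apply/w1/q1; move/negP: zc; rewrite inE.
by rewrite /dsum big1 // => i _; rewrite wz mulr0.
Qed.

Lemma weighted_integral_ge r : 0 <= r -> weighted_integral 0 <= weighted_integral r.
Proof.
move=> r0; apply: (@ger0_derive1_le_cc _ weighted_integral 0 r) => //.
- by move=> x _; have [] := weighted_integral_derive x.
- by move=> x; rewrite in_itv /= => /andP[x0 _]; have [_] := weighted_integral_derive x; apply; exact: ltW.
- apply: continuous_subspaceT => x; apply: differentiable_continuous; apply/derivable1_diffP.
  by have [] := weighted_integral_derive x.
- by rewrite in_itv /= lexx.
- by rewrite in_itv /= r0 lexx.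
Qed.

Lemma weighted_mean_ge0 r : 0 <= r ->
  (0 <= \int[leb R N]_(z in cube N 1) ((g (a + r *: z) - g a) * w (q z))%:E)%E.
Proof.
move=> r0; have := weighted_integral_ge r0; rewrite /weighted_integral /Rintegral.
have i0 := wint 0; have ir := wint r.
have iE : (\int[leb R N]_(z in cube N 1) ((g (a + r *: z) - g a) * w (q z))%:E =
  \int[leb R N]_(z in cube N 1) (EFin \o (fun z => (g (a + r *: z) * w (q z))%R)) z -
  \int[leb R N]_(z in cube N 1) (EFin \o (fun z => (g (a + 0 *: z) * w (q z))%R)) z)%E.
  rewrite -(integralB (@measurable_cube R N 1) ir i0).
  by apply: eq_integral => z _ /=; rewrite -EFinB scale0r addr0 mulrBl.
have sub_ge0 (x y : \bar R) : x \is a fin_num -> y \is a fin_num -> fine y <= fine x -> (0 <= x - y)%E.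
  by move=> fx fy yx; rewrite -(fineK fx) -(fineK fy) -EFinB lee_fin subr_ge0.
have f0 := integrable_fin_num (@measurable_cube R N 1) i0.
have fr := integrable_fin_num (@measurable_cube R N 1) ir.
by rewrite iE => h; exact: (sub_ge0 _ _ fr f0 h).
Qed.

End weighted_monotone.

(** * From continuous weights to annuli *)

Section trapezoid.
Variable R : realType.
Implicit Types (al be t x : R).

Definition clamp x : R := Num.max 0 (Num.min 1 x).

Lemma continuous_clamp : continuous clamp.
Proof.
move=> x; apply: (@continuous_max R R (cst 0) (fun x => Num.min 1 x)); first exact: cst_continuous.
by apply: (@continuous_min R R (cst 1) id); [exact: cst_continuous|exact: cvg_id].
Qed.

Lemma clamp_ge0 x : 0 <= clamp x. Proof. by rewrite le_max lexx. Qed.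

Lemma clamp_le1 x : clamp x <= 1. Proof. by rewrite ge_max ler01 ge_min lexx. Qed.

Lemma clamp_homo x y : x <= y -> clamp x <= clamp y.
Proof. by move=> xy; rewrite ge_max !le_max lexx /= le_min !ge_min lexx xy /= !orbT. Qed.

Lemma clamp_eq0 x : x <= 0 -> clamp x = 0.
Proof. by move=> x0; apply/max_idPl; rewrite ge_min x0 orbT. Qed.

Lemma clamp_eq1 x : 1 <= x -> clamp x = 1.
Proof. by move=> x1; rewrite /clamp (min_idPl x1); apply/max_idPr; rewrite ler01. Qed.

(* A continuous approximation of the indicator function of [al, be[. *)
Definition trapezoid (k : R) al be t : R := clamp (k * (be - t)) - clamp (k * (al - t)).

Lemma continuous_trapezoid (k : R) al be : continuous (trapezoid k al be).
Proof.
have H c : continuous (fun t => clamp (k * (c - t))).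
  move=> t; apply: (@continuous_comp _ _ _ (fun t => k * (c - t)) clamp); last exact: continuous_clamp.
  apply: (@continuousM _ _ (cst k) (fun t => c - t)); first exact: cst_continuous.
  by apply: (@continuousB _ _ _ (cst c) id); [exact: cst_continuous|exact: cvg_id].
by move=> t; apply: (@continuousB _ _ _ (fun t => clamp (k * (be - t)))); exact: H.
Qed.

Lemma trapezoid01 (k : R) al be t : 0 <= k -> al <= be -> 0 <= trapezoid k al be t <= 1.
Proof.
move=> k0 ab; rewrite /trapezoid subr_ge0 clamp_homo ?ler_wpM2l ?lerD2r //=.
by rewrite lerBlDr (le_trans (clamp_le1 _)) // lerDl clamp_ge0.
Qed.

Lemma trapezoid_ge (k : R) al be t : 0 <= k -> al <= be -> be <= t -> trapezoid k al be t = 0.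
Proof.
move=> k0 ab bt.
by rewrite /trapezoid !clamp_eq0 ?subrr // mulr_ge0_le0 // subr_le0 // (le_trans ab).
Qed.

Lemma trapezoid_le (k : R) al be t : 0 < k -> al <= be -> t <= al - k^-1 -> trapezoid k al be t = 0.
Proof.
move=> k0 ab ta; have H : 1 <= k * (al - t).
  by rewrite mulrC -ler_pdivrMr // mul1r lerBrDl -lerBrDr.
by rewrite /trapezoid !clamp_eq1 ?subrr // (le_trans H) // ler_pM2l // lerD2r.
Qed.

Lemma trapezoid_cvg al be t : al <= be ->
  trapezoid k.+1%:R al be t @[k --> \oo] --> ((al <= t < be)%R%:R : R).
Proof.
move=> ab.
have H c : clamp (k.+1%:R * (c - t)) @[k --> \oo] --> ((t < c)%R%:R : R).
  case: ltP => tc; last first.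
    by apply: cvg_near_cst; apply: nearW => k; rewrite clamp_eq0 // mulr_ge0_le0 // subr_le0.
  apply: cvg_near_cst; near=> k; rewrite clamp_eq1 //.
  rewrite -ler_pdivrMr ?subr_gt0 // mul1r (@le_trans _ _ k%:R) ?ler_nat //.
  by near: k; exact: nbhs_infty_ger.
have -> : (al <= t < be)%R%:R = (t < be)%R%:R - (t < al)%R%:R :> R.
  case: (ltP t al) => ta /=; last by rewrite subr0.
  by rewrite (lt_le_trans ta ab) subrr.
by apply: cvgB; exact: H.
Unshelve. all: by end_near. Qed.

(** Vanishing outside [c, 1] makes [w] integrable on the line, so its primitive from -oo exists
    everywhere. Subtracting the value at 1 makes it nonpositive, and zero from 1 on. *)
Lemma half_primitive (w : R -> R) c : continuous w -> (forall t, 0 <= w t) ->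
  (forall t, t <= c -> w t = 0) -> (forall t, 1 <= t -> w t = 0) ->
  exists V : R -> R, [/\ forall t, is_derive t (1 : R) V (w t / 2),
    forall t, V t <= 0 & forall t, 1 <= t -> V t = 0].
Proof.
move=> cw w0 wc w1; pose mu := @lebesgue_measure R.
have iw : mu.-integrable setT (EFin \o w).
  have ic : mu.-integrable `[c, 1] (EFin \o w).
    by apply: continuous_compact_integrable; [exact: segment_compact|exact: continuous_subspaceT].
  have [+ _] := @integrable_mkcond _ _ _ mu `[c, 1]%classic (EFin \o w) (measurable_itv _).
  move=> /(_ ic) H; move: H; congr (is_true (integrable mu setT _)).
  apply/funext => t /=; rewrite patchE; case: ifPn => // /negP; rewrite inE /= in_itv /= => tI.
  by congr EFin; case: (leP t c) => [/wc//|ct]; case: (leP 1 t) => [/w1//|t1]; case: tI; rewrite !ltW.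
pose F y := (\int[mu]_(t in `]-oo, y]) w t)%R.
have dF t : is_derive t (1 : R) F (w t).
  have [] := @continuous_FTC1 R w -oo%O t (t + 1) _ _ _ (cw t).
  - by rewrite ltrDl.
  - by apply: integrableS iw.
  - by rewrite ltNyr.
  by move=> d1 d2; apply: DeriveDef; [exact: d1|rewrite -derive1E; exact: d2].
have cF : continuous F.
  by move=> t; apply: differentiable_continuous; apply/derivable1_diffP; have [] := dF t.
have F1 t : derive1 F t = w t by rewrite derive1E; have [] := dF t.
have Fle x y : x <= y -> F x <= F y.
  move=> xy; apply: (@ger0_derive1_le_cc _ F x y) => //.
  - by move=> t _; rewrite F1.
  - exact: continuous_subspaceT.
  - by rewrite in_itv /= lexx.
  - by rewrite in_itv /= xy lexx.
have Fge t : 1 <= t -> F t <= F 1.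
  move=> t1; apply: (@ler0_derive1_le_cc _ F 1 t) => //.
  - by move=> x; rewrite in_itv /= => /andP[x1 _]; rewrite F1 w1 // ltW.
  - exact: continuous_subspaceT.
  - by rewrite in_itv /= t1 lexx.
  - by rewrite in_itv /= lexx.
exists (fun t => 2^-1 * (F t - F 1)); split.
- move=> t; have := is_deriveZ 2^-1 (is_deriveB (dF t) (is_derive_cst (F 1) t (1 : R))).
  by congr is_derive; rewrite subr0 /GRing.scale /= mulrC.
- move=> t; rewrite mulr_ge0_le0 ?invr_ge0 // subr_le0.
  by case: (leP t 1) => t1; [exact: Fle|exact: Fge (ltW t1)].
- by move=> t t1; rewrite (_ : F t = F 1) ?subrr ?mulr0 //; apply/eqP; rewrite eq_le Fge // Fle.
Qed.

End trapezoid.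

Section spherical_mean.
Variables (R : realType) (n : nat) (e s : R).
Local Notation N := (n + n)%N.
Local Notation E := 'rV[R]_N.
Hypotheses (e0 : 0 < e) (s0 : 0 < s) (sN : 2 * (s + 1) <= N%:R).
Local Notation g := (@ureg R n e s).
Local Notation q := (@cnorm2 R n).
Local Notation mu := (leb R N).
Variable a : E.

Definition annulus (al be : R) : set E := [set z | al <= q z < be].

Lemma measurable_annulus al be : measurable (annulus al be).
Proof.
have mq : measurable_fun setT q by apply: continuous_measurable_rV; exact: continuous_cnorm2.
rewrite (_ : annulus al be = q @^-1` `[al, be[%classic); last first.
  by apply/seteqP; split => z /=; rewrite in_itv.
by rewrite -[X in measurable X]setTI; apply: mq => //; exact: measurable_itv.
Qed.

Let q_lt1_cube z : q z < 1 -> cube N 1 z.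
Proof.
move=> q1; apply: unit_ball_cube.
by rewrite /unit_ball /= -(@ltr_pXn2r _ 2) ?nnegrE ?cnorm_ge0 // expr1n sqr_cnorm.
Qed.

Let measurable_shift (h : E -> E) : measurable_fun setT h -> measurable_fun setT (fun z => g (a + h z)).
Proof.
move=> mh; apply: (@measurableT_comp _ _ _ _ _ _ (fun z : E => g (a + z)) _ h) => //.
apply: continuous_measurable_rV => z.
apply: (@continuous_comp _ _ _ (fun z : E => a + z) g); last exact: continuous_ureg.
by apply: continuousD; [exact: cst_continuous|exact: cvg_id].
Qed.

Let measurable_dilation r : measurable_fun setT (fun z : E => r *: z).
Proof.
apply: measurable_fun_rVP => i.
rewrite (_ : (fun t => _) = (fun z : E => r * z 0 i)); last by apply/funext => z; rewrite mxE.
by apply: measurable_funM => //; exact: measurable_coor.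
Qed.

(** The trapezoids converge pointwise to the indicator of the half-open interval, and [ureg] is
    bounded, so dominated convergence applies. Half-open annuli are wanted because they tile the
    ball. *)
Lemma annulus_mean_ge0 al be r : 0 <= r -> al <= be -> be <= 1 ->
  (0 <= \int[mu]_(z in annulus al be) (g (a + r *: z) - g a)%:E)%E.
Proof.
move=> r0 ab b1.
pose h (z : E) : R := g (a + r *: z) - g a.
pose w k : R -> R := trapezoid k.+1%:R al be.
pose f (z : E) : R := h z * (al <= q z < be)%R%:R.
have mh : measurable_fun setT h.
  by apply: measurable_funB => //; apply: measurable_shift; exact: measurable_dilation.
have mwk k : measurable_fun setT (fun z : E => w k (q z)).
  apply: continuous_measurable_rV => z.
  by apply: (@continuous_comp _ _ _ q (w k)); [exact: continuous_cnorm2|exact: continuous_trapezoid].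
have h_le z : `|h z| <= e `^ (- s) + e `^ (- s).
  by rewrite (le_trans (ler_normB _ _)) // lerD // ureg_bounded.
have H3 z : (h z * w k (q z))%:E @[k --> \oo] --> (f z)%:E.
  apply: cvg_EFin; first by apply: nearW.
  by apply: cvgM; [exact: cvg_cst|exact: trapezoid_cvg].
have H1 k : measurable_fun (cube N 1) (fun z : E => (h z * w k (q z))%:E).
  by apply: measurable_funTS; apply/measurable_EFinP; exact: measurable_funM.
have H2 : measurable_fun (cube N 1) (EFin \o f).
  by apply: (emeasurable_fun_cvg (fun k z => (h z * w k (q z))%:E)) => // z _; exact: H3.
have H4 : mu.-integrable (cube N 1) (fun=> (e `^ (- s) + e `^ (- s))%:E).
  apply: (@measurable_bounded_integrable _ _ _ mu (cst (e `^ (- s) + e `^ (- s)))).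
  - exact: measurable_cube.
  - by rewrite [X in (X < _)%E](leb_cube N ler01) ltry.
  - exact: measurable_cst.
  - exists (e `^ (- s) + e `^ (- s)); split=> [|b Bb z zc]; first exact: num_real.
    by rewrite /= ger0_norm ?addr_ge0 ?powR_ge0 // ltW.
have H5 k z : (`|(h z * w k (q z))%:E| <= (e `^ (- s) + e `^ (- s))%:E)%E.
  have /andP[w0 w1] : 0 <= w k (q z) <= 1 by exact: trapezoid01.
  by rewrite /= lee_fin normrM -[leRHS]mulr1 ler_pM // ger0_norm.
have [_ _ H] := @dominated_convergence _ _ _ mu (cube N 1) (@measurable_cube R N 1)
  (fun k z => (h z * w k (q z))%:E) (EFin \o f) _ H1 H2
  (aeW _ (fun z _ => H3 z)) H4 (aeW _ (fun z k _ => H5 k z)).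
have -> : (\int[mu]_(z in annulus al be) (h z)%:E = \int[mu]_(z in cube N 1) (EFin \o f) z)%E.
  rewrite [LHS]integral_mkcond [RHS]integral_mkcond; apply: eq_integral => z _.
  rewrite !patchE /f; case: ifPn => [|/negP]; rewrite inE /annulus /= => zA.
    rewrite ifT; last by rewrite inE; apply: q_lt1_cube; case/andP: zA => _ /lt_le_trans; exact.
    by rewrite zA mulr1.
  by case: ifPn => // _; rewrite (negbTE (introN idP zA)) mulr0.
rewrite -(cvg_lim _ H) //; apply: lime_ge; first exact: cvgP H.
apply: nearW => k.
have k0 : 0 < k.+1%:R :> R by [].
have w0 t : 0 <= w k t <= 1 by exact: trapezoid01 (ltW k0) ab.
have wl t : t <= al - k.+1%:R^-1 -> w k t = 0 by exact: trapezoid_le.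
have wr t : 1 <= t -> w k t = 0 by move=> t1; apply: trapezoid_ge => //; exact: le_trans t1.
have cw : continuous (w k) by exact: continuous_trapezoid.
have [V [dV V0 V1]] := half_primitive cw (fun t => proj1 (andP (w0 t))) wl wr.
exact: (@weighted_mean_ge0 R n e s e0 s0 sN V (w k) dV cw w0 V0 V1 wr a r r0).
Qed.

Definition ureg_lipschitz : R := N%:R * ureg1_bound e s.

Lemma ureg_lipschitz_ge0 : 0 <= ureg_lipschitz.
Proof.
by rewrite mulr_ge0 // /ureg1_bound !mulr_ge0 ?powR_ge0 ?addr_ge0 ?invr_ge0 ?(ltW s0) ?(ltW e0).
Qed.

(** By the gradient bound, adding K t with K = [ureg_lipschitz] |z| to the function of t makes it
    nondecreasing. *)
Lemma ureg_radial_le (z : E) t t' : t <= t' ->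
  g (a + t *: z) <= g (a + t' *: z) + ureg_lipschitz * (cnorm z * (t' - t)).
Proof.
move=> tt'; pose K := ureg_lipschitz * cnorm z.
pose f t := g (a + t *: z) + K * t.
have df x : is_derive x (1 : R) f (\sum_i z 0 i * ureg1 e s i (a + x *: z) + K).
  have := is_deriveD (@is_derive_ureg_radial R n e s e0 a z x) (is_deriveZ K (is_derive_id x (1 : R))).
  by congr is_derive; rewrite /GRing.scale /= mulr1.
have d0 x : 0 <= derive1 f x.
  have -> : derive1 f x = \sum_i z 0 i * ureg1 e s i (a + x *: z) + K.
    by rewrite derive1E; have [] := df x.
  rewrite -lerBlDr sub0r lerNl.
  apply: le_trans (ler_norm _) _; rewrite normrN; apply: le_trans (ler_norm_sum _ _ _) _.
  rewrite /K /ureg_lipschitz -mulrA mulr_natl -[N in leRHS]card_ord -sumr_const; apply: ler_sum => i _.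
  rewrite normrM mulrC ler_pM //; first exact: ureg1_bounded.
  rewrite -(@ler_pXn2r _ 2) ?nnegrE ?cnorm_ge0 // real_normK ?num_real // sqr_cnorm.
  exact: sqr_coor_le.
have : f t <= f t'.
  apply: (@ger0_derive1_le_cc _ f t t') => //.
  - apply: continuous_subspaceT => x; apply: differentiable_continuous; apply/derivable1_diffP.
    by have [] := df x.
  - by rewrite in_itv /= lexx.
  - by rewrite in_itv /= tt' lexx.
rewrite /f -lerBrDr -addrA -mulrBr => h; apply: le_trans h _.
by rewrite mulrA.
Qed.

End spherical_mean.

Section geometric_annuli.
Variables (R : realType) (n : nat) (th : R).
Local Notation N := (n + n)%N.
Local Notation E := 'rV[R]_N.
Hypotheses (th0 : 0 < th) (th1 : th < 1).

(** Index 0 holds the origin, which no annulus reaches. The squares appear because [annulus] is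
    measured by |z|^2. *)
Definition geometric_annulus (j : nat) : set E :=
  if j is j'.+1 then annulus ((th ^+ j'.+1) ^+ 2) ((th ^+ j') ^+ 2) else [set 0].

Lemma measurable_geometric_annulus j : measurable (geometric_annulus j).
Proof.
case: j => [|j] /=; last exact: measurable_annulus.
by apply: measurable_compact_rV; exact: compact_set1.
Qed.

Lemma geometric_annulusE j (z : E) :
  geometric_annulus j.+1 z <-> th ^+ j.+1 <= cnorm z < th ^+ j.
Proof.
rewrite /= /annulus /= -sqr_cnorm.
by rewrite ler_pXn2r ?ltr_pXn2r ?nnegrE ?exprn_ge0 ?cnorm_ge0 ?(ltW th0).
Qed.

Lemma trivIset_geometric_annulus : trivIset setT geometric_annulus.
Proof.
apply: ltn_trivIset => j i ij; apply/seteqP; split=> // z [zi zj].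
case: j ij zj => // j ij zj.
have /andP[zj1 _] := (geometric_annulusE j z).1 zj.
have cz : 0 < cnorm z by apply: lt_le_trans zj1; rewrite exprn_gt0.
case: i ij zi => [_ /= z0|i ij zi]; first by rewrite z0 cnorm_gt0 eqxx in cz.
have /andP[zi1 _] := (geometric_annulusE i z).1 zi.
have /andP[_ zj2] := (geometric_annulusE j z).1 zj.
move: (lt_le_trans zj2 (le_trans (ler_wiXn2l (ltW th0) (ltW th1) (ij : (i.+1 <= j)%N)) zi1)).
by rewrite ltxx.
Qed.

Lemma unit_ball_geometric_annuli : @unit_ball R n = \bigcup_j geometric_annulus j.
Proof.
apply/seteqP; split=> z; last first.
  case=> -[_ /= ->|j _ /(proj1 (geometric_annulusE j z))/andP[_ zj]].
    by rewrite /unit_ball /= (_ : cnorm _ = 0) //; apply/eqP; rewrite cnorm_eq0.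
  by rewrite /unit_ball /=; apply: lt_le_trans zj _; rewrite exprn_ile1 // ltW.
rewrite /unit_ball /= => z1; have [->|z0] := eqVneq z 0; first by exists 0%N.
have ex : exists j, th ^+ j.+1 <= cnorm z.
  have : th ^+ k @[k --> \oo] --> 0 by apply: cvg_expr; rewrite ger0_norm // ltW.
  move=> /cvgr0_norm_lt/(_ (cnorm z)); rewrite cnorm_gt0 => /(_ z0)[k _ Hk].
  by exists k; have := Hk k.+1 (leqnSn k); rewrite ger0_norm ?exprn_ge0 ?(ltW th0) // => /ltW.
case: (ex_minnP ex) => j zj jmin; exists j.+1 => //; apply/geometric_annulusE; rewrite zj /=.
case: j zj jmin => [|j] zj jmin; first by rewrite expr0.
by rewrite ltNge; apply/negP => /jmin; rewrite ltnn.
Qed.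

End geometric_annuli.

Section sphere_mean_inequality.
Variables (R : realType) (n : nat) (s : R).
Local Notation N := (n + n)%N.
Local Notation E := 'rV[R]_N.
Hypotheses (s0 : 0 < s) (sN : 2 * (s + 1) <= N%:R).
Local Notation q := (@cnorm2 R n).
Local Notation mu := (leb R N).
Variable a : E.

Let measurable_ureg_radial e r : 0 < e -> measurable_fun setT (fun z : E => ureg e s (a + (r / cnorm z) *: z)).
Proof.
move=> e0; apply: (@measurableT_comp _ _ _ _ _ _ (fun z : E => ureg e s (a + z)) _ (fun z : E => (r / cnorm z) *: z)).
  apply: continuous_measurable_rV => z.
  apply: (@continuous_comp _ _ _ (fun z : E => a + z) (ureg e s)); last exact: continuous_ureg.
  by apply: continuousD; [exact: cst_continuous|exact: cvg_id].
exact: measurable_radial.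
Qed.

Let ball_integrable (h : E -> R) (B : R) (A : set E) : measurable A -> A `<=` @unit_ball R n ->
  measurable_fun setT h -> (forall z, `|h z| <= B) -> mu.-integrable A (EFin \o h).
Proof.
move=> mA AB mh hB; apply: measurable_bounded_integrable => //.
- apply: (@le_lt_trans _ _ (mu (@unit_ball R n))); last exact: unit_ball_lty.
  by apply: le_measure; rewrite ?inE //; exact: measurable_unit_ball.
- exact: measurable_funTS.
- exists B; split=> [|b Bb z zc]; first exact: num_real.
  exact: le_trans (hB z) (ltW Bb).
Qed.

(* For [th ^+ j.+1 <= cnorm z < th ^+ j], the points [a + (r / cnorm z) *: z] and
   [a + (r / th ^+ j) *: z] are at distance at most [r * (1 - th)]. *)
Lemma ureg_sphere_approx e th r : 0 < e -> 0 < th -> th < 1 -> 0 < r ->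
  (0 <= \int[mu]_(z in @unit_ball R n)
    (ureg e s (a + (r / cnorm z) *: z) - ureg e s a + ureg_lipschitz n e s * r * (1 - th))%:E)%E.
Proof.
move=> e0 th0 th1 r0; set c := _ * (1 - th).
have c0 : 0 <= c.
  by apply: mulr_ge0; [apply: mulr_ge0; [exact: ureg_lipschitz_ge0|exact: ltW]|rewrite subr_ge0 ltW].
pose h (z : E) := ureg e s (a + (r / cnorm z) *: z) - ureg e s a + c.
pose F := @geometric_annulus R n th.
have mF j : measurable (F j) by exact: measurable_geometric_annulus.
have mh : measurable_fun setT h.
  by apply: measurable_funD => //; apply: measurable_funB => //; exact: measurable_ureg_radial.
have h_le z : `|h z| <= e `^ (- s) + e `^ (- s) + c.
  rewrite (le_trans (ler_normD _ _)) // [X in _ + X]ger0_norm // lerD2r.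
  by rewrite (le_trans (ler_normB _ _)) // lerD // ureg_bounded.
have BF : @unit_ball R n = \bigcup_j F j by exact: unit_ball_geometric_annuli.
rewrite BF (@integral_bigcup _ _ _ mu F (EFin \o h)) //.
- apply: nneseries_ge0 => -[|j] _ _.
    (* At the origin the radial map takes the value 0, so the integrand is the constant c >= 0. *)
    apply: integral_ge0 => z ->; rewrite lee_fin /h (_ : (r / _) *: _ = 0) ?scaler0 //.
    by rewrite addr0 subrr add0r.
  have FB : F j.+1 `<=` @unit_ball R n by rewrite BF => z Fz; exists j.+1.
  (* On the annulus |z| < th^j gives t < r/|z|, so replacing the projection to the sphere by the
     dilation by t moves the point outwards along its ray by r (1 - |z|/th^j) <= r (1 - th). *)
  pose t := r / th ^+ j.
  have thj : 0 < th ^+ j by rewrite exprn_gt0.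
  have t0 : 0 <= t by rewrite divr_ge0 // ltW.
  apply: (@le_trans _ _ (\int[mu]_(z in F j.+1) (ureg e s (a + t *: z) - ureg e s a)%:E)%E).
    apply: annulus_mean_ge0 => //.
      by rewrite ler_pXn2r ?nnegrE ?exprn_ge0 ?(ltW th0) // ler_wiXn2l // ltW.
    by rewrite exprn_ile1 ?exprn_ge0 ?exprn_ile1 // ltW.
  apply: (le_integral (mF j.+1)) => [| |z].
  - apply: (@ball_integrable _ (e `^ (- s) + e `^ (- s))) => // [|z].
      apply: measurable_funB => //; apply: continuous_measurable_rV => z.
      apply: (@continuous_comp _ _ _ (fun z : E => a + t *: z) (ureg e s)); last exact: continuous_ureg.
      exact: continuous_affine.
    by rewrite (le_trans (ler_normB _ _)) // lerD // ureg_bounded.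
  - exact: ball_integrable h_le.
  rewrite inE => /(proj1 (geometric_annulusE th0 j z))/andP[z1 z2].
  have cz : 0 < cnorm z by apply: lt_le_trans z1; rewrite exprn_gt0.
  rewrite lee_fin /= /h addrAC lerD2r.
  have tt' : t <= r / cnorm z by rewrite ler_pM2l // lef_pV2 ?posrE // ltW.
  apply: le_trans (ureg_radial_le e0 s0 a z tt') _; rewrite lerD2l.
  have -> : c = ureg_lipschitz n e s * (r * (1 - th)) by rewrite mulrA.
  apply: ler_wpM2l; first exact: ureg_lipschitz_ge0.
  rewrite /t mulrBr mulrCA divff ?gt_eqF // mulr1 mulrBr mulr1 lerD2l lerN2.
  rewrite mulrCA ler_pM2l // ler_pdivlMr // -exprS.
  exact: z1.
- exact: trivIset_geometric_annulus.
- by rewrite -BF; apply: ball_integrable h_le => //; exact: measurable_unit_ball.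
Qed.

Lemma ureg_sphere_mean_ge e r : 0 < e -> 0 < r ->
  ((ureg e s a)%:E * mu (@unit_ball R n) <=
   \int[mu]_(z in @unit_ball R n) (ureg e s (a + (r / cnorm z) *: z))%:E)%E.
Proof.
move=> e0 r0; set G := fun z : E => ureg e s (a + (r / cnorm z) *: z).
have mB := @measurable_unit_ball R n.
have iG : mu.-integrable (@unit_ball R n) (EFin \o G).
  by apply: (@ball_integrable _ (e `^ (- s))) => // [|z]; [exact: measurable_ureg_radial|exact: ureg_bounded].
have [v vE] : exists v, mu (@unit_ball R n) = v%:E.
  by exists (fine (mu (@unit_ball R n))); rewrite fineK // ge0_fin_numE //; exact: unit_ball_lty.
have v0 : 0 <= v by rewrite -lee_fin -vE.
have [x xE] : exists x, (\int[mu]_(z in @unit_ball R n) (G z)%:E)%E = x%:E.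
  by exists (fine (\int[mu]_(z in @unit_ball R n) (G z)%:E)%E); rewrite fineK // (integrable_fin_num mB iG).
rewrite xE [X in (_ * X)%E]vE -EFinM lee_fin.
pose L := ureg_lipschitz n e s * r * v.
have L0 : 0 <= L by apply: mulr_ge0 => //; apply: mulr_ge0; [exact: ureg_lipschitz_ge0|exact: ltW].
have key th : 0 < th -> th < 1 -> ureg e s a * v <= x + L * (1 - th).
  move=> th0 th1; have := ureg_sphere_approx e0 th0 th1 r0.
  set c := _ * (1 - th).
  have icst (b : R) : mu.-integrable (@unit_ball R n) (EFin \o cst b).
    by apply: (@ball_integrable _ `|b|).
  rewrite (_ : (\int[mu]_(z in _) _)%E =
     (\int[mu]_(z in @unit_ball R n) ((EFin \o G) z + (EFin \o cst (c - ureg e s a)%R) z))%E); last first.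
    by apply: eq_integral => z _ /=; rewrite -EFinD /G addrAC addrA.
  rewrite (integralD mB iG (icst _)) xE.
  rewrite (integral_cst mu mB (c - ureg e s a)%:E) [X in (_ + _ * X)%E]vE -EFinM -EFinD lee_fin.
  by rewrite /c /L => H; rewrite -subr_ge0; apply: le_trans H _; rewrite le_eqVlt; apply/orP; left; apply/eqP; ring.
apply/ler_addgt0Pr => d d0.
(* The minimum with 1/2 keeps th in ]0, 1[; the other term makes L (1 - th) at most d. *)
pose th := 1 - Num.min 2^-1 (d / (L + 1)).
have L1 : 0 < L + 1 by rewrite ltr_wpDl.
have m0 : 0 < Num.min 2^-1 (d / (L + 1)) by rewrite lt_min divr_gt0 // andbT.
have m1 : Num.min 2^-1 (d / (L + 1)) < 1.
  by rewrite gt_min; apply/orP; left; rewrite invf_lt1 // ltr1n.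
apply: le_trans (key th _ _) _; rewrite /th ?subr_gt0 // ?gtrBl // lerD2l opprB addrC subrK.
apply: (@le_trans _ _ (L * (d / (L + 1)))); first by rewrite ler_wpM2l // ge_min lexx orbT.
rewrite mulrA ler_pdivrMr // mulrC ler_pM2l // lerDl.
by [].
Qed.

End sphere_mean_inequality.

Section usng_subharmonic.
Variables (R : realType) (n : nat) (s : R).
Local Notation N := (n + n)%N.
Local Notation E := 'rV[R]_N.
Hypotheses (s0 : 0 < s) (sN : 2 * (s + 1) <= N%:R).
Local Notation mu := (leb R N).

(** The values |u_e| increase to |u|, so monotone convergence applies to their means, each of which
    is at most |u_e(a)| <= |u(a)|. Working with absolute values also covers u(a) = -oo. *)
Lemma usng_sphere_mean_ge (a : E) (r : R) : 0 < r ->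
  (usng s a <= sphere_mean (usng s : E -> \bar R) a r)%E.
Proof.
move=> r0; have mB := @measurable_unit_ball R n.
have v0 := @unit_ball_gt0 R n; have v1 := @unit_ball_lty R n.
have vE : mu (@unit_ball R n) = (fine (mu (@unit_ball R n)))%:E by rewrite fineK // ge0_fin_numE.
have fv0 : 0 < fine (mu (@unit_ball R n)) by rewrite fine_gt0 // v0.
rewrite /sphere_mean; set v := fine _ in vE fv0 *.
rewrite lee_pdivlMr //.
pose T (z : E) := a + (r / cnorm z) *: z.
have mT : measurable_fun setT T.
  apply: (@measurableT_comp _ _ _ _ _ _ (fun z : E => a + z) _ (fun z : E => (r / cnorm z) *: z)).
    apply: measurable_fun_rVP => i.
    rewrite (_ : (fun t => _) = (fun z : E => a 0 i + z 0 i)); last by apply/funext => z; rewrite mxE.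
    by apply: measurable_funD => //; exact: measurable_coor.
  exact: measurable_radial.
have mq k : measurable_fun (@unit_ball R n) (fun z : E => (qpow (epsk R k) (- s) (T z))%:E).
  apply: measurable_funTS; apply/measurable_EFinP.
  apply: (measurableT_comp _ mT); apply: continuous_measurable_rV.
  by apply: continuous_qpow; exact: epsk_gt0.
have H := @cvg_monotone_convergence _ _ _ mu _ mB
  (fun k z => (qpow (epsk R k) (- s) (T z))%:E) mq.
have H0 k z : @unit_ball R n z -> (0 <= (qpow (epsk R k) (- s) (T z))%:E)%E.
  by move=> _; rewrite lee_fin powR_ge0.
have H1 z : @unit_ball R n z -> {homo (fun k => (qpow (epsk R k) (- s) (T z))%:E) : k l / (k <= l)%N >-> (k <= l)%E}.
  move=> _ k l kl; rewrite lee_fin; apply: qpow_anti => //; first exact: epsk_gt0.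
  by rewrite /epsk lef_pV2 ?posrE // ler_nat.
move: (H H0 H1) => {H}H.
have Hle : (\int[mu]_(z in @unit_ball R n) `|usng s (T z)| <= - usng s a * v%:E)%E.
  rewrite (_ : (\int[mu]_(z in _) _)%E =
    \int[mu]_(z in @unit_ball R n) (limn (fun k => (qpow (epsk R k) (- s) (T z))%:E)))%E; last first.
    by apply: eq_integral => z _; apply/esym/cvg_lim => //; exact: qpow_cvg.
  rewrite -(cvg_lim _ H) //; apply: lime_le; first exact: cvgP H.
  apply: nearW => k.
  have k0 := epsk_gt0 R k.
  have := @ureg_sphere_mean_ge R n s s0 sN a (epsk R k) r k0 r0.
  rewrite (_ : (\int[mu]_(z in _) _)%E =
    (\int[mu]_(z in @unit_ball R n) - (qpow (epsk R k) (- s) (T z))%:E)%E); last first.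
    by apply: eq_integral => z _; rewrite /ureg EFinN.
  rewrite integral_ge0N; last by move=> z _; rewrite lee_fin powR_ge0.
  rewrite {1}/ureg EFinN mulNe leeN2 => h; apply: le_trans h _.
  rewrite [X in (_ * X <= _)%E]vE lee_wpmul2r ?lee_fin ?(ltW fv0) //.
  by rewrite -usng_abse; exact: qpow_le_usng.
rewrite (_ : (\int[mu]_(z in _) _)%E = (\int[mu]_(z in @unit_ball R n) - `|usng s (T z)|)%E); last first.
  by apply: eq_integral => z _; rewrite usng_abse oppeK.
by rewrite integral_ge0N // leeNr -mulNe.
Qed.

Lemma usng_subharmonic : subharmonic setT (usng s : E -> \bar R).
Proof. by split=> [|a r r0 _]; [exact: usng_usc|exact: usng_sphere_mean_ge]. Qed.

End usng_subharmonic.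

Theorem theorem4p2 (R : realType) (m n : nat) (hm : (1 <= m)%N)
    (hmn : (m < n)%N) :
  exists (Om : set 'rV[R]_(n + n)) (u : 'rV[R]_(n + n) -> \bar R),
    [/\ open_nbhs (0 : 'rV[R]_(n + n)) Om,
        SH m Om u,
        is_lelong m u 0 0%E
      & forall gamma : R, 0 < gamma ->
          forall U : set 'rV[R]_(n + n), open_nbhs (0 : 'rV[R]_(n + n)) U -> U `<=` Om ->
            ~ (leb R (n + n)).-integrable U
                (fun z => expeR (- (gamma%:E * u z))%E)].
Proof.
have n2 : (2 <= n)%N by exact: leq_ltn_trans hm hmn.
have n0 : (0 < n)%N by exact: ltnW.
(* With N = 2 n this is 1/(2 N), for which 2 s N (N + 1) = N + 1 is an integer. The bounds that
   follow serve local integrability ([s2]), positivity of the current and the Lelong number ([sm]),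
   and the submean inequality ([sN]). *)
pose s : R := (n%:R * 4)^-1.
have nR2 : 2 <= n%:R :> R by rewrite ler_nat.
have n4 : 0 < n%:R * 4 :> R by lra.
have s0 : 0 < s by rewrite invr_gt0.
have s8 : s <= 8^-1 by rewrite lef_pV2 ?posrE //; lra.
have s2 : 2 * s < 1 by lra.
have sm : s * m%:R < 1.
  have mn : m%:R < n%:R :> R by rewrite ltr_nat.
  by rewrite mulrC ltr_pdivrMr // mul1r; lra.
have sN : 2 * (s + 1) <= (n + n)%:R by rewrite natrD; lra.
exists setT, (usng s); split.
- by split=> //; exact: openT.
- split.
  + by move=> z _; exact: usng_lty.
  + exact: usng_loc_integrable.
  + exact: usng_usc.
  + exact: usng_subharmonic.
  + by move=> b mb; apply: usng_ddc_wedge_ge0 => //; exact: ltW.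
- exact: usng_lelong.
- by move=> gamma g0 U oU _; apply: usng_not_exp_integrable.
Qed.
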